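(* Let $q,a,b,k$ be nonzero complex numbers with $|q|<1$, such that no zero factor occurs in any denominator below (including the denominators of the terms of the series) and all the series below converge absolutely. Then $$\frac{(qab/k,kq/b;q)_\infty\,(q,k^2q/a,q^2a,q^2a^2/k^2;q^2)_\infty}{(kq,qa/k;q)_\infty}\;{}_{6}\phi_{5}\left[\begin{matrix}-q\sqrt{k},\,\frac{k^2}{ab},\,b,\,\sqrt{qa},\,-\sqrt{qa},\,\frac{k^2}{a^2}\\ -\sqrt{k},\,\frac{qab}{k},\,\frac{qk}{b},\,k\sqrt{\frac{q}{a}},\,-k\sqrt{\frac{q}{a}}\end{matrix};q,-\frac{qa}{k}\right]$$ $$=\left(\frac{k^2q}{ab},bq,\frac{a^2bq^2}{k^2},\frac{q^2a}{b};q^2\right)_\infty$$ $$\times\;{}_{16}W_{15}\left(a;\frac{k^2}{ab},b,aq,\frac{kq}{a},\frac{k}{a},a\sqrt{\tfrac{q}{k}},-a\sqrt{\tfrac{q}{k}},a\sqrt{\tfrac{q^3}{k}},-a\sqrt{\tfrac{q^3}{k}},\frac{a}{\sqrt{k}},\frac{aq}{\sqrt{k}},-\frac{aq}{\sqrt{k}},-\frac{aq^2}{\sqrt{k}};\,q^2,\,q^2\right)$$ $$-q\,\frac{(1-aq^2)\left(1-\frac{k}{a}\right)\left(1-\frac{a}{\sqrt{k}}\right)\left(1+\frac{aq}{\sqrt{k}}\right)}{(1-q)(1-kq)(1-\sqrt{k}\,q)(1+\sqrt{k})}\left(\frac{k^2}{ab},b,\frac{a^2bq^3}{k^2},\frac{q^3a}{b};q^2\right)_\infty$$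 $$\times\;{}_{16}W_{15}\left(aq^2;\frac{k^2q}{ab},bq,aq,\frac{kq}{a},\frac{kq^2}{a},a\sqrt{\tfrac{q^3}{k}},-a\sqrt{\tfrac{q^3}{k}},a\sqrt{\tfrac{q^5}{k}},-a\sqrt{\tfrac{q^5}{k}},\frac{aq}{\sqrt{k}},\frac{aq^2}{\sqrt{k}},-\frac{aq^2}{\sqrt{k}},-\frac{aq^3}{\sqrt{k}};\,q^2,\,q^2\right).$$
   Context: Notation: $(x;q)_0=1$, $(x;q)_n=\prod_{j=0}^{n-1}(1-xq^j)$, $(x;q)_\infty=\prod_{j\ge 0}(1-xq^j)$, and $(x_1,\dots,x_m;q)_n=(x_1;q)_n\cdots(x_m;q)_n$ for $n$ a nonnegative integer or $\infty$. In expressions such as $k^2/ab$ the whole product after the slash is the denominator. Basic hypergeometric series: $${}_{r+1}\phi_r\left[\begin{matrix}a_1,\dots,a_{r+1}\\ b_1,\dots,b_r\end{matrix};p,x\right]=\sum_{n=0}^{\infty}\frac{(a_1,\dots,a_{r+1};p)_n}{(p,b_1,\dots,b_r;p)_n}x^n .$$ The very-well-poised series with base $p$ (here $p=q^2$) is $${}_{r+1}W_{r}(a_1;a_4,\dots,a_{r+1};p,x)=\sum_{n=0}^{\infty}\frac{(a_1,p\sqrt{a_1},-p\sqrt{a_1},a_4,\dots,a_{r+1};p)_n}{(p,\sqrt{a_1},-\sqrt{a_1},\frac{a_1p}{a_4},\dots,\frac{a_1p}{a_{r+1}};p)_n}\,x^n .$$ Here $\sqrt{k}$ is one fixed complex square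 root of $k$, the same throughout; every other square root is an arbitrary fixed choice (it occurs together with its negative). *)

(* Defs.v *)
From Stdlib Require Export Reals List.
From Coquelicot Require Export Coquelicot.
Export ListNotations.
Open Scope C_scope.

(** Limits and sums of complex sequences, through real and imaginary parts.
    As with [Lim_seq] and [Series], the value is meaningful only in case of
    convergence. *)
Definition CLim_seq (u : nat -> C) : C :=
  (real (Lim_seq (fun n => Re (u n))), real (Lim_seq (fun n => Im (u n)))).

Definition CSeries (u : nat -> C) : C :=
  (Series (fun n => Re (u n)), Series (fun n => Im (u n))).

Definition abs_convergent (u : nat -> C) : Prop :=
  ex_series (fun n => Cmod (u n)).

Fixpoint qpoch (x q : C) (n : nat) : C :=
  match n with
  | O => 1
  | S m => qpoch x q m * (1 - x * q ^ m)
  end.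

Definition qpoch_inf (x q : C) : C := CLim_seq (qpoch x q).

Definition Cprod (xs : list C) : C := fold_right Cmult 1 xs.

Definition qpochs (xs : list C) (q : C) (n : nat) : C :=
  Cprod (map (fun x => qpoch x q n) xs).

Definition qpochs_inf (xs : list C) (q : C) : C :=
  Cprod (map (fun x => qpoch_inf x q) xs).

(** No factor [1 - x q^j] of [(xs; q)_n], for [n] finite or infinite, is zero. *)
Definition no_zero_factor (xs : list C) (q : C) : Prop :=
  forall x, In x xs -> forall j : nat, 1 - x * q ^ j <> 0.

(** The series [_{r+1}phi_r] with upper parameters [us] and lower parameters
    [ls]; to be used with [length us = S (length ls)]. *)
Definition phi_term (us ls : list C) (p x : C) (n : nat) : C :=
  qpochs us p n / qpochs (p :: ls) p n * x ^ n.

Definition phi (us ls : list C) (p x : C) : C := CSeries (phi_term us ls p x).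

Definition phi_admissible (us ls : list C) (p x : C) : Prop :=
  no_zero_factor (p :: ls) p /\ abs_convergent (phi_term us ls p x).

(** The very-well-poised series [W(a1; cs; p, x)], where [cs] lists
    [a_4, ..., a_{r+1}] and [s] is a chosen square root of [a1]. *)
Definition W_upper (a1 s : C) (cs : list C) (p : C) : list C :=
  a1 :: p * s :: - (p * s) :: cs.

Definition W_lower (a1 s : C) (cs : list C) (p : C) : list C :=
  s :: - s :: map (fun c => a1 * p / c) cs.

Definition W (a1 s : C) (cs : list C) (p x : C) : C :=
  phi (W_upper a1 s cs p) (W_lower a1 s cs p) p x.

Definition W_admissible (a1 s : C) (cs : list C) (p x : C) : Prop :=
  phi_admissible (W_upper a1 s cs p) (W_lower a1 s cs p) p x.

(** Parameters of the three series of the identity.  The square roots are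
    passed as [sk] for k, [sqa] for qa, [sq_a] for q/a, and [r1], [r3], [r5]
    for q/k, q^3/k, q^5/k. *)
Definition phi65_upper (q a b k sk sqa : C) : list C :=
  [ - (q * sk); k ^ 2 / (a * b); b; sqa; - sqa; k ^ 2 / a ^ 2 ].

Definition phi65_lower (q a b k sk sq_a : C) : list C :=
  [ - sk; q * a * b / k; q * k / b; k * sq_a; - (k * sq_a) ].

Definition W1_params (q a b k sk r1 r3 : C) : list C :=
  [ k ^ 2 / (a * b); b; a * q; k * q / a; k / a;
    a * r1; - (a * r1); a * r3; - (a * r3);
    a / sk; a * q / sk; - (a * q / sk); - (a * q ^ 2 / sk) ].

Definition W2_params (q a b k sk r3 r5 : C) : list C :=
  [ k ^ 2 * q / (a * b); b * q; a * q; k * q / a; k * q ^ 2 / a;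
    a * r3; - (a * r3); a * r5; - (a * r5);
    a * q / sk; a * q ^ 2 / sk; - (a * q ^ 2 / sk); - (a * q ^ 3 / sk) ].

(* Main.v *)
Require Import Defs.
From Stdlib Require Import Lra Lia Classical.

(** The two series on the right are the even and the odd terms of a single
    series over the base [q]. The proof shows that this series and the 6phi5 on
    the left arise from one double sum, by summation over its rows and over its
    diagonals.

    The parameters are written as [A = k^2/(ab)], [B = b], [P = a/k] and
    [s = sqrt k], so that [a = A B P^2] and [k = A B P]. The general term of the
    6phi5 has the factor [(k^2/a^2;q)_n (1 + s q^n) / ((q;q)_n (1 + s))]. This
    factor is a very-well-poised sum over [r <= n], a WP Bailey pair relative to
    [a] ([beta_sum]). Two weighted versions of that sum satisfy a linear
    recursion in [n], which is found by telescoping and solved in closed form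
    ([wp_rec], [wp_closed]).

    Insert this sum into the 6phi5, write [n = m + r], and sum over [m] first. For
    fixed [r] the inner series is a multiple of the non-terminating q-analogue of
    Watson's series with parameters [A q^r], [B q^r] and [P] ([entry_factor]). Its
    value ([watson_sum]) is a product, and with this product the row becomes the
    term of index [r] of the right-hand side ([row_sum_full]). Watson's sum itself
    is obtained from a recursion under [P -> q P], again by telescoping. Iteration
    lets [P] tend to [0], where the series becomes the q-analogue of Gauss's
    second theorem ([gauss_second]).

    The exchange of the two summations is an estimate. The entry at [(m, r)] is of
    order [|q P|^m |q|^r], which suffices if [|q P| < 1]; if [A] or [B] is a
    non-positive power of [q], only finitely many diagonals are nonzero
    ([nondegenerate_limit]). Absolute convergence of the 6phi5 forces one of these
    situations ([left_term_convergent]), with one exception: it may also terminate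
    because [a q^(2N+1) = 1].

    In that case every sum is finite, but the rows are truncated Watson series.
    The same recursion evaluates them, and a three-term theta function identity
    ([theta_identity]) writes the value as a sum of two products
    ([watson_truncated_sum]). The first one is the term of index [r] of the
    right-hand side. The second one is its term of index [2 N + 1 - r], read
    backwards ([right_term_reverse]). The rows [r <= N] thus give all terms once.
    The theta function identity follows from Watson's sum: when [A B q P^2 = 1],
    the series without its first term is again a Watson series
    ([watson_term_tail]). *)

(** * Limits and sums of complex sequences *)

Definition tends (u : nat -> C) (l : C) : Prop :=
  is_lim_seq (fun n => Cmod (u n - l)) 0%R.

Fixpoint csum (u : nat -> C) (n : nat) : C :=
  match n with
  | O => 0
  | S m => csum u m + u m
  end.

Definition sums (u : nat -> C) (l : C) : Prop := tends (csum u) l.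

Lemma tends_squeeze (u : nat -> C) (l : C) (e : nat -> R) (N : nat) :
  (forall n, (N <= n)%nat -> (Cmod (u n - l) <= e n)%R) ->
  is_lim_seq e 0%R -> tends u l.
Proof.
  intros H He. unfold tends.
  apply is_lim_seq_le_le_loc with (u := fun _ => 0%R) (w := e).
  - exists N. intros n Hn. split. apply Cmod_ge_0. apply H; exact Hn.
  - apply is_lim_seq_const.
  - exact He.
Qed.

Lemma tends_const (c : C) : tends (fun _ => c) c.
Proof.
  apply (tends_squeeze _ _ (fun _ => 0%R) 0).
  - intros n _. replace (c - c) with (RtoC 0) by ring. rewrite Cmod_0. lra.
  - apply is_lim_seq_const.
Qed.

Lemma tends_eps (u : nat -> C) (l : C) (e : R) :
  tends u l -> (0 < e)%R -> exists N, forall n, (N <= n)%nat -> (Cmod (u n - l) < e)%R.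
Proof.
  intros H He. apply is_lim_seq_spec in H. destruct (H (mkposreal _ He)) as [N HN].
  exists N. intros n Hn. specialize (HN n Hn). simpl in HN.
  now rewrite Rminus_0_r, Rabs_pos_eq in HN by apply Cmod_ge_0.
Qed.

Lemma is_lim_seq_scal_geom (K w : R) :
  (0 <= w < 1)%R -> is_lim_seq (fun n => K * w ^ n)%R 0%R.
Proof.
  intros Hw. replace (Finite 0) with (Finite (K * 0)) by (f_equal; ring).
  apply (is_lim_seq_scal_l _ K 0%R). apply is_lim_seq_geom. rewrite Rabs_pos_eq; lra.
Qed.

Lemma tends_ext_ev (u v : nat -> C) (l : C) (N : nat) :
  (forall n, (N <= n)%nat -> u n = v n) -> tends u l -> tends v l.
Proof.
  intros H Hu. apply (tends_squeeze _ _ (fun n => Cmod (u n - l)) N).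
  - intros n Hn. rewrite (H n Hn). lra.
  - exact Hu.
Qed.

Lemma tends_ext (u v : nat -> C) (l : C) :
  (forall n, u n = v n) -> tends u l -> tends v l.
Proof. intros H. apply (tends_ext_ev u v l 0). intros n _; apply H. Qed.

Lemma tends_plus (u v : nat -> C) (l m : C) :
  tends u l -> tends v m -> tends (fun n => u n + v n) (l + m).
Proof.
  intros Hu Hv.
  apply (tends_squeeze _ _ (fun n => Cmod (u n - l) + Cmod (v n - m))%R 0).
  - intros n _. replace (u n + v n - (l + m)) with ((u n - l) + (v n - m)) by ring.
    apply Cmod_triangle.
  - replace (Finite 0) with (Finite (0 + 0)) by (f_equal; ring).
    now apply is_lim_seq_plus'.
Qed.

Lemma tends_mult (u v : nat -> C) (l m : C) :
  tends u l -> tends v m -> tends (fun n => u n * v n) (l * m).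
Proof.
  intros Hu Hv.
  apply (tends_squeeze _ _ (fun n => Cmod (u n - l) * Cmod (v n - m)
    + (Cmod l * Cmod (v n - m) + Cmod m * Cmod (u n - l)))%R 0).
  - intros n _.
    replace (u n * v n - l * m)
      with ((u n - l) * (v n - m) + (l * (v n - m) + m * (u n - l))) by ring.
    eapply Rle_trans. apply Cmod_triangle. rewrite Cmod_mult.
    apply Rplus_le_compat_l. eapply Rle_trans. apply Cmod_triangle.
    rewrite !Cmod_mult. lra.
  - replace (Finite 0) with (Finite (0 * 0 + (Cmod l * 0 + Cmod m * 0)))
      by (f_equal; ring).
    apply is_lim_seq_plus'. now apply is_lim_seq_mult'.
    apply is_lim_seq_plus'.
    apply (is_lim_seq_scal_l _ (Cmod l) 0%R Hv).
    apply (is_lim_seq_scal_l _ (Cmod m) 0%R Hu).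
Qed.

Lemma tends_scal (c : C) (u : nat -> C) (l : C) :
  tends u l -> tends (fun n => c * u n) (c * l).
Proof. intros H. apply (tends_mult (fun _ => c)); [apply tends_const | exact H]. Qed.

Lemma tends_opp (u : nat -> C) (l : C) : tends u l -> tends (fun n => - u n) (- l).
Proof.
  intros H. replace (- l) with (- (1) * l) by ring.
  apply (tends_ext (fun n => - (1) * u n)). intros; ring. now apply tends_scal.
Qed.

Lemma tends_minus (u v : nat -> C) (l m : C) :
  tends u l -> tends v m -> tends (fun n => u n - v n) (l - m).
Proof. intros Hu Hv. apply tends_plus; [exact Hu | now apply tends_opp]. Qed.

Lemma tends_unique (u : nat -> C) (l m : C) : tends u l -> tends u m -> l = m.
Proof.
  intros Hl Hm.
  assert (H := tends_minus _ _ _ _ Hl Hm).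
  assert (H0 : tends (fun _ => 0) (l - m)).
  { apply (tends_ext (fun n => u n - u n)). intros; ring. exact H. }
  unfold tends in H0. apply is_lim_seq_unique in H0.
  rewrite Lim_seq_const in H0. injection H0 as H0.
  apply Cmod_eq_0 in H0.
  replace l with (m - (0 - (l - m))) by ring. rewrite H0. ring.
Qed.

Lemma tends_shift (u : nat -> C) (l : C) (k : nat) :
  tends u l -> tends (fun n => u (n + k)%nat) l.
Proof. intros H. exact (proj1 (is_lim_seq_incr_n _ k 0%R) H). Qed.

Lemma tends_unshift (u : nat -> C) (l : C) (k : nat) :
  tends (fun n => u (n + k)%nat) l -> tends u l.
Proof. intros H. exact (proj2 (is_lim_seq_incr_n _ k 0%R) H). Qed.

Lemma tends_double (u : nat -> C) (l : C) :
  tends u l -> tends (fun n => u (2 * n)%nat) l.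
Proof.
  intros H. unfold tends.
  apply (is_lim_seq_subseq (fun n => Cmod (u n - l)) 0%R (fun n => (2 * n)%nat)).
  - apply eventually_subseq. intros n. lia.
  - exact H.
Qed.

Lemma tends_away (u : nat -> C) (l : C) :
  tends u l -> l <> 0 ->
  exists N, forall n, (N <= n)%nat -> (Cmod l / 2 <= Cmod (u n))%R.
Proof.
  intros H Hl. apply Cmod_gt_0 in Hl.
  destruct (tends_eps u l (Cmod l / 2) H ltac:(lra)) as [N HN].
  exists N. intros n Hn. specialize (HN n Hn).
  assert (Ht := Cmod_triangle (u n) (- (u n - l))).
  rewrite Cmod_opp in Ht. replace (u n + - (u n - l)) with l in Ht by ring. lra.
Qed.

Lemma tends_inv (u : nat -> C) (l : C) :
  tends u l -> l <> 0 -> tends (fun n => / u n) (/ l).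
Proof.
  intros H Hl. destruct (tends_away u l H Hl) as [N HN].
  assert (Hm := proj1 (Cmod_gt_0 l) Hl).
  apply (tends_squeeze _ _ (fun n => (2 / (Cmod l * Cmod l)) * Cmod (u n - l))%R N).
  - intros n Hn. specialize (HN n Hn).
    assert (Hu : u n <> 0) by (apply Cmod_gt_0; lra).
    replace (/ u n - / l) with (- (u n - l) * / (u n * l)) by (field; auto).
    rewrite Cmod_mult, Cmod_opp, Cmod_inv, Cmod_mult by (now apply Cmult_neq_0).
    rewrite Rmult_comm. apply Rmult_le_compat_r. apply Cmod_ge_0.
    replace (2 / (Cmod l * Cmod l))%R with (/ (Cmod l / 2 * Cmod l))%R by (field; lra).
    apply Rinv_le_contravar. nra. nra.
  - replace (Finite 0) with (Finite ((2 / (Cmod l * Cmod l)) * 0))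
      by (f_equal; ring).
    exact (is_lim_seq_scal_l _ (2 / (Cmod l * Cmod l))%R 0%R H).
Qed.

Lemma tends_div (u v : nat -> C) (l m : C) :
  tends u l -> tends v m -> m <> 0 -> tends (fun n => u n / v n) (l / m).
Proof. intros Hu Hv Hm. apply tends_mult; [exact Hu | now apply tends_inv]. Qed.

Lemma tends_pow_geom (q : C) : (Cmod q < 1)%R -> tends (fun n => q ^ n) 0.
Proof.
  intros H. apply (tends_squeeze _ _ (fun n => (Cmod q ^ n)%R) 0).
  - intros n _. replace (q ^ n - 0) with (q ^ n) by ring. rewrite Cmod_pow. lra.
  - apply is_lim_seq_geom. rewrite Rabs_pos_eq by apply Cmod_ge_0. exact H.
Qed.

Lemma im_le_Cmod (c : C) : (Rabs (Im c) <= Cmod c)%R.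
Proof. eapply Rle_trans; [apply Rmax_r | apply Rmax_Cmod]. Qed.

Lemma Re_csum (u : nat -> C) (n : nat) :
  Re (csum u (S n)) = sum_n (fun i => Re (u i)) n.
Proof.
  induction n as [|n IH].
  - rewrite sum_O. simpl. apply Rplus_0_l.
  - rewrite sum_Sn, <- IH. reflexivity.
Qed.

Lemma Im_csum (u : nat -> C) (n : nat) :
  Im (csum u (S n)) = sum_n (fun i => Im (u i)) n.
Proof.
  induction n as [|n IH].
  - rewrite sum_O. simpl. apply Rplus_0_l.
  - rewrite sum_Sn, <- IH. reflexivity.
Qed.

Lemma tends_parts (u : nat -> C) (l : C) :
  tends u l <->
  is_lim_seq (fun n => Re (u n)) (Re l) /\ is_lim_seq (fun n => Im (u n)) (Im l).
Proof.
  split.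
  - intros H. split.
    + apply is_lim_seq_spec. intros eps.
      destruct (tends_eps u l eps H (cond_pos eps)) as [N HN]. exists N.
      intros n Hn. eapply Rle_lt_trans; [|exact (HN n Hn)].
      exact (re_le_Cmod (u n - l)).
    + apply is_lim_seq_spec. intros eps.
      destruct (tends_eps u l eps H (cond_pos eps)) as [N HN]. exists N.
      intros n Hn. eapply Rle_lt_trans; [|exact (HN n Hn)].
      exact (im_le_Cmod (u n - l)).
  - intros [Hr Hi].
    apply (tends_squeeze _ _
      (fun n => Rabs (Re (u n) - Re l) + Rabs (Im (u n) - Im l))%R 0).
    + intros n _. replace (u n - l)
        with (RtoC (Re (u n) - Re l)%R + Ci * RtoC (Im (u n) - Im l)%R).
      * eapply Rle_trans. apply Cmod_triangle. rewrite Cmod_mult, !Cmod_R.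
        replace (Cmod Ci) with 1%R. lra.
        unfold Cmod, Ci; simpl. transitivity (sqrt 1). now rewrite sqrt_1. f_equal. ring.
      * unfold Cminus, Cplus, Cmult, Copp, Ci, RtoC, Re, Im. simpl.
        f_equal; ring.
    + replace (Finite 0) with (Finite (0 + 0)) by (f_equal; ring).
      apply is_lim_seq_plus'.
      * replace (Finite 0) with (Rbar_abs (Finite 0)) by (simpl; now rewrite Rabs_R0).
        apply is_lim_seq_abs.
        replace (Finite 0) with (Finite (Re l - Re l)) by (f_equal; ring).
        apply is_lim_seq_minus'; [exact Hr | apply is_lim_seq_const].
      * replace (Finite 0) with (Rbar_abs (Finite 0)) by (simpl; now rewrite Rabs_R0).
        apply is_lim_seq_abs.
        replace (Finite 0) with (Finite (Im l - Im l)) by (f_equal; ring).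
        apply is_lim_seq_minus'; [exact Hi | apply is_lim_seq_const].
Qed.

Lemma tends_CLim_seq (u : nat -> C) (l : C) : tends u l -> CLim_seq u = l.
Proof.
  intros H. apply tends_parts in H. destruct H as [Hr Hi].
  unfold CLim_seq. rewrite (is_lim_seq_unique _ _ Hr), (is_lim_seq_unique _ _ Hi).
  destruct l; reflexivity.
Qed.

Lemma sums_CSeries (u : nat -> C) (l : C) : sums u l -> CSeries u = l.
Proof.
  intros H. apply (tends_shift _ _ 1) in H. apply tends_parts in H.
  destruct H as [Hr Hi]. unfold CSeries.
  assert (H1 : is_series (fun n => Re (u n)) (Re l)).
  { apply is_lim_seq_ext with (2 := Hr). intros n. rewrite Nat.add_1_r.
    apply Re_csum. }
  assert (H2 : is_series (fun n => Im (u n)) (Im l)).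
  { apply is_lim_seq_ext with (2 := Hi). intros n. rewrite Nat.add_1_r.
    apply Im_csum. }
  rewrite (is_series_unique _ _ H1), (is_series_unique _ _ H2).
  destruct l; reflexivity.
Qed.

Lemma summable_dom (u : nat -> C) (M : nat -> R) :
  (forall n, (Cmod (u n) <= M n)%R) -> ex_series M -> exists l, sums u l.
Proof.
  intros H HM.
  assert (Hr : ex_series (fun n => Re (u n))).
  { apply (ex_series_le (K := R_AbsRing) (V := R_CompleteNormedModule)) with (b := M).
    intros n. eapply Rle_trans; [apply re_le_Cmod | apply H]. exact HM. }
  assert (Hi : ex_series (fun n => Im (u n))).
  { apply (ex_series_le (K := R_AbsRing) (V := R_CompleteNormedModule)) with (b := M).
    intros n. eapply Rle_trans; [apply im_le_Cmod | apply H]. exact HM. }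
  destruct Hr as [lr Hr], Hi as [li Hi]. exists (lr, li).
  apply (tends_unshift _ _ 1). apply tends_parts. split.
  - apply is_lim_seq_ext with (2 := Hr). intros n. rewrite Nat.add_1_r.
    symmetry. apply Re_csum.
  - apply is_lim_seq_ext with (2 := Hi). intros n. rewrite Nat.add_1_r.
    symmetry. apply Im_csum.
Qed.

Lemma ex_series_geom_scal (K w : R) :
  (0 <= w < 1)%R -> ex_series (fun n => K * w ^ n)%R.
Proof.
  intros Hw. apply (ex_series_scal_l K (fun n => w ^ n)%R).
  apply ex_series_geom. rewrite Rabs_pos_eq; lra.
Qed.

Lemma sums_abs_convergent (u : nat -> C) : abs_convergent u -> sums u (CSeries u).
Proof.
  intros H. destruct (summable_dom u (fun n => Cmod (u n))) as [l Hl].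
  - intros; lra.
  - exact H.
  - now rewrite (sums_CSeries u l Hl).
Qed.

Lemma csum_S (u : nat -> C) (n : nat) : csum u (S n) = csum u n + u n.
Proof. reflexivity. Qed.

Lemma csum_ext (u v : nat -> C) (n : nat) :
  (forall i, (i < n)%nat -> u i = v i) -> csum u n = csum v n.
Proof.
  induction n as [|n IH]; intros H; simpl. reflexivity.
  rewrite IH, H by (auto || lia). reflexivity.
Qed.

Lemma csum_scal (c : C) (u : nat -> C) (n : nat) :
  csum (fun i => c * u i) n = c * csum u n.
Proof. induction n as [|n IH]; simpl. ring. rewrite IH. ring. Qed.

Lemma csum_plus (u v : nat -> C) (n : nat) :
  csum (fun i => u i + v i) n = csum u n + csum v n.
Proof. induction n as [|n IH]; simpl. ring. rewrite IH. ring. Qed.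

Lemma csum_add (u : nat -> C) (n m : nat) :
  csum u (n + m) = csum u n + csum (fun i => u (n + i)%nat) m.
Proof.
  induction m as [|m IH]; simpl.
  - rewrite Nat.add_0_r. ring.
  - rewrite Nat.add_succ_r. simpl. rewrite IH. ring.
Qed.

Lemma csum_zero (u : nat -> C) (n : nat) :
  (forall i, (i < n)%nat -> u i = 0) -> csum u n = 0.
Proof.
  induction n as [|n IH]; intros H; simpl. reflexivity.
  rewrite IH, H by (auto || lia). ring.
Qed.

Lemma sums_finite (u : nat -> C) (N : nat) :
  (forall n, (N <= n)%nat -> u n = 0) -> sums u (csum u N).
Proof.
  intros H. apply (tends_unshift _ _ N).
  apply (tends_ext (fun _ => csum u N)); [|apply tends_const].
  intros n. rewrite Nat.add_comm, csum_add.
  rewrite (csum_zero (fun i => u (N + i)%nat)). ring.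
  intros i _. apply H. lia.
Qed.

Lemma Cmod_csum_geom (u : nat -> C) (K w : R) (n : nat) :
  (0 <= w < 1)%R -> (0 <= K)%R ->
  (forall i, (i < n)%nat -> (Cmod (u i) <= K * w ^ i)%R) ->
  (Cmod (csum u n) <= K / (1 - w) * (1 - w ^ n))%R.
Proof.
  intros Hw HK. induction n as [|n IH]; intros H; simpl csum.
  - rewrite Cmod_0. simpl. lra.
  - eapply Rle_trans. apply Cmod_triangle.
    specialize (IH (fun i Hi => H i (Nat.lt_lt_succ_r _ _ Hi))).
    specialize (H n (Nat.lt_succ_diag_r n)).
    replace (K / (1 - w) * (1 - w ^ S n))%R
      with (K / (1 - w) * (1 - w ^ n) + K * w ^ n)%R.
    lra. simpl. field. lra.
Qed.

Lemma tends_Cmod_le (u : nat -> C) (l : C) (K : R) :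
  tends u l -> (forall n, (Cmod (u n) <= K)%R) -> (Cmod l <= K)%R.
Proof.
  intros H HK. apply Rnot_lt_le. intros Hlt.
  destruct (tends_eps u l (Cmod l - K) H ltac:(lra)) as [N HN].
  specialize (HN N (Nat.le_refl _)).
  assert (Ht := Cmod_triangle (u N) (- (u N - l))).
  rewrite Cmod_opp in Ht. replace (u N + - (u N - l)) with l in Ht by ring.
  specialize (HK N). lra.
Qed.

Lemma geom_tail (u : nat -> C) (l : C) (K w : R) (N : nat) :
  (0 <= w < 1)%R -> (0 <= K)%R ->
  (forall i, (Cmod (u i) <= K * w ^ i)%R) -> sums u l ->
  (Cmod (l - csum u N) <= K / (1 - w) * w ^ N)%R.
Proof.
  intros Hw HK H Hs.
  apply (tends_Cmod_le (fun n => csum u (n + N) - csum u N)).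
  - apply tends_minus; [now apply tends_shift | apply tends_const].
  - intros n. rewrite Nat.add_comm, csum_add.
    replace (csum u N + csum (fun i => u (N + i)%nat) n - csum u N)
      with (csum (fun i => u (N + i)%nat) n) by ring.
    assert (Hwn := pow_le w N (proj1 Hw)). assert (Hwm := pow_le w n (proj1 Hw)).
    eapply Rle_trans.
    + apply (Cmod_csum_geom _ (K * w ^ N) w n Hw).
      * now apply Rmult_le_pos.
      * intros i _. rewrite Rmult_assoc, <- pow_add. apply H.
    + replace (K * w ^ N / (1 - w) * (1 - w ^ n))%R
        with (K / (1 - w) * w ^ N * (1 - w ^ n))%R by (field; lra).
      assert (0 <= K / (1 - w) * w ^ N)%R.
      { apply Rmult_le_pos; [|exact Hwn]. apply Rdiv_le_0_compat; lra. }
      nra.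
Qed.

(** Tannery's theorem with a geometric majorant. It carries every passage to
    a limit in a parameter of an infinite series below. *)
Lemma tannery (T : nat -> nat -> C) (t : nat -> C) (s : nat -> C) (K w : R) (N0 : nat) :
  (0 <= w < 1)%R -> (0 <= K)%R ->
  (forall N m, (N0 <= N)%nat -> (Cmod (T N m) <= K * w ^ m)%R) ->
  (forall m, tends (fun N => T N m) (t m)) ->
  (forall N, sums (T N) (s N)) ->
  exists S, sums t S /\ tends s S.
Proof.
  intros Hw HK HT Ht Hs.
  assert (Hb : forall m, (Cmod (t m) <= K * w ^ m)%R).
  { intros m. apply (tends_Cmod_le (fun N => T (N + N0)%nat m)).
    - apply (tends_shift (fun N => T N m)). apply Ht.
    - intros n. apply HT. lia. }
  destruct (summable_dom t (fun m => K * w ^ m)%R Hb (ex_series_geom_scal K w Hw))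
    as [S HS].
  exists S. split. exact HS.
  assert (Hfin : forall M, tends (fun N => csum (T N) M) (csum t M)).
  { induction M as [|M IH]; simpl. apply tends_const. now apply tends_plus. }
  unfold tends. apply is_lim_seq_spec. intros eps.
  assert (He : (0 < eps / 3)%R) by (destruct eps; simpl; lra).
  assert (Hg := is_lim_seq_scal_geom (K / (1 - w)) w Hw). apply is_lim_seq_spec in Hg.
  destruct (Hg (mkposreal _ He)) as [M HM]. specialize (HM M (Nat.le_refl _)).
  simpl in HM. apply Rabs_lt_between in HM.
  destruct (tends_eps _ _ (eps / 3) (Hfin M) He) as [N1 HN1].
  exists (max N0 N1). intros N HN. specialize (HN1 N ltac:(lia)).
  rewrite Rminus_0_r, Rabs_pos_eq by apply Cmod_ge_0.
  assert (H1 := geom_tail (T N) (s N) K w M Hw HK (fun m => HT N m ltac:(lia)) (Hs N)).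
  assert (H2 := geom_tail t S K w M Hw HK Hb HS).
  replace (s N - S) with ((s N - csum (T N) M) + ((csum (T N) M - csum t M)
    + - (S - csum t M))) by ring.
  eapply Rle_lt_trans. apply Cmod_triangle.
  eapply Rle_lt_trans. apply Rplus_le_compat_l. apply Cmod_triangle.
  rewrite Cmod_opp. lra.
Qed.

(** Both sides sum over the triangle [m + r < N]. *)
Lemma csum_triangle (x : nat -> nat -> C) (N : nat) :
  csum (fun n => csum (fun r => x (n - r)%nat r) (S n)) N
  = csum (fun r => csum (fun m => x m r) (N - r)) N.
Proof.
  induction N as [|N IH]. reflexivity.
  rewrite (csum_S (fun n => csum (fun r => x (n - r)%nat r) (S n))), IH.
  rewrite (csum_S (fun r => csum (fun m => x m r) (S N - r))).
  rewrite (csum_S (fun r => x (N - r)%nat r)).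
  replace (S N - N)%nat with 1%nat by lia. replace (N - N)%nat with 0%nat by lia.
  rewrite (csum_ext (fun r => csum (fun m => x m r) (S N - r))
     (fun r => csum (fun m => x m r) (N - r) + x (N - r)%nat r)).
  - rewrite csum_plus, (csum_S (fun m => x m N)). simpl. ring.
  - intros r Hr. replace (S N - r)%nat with (S (N - r)) by lia. reflexivity.
Qed.

(** The difference between the first [N] complete rows and the first [N]
    diagonals consists of the tails of the rows beyond [m + r = N]. Each tail
    is of order [w^N], and [N w^N] tends to zero. The conclusion speaks of the
    difference of the partial sums, because the convergence of the two sides
    is known separately when it is used. *)
Lemma diagonals_vs_rows (x : nat -> nat -> C) (row : nat -> C) (K w : R) :
  (0 <= w < 1)%R -> (0 <= K)%R ->
  (forall m r, (Cmod (x m r) <= K * w ^ (m + r))%R) ->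
  (forall r, sums (fun m => x m r) (row r)) ->
  tends (fun N => csum row N - csum (fun n => csum (fun r => x (n - r)%nat r) (S n)) N) 0.
Proof.
  intros Hw HK Hx HR.
  assert (Hb : forall N, (Cmod (csum row N
      - csum (fun n => csum (fun r => x (n - r)%nat r) (S n)) N)
      <= K / (1 - w) * (INR N * w ^ N))%R).
  { intros N. rewrite csum_triangle.
    assert (H : forall M, (M <= N)%nat ->
      (Cmod (csum row M - csum (fun r => csum (fun m => x m r) (N - r)) M)
        <= K / (1 - w) * (INR M * w ^ N))%R).
    { induction M as [|M IH]; intros HM.
      - simpl. replace (RtoC 0 - RtoC 0) with (RtoC 0) by ring. rewrite Cmod_0. lra.
      - simpl csum. rewrite S_INR.
        replace (csum row M + row M - (csum (fun r => csum (fun m => x m r) (N - r)) M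
            + csum (fun m => x m M) (N - M)))
          with ((csum row M - csum (fun r => csum (fun m => x m r) (N - r)) M)
            + (row M - csum (fun m => x m M) (N - M))) by ring.
        eapply Rle_trans. apply Cmod_triangle. specialize (IH ltac:(lia)).
        assert (Ht := geom_tail (fun m => x m M) (row M) (K * w ^ M) w (N - M) Hw).
        replace (K / (1 - w) * ((INR M + 1) * w ^ N))%R
          with (K / (1 - w) * (INR M * w ^ N) + K / (1 - w) * w ^ N)%R by ring.
        apply Rplus_le_compat. exact IH.
        replace (w ^ N)%R with (w ^ M * w ^ (N - M))%R
          by (rewrite <- pow_add; f_equal; lia).
        replace (K / (1 - w) * (w ^ M * w ^ (N - M)))%R
          with (K * w ^ M / (1 - w) * w ^ (N - M))%R by (field; lra).
        apply Ht.
        + apply Rmult_le_pos. exact HK. apply pow_le. lra.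
        + intros i. rewrite Rmult_assoc, <- pow_add, Nat.add_comm. apply Hx.
        + apply HR. }
    now apply H. }
  assert (Hlim : is_lim_seq (fun N => INR N * w ^ N)%R 0%R).
  { set (u := sqrt w).
    assert (Hu0 : (0 <= u)%R) by apply sqrt_pos.
    assert (Huu : (u * u = w)%R) by (apply sqrt_sqrt; lra).
    assert (Hu1 : (u < 1)%R) by nra.
    assert (HN : forall N, (INR N * u ^ N <= / (1 - u))%R).
    { assert (Hs : forall N, (INR N * u ^ N <= / (1 - u) * (1 - u ^ N))%R).
      { induction N as [|N IH]. simpl. lra.
        rewrite S_INR. simpl.
        assert (Hp := pow_le u N Hu0).
        assert (Hi : (0 < / (1 - u))%R) by (apply Rinv_0_lt_compat; lra).
        assert (HI := pos_INR N).
        replace (/ (1 - u) * (1 - u * u ^ N))%R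
          with (/ (1 - u) * (1 - u ^ N) + u ^ N)%R by (field; lra).
        assert (INR N * u ^ N * (1 - u) >= 0)%R.
        { apply Rle_ge. repeat apply Rmult_le_pos; lra. }
        nra. }
      intros N. eapply Rle_trans. apply Hs.
      assert (Hp := pow_le u N Hu0).
      assert (Hi : (0 < / (1 - u))%R) by (apply Rinv_0_lt_compat; lra). nra. }
    apply is_lim_seq_le_le with (u := fun _ => 0%R) (w := fun N => (/ (1 - u) * u ^ N)%R).
    - intros N. assert (Hp := pow_le u N Hu0). split.
      + apply Rmult_le_pos. apply pos_INR. apply pow_le; lra.
      + rewrite <- Huu, Rpow_mult_distr. rewrite <- Rmult_assoc.
        apply Rmult_le_compat_r. exact Hp. apply HN.
    - apply is_lim_seq_const.
    - apply is_lim_seq_scal_geom. lra. }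
  apply (tends_squeeze _ _ (fun N => K / (1 - w) * (INR N * w ^ N))%R 0).
  - intros N _. replace (csum row N - csum (fun n => csum (fun r => x (n - r)%nat r) (S n)) N - 0)
      with (csum row N - csum (fun n => csum (fun r => x (n - r)%nat r) (S n)) N) by ring.
    apply Hb.
  - replace (Finite 0) with (Finite (K / (1 - w) * 0)) by (f_equal; ring).
    apply (is_lim_seq_scal_l _ (K / (1 - w))%R 0%R Hlim).
Qed.

(** * Finite and infinite q-shifted factorials *)

Definition nonvanishing (x q : C) : Prop := forall j : nat, 1 - x * q ^ j <> 0.

Lemma Cinv_0 : / (RtoC 0) = 0.
Proof. unfold Cinv, RtoC; simpl. f_equal; unfold Rdiv; ring. Qed.

Lemma Cinv_mult (x y : C) : / (x * y) = / x * / y.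
Proof.
  destruct (classic (x = 0)) as [->|Hx].
  { rewrite Cinv_0. replace (0 * y) with (RtoC 0) by ring. rewrite Cinv_0. ring. }
  destruct (classic (y = 0)) as [->|Hy].
  { rewrite Cinv_0. replace (x * 0) with (RtoC 0) by ring. rewrite Cinv_0. ring. }
  field. auto.
Qed.

Lemma Cmult_integral (x y : C) : x * y = 0 -> x = 0 \/ y = 0.
Proof.
  intros H. destruct (classic (x = 0)) as [Hx|Hx]; [now left|right].
  replace y with (/ x * (x * y)) by (field; auto). rewrite H. ring.
Qed.

Lemma Cmult_neq0_l (x y : C) : x * y <> 0 -> x <> 0.
Proof. intros H H0. apply H. rewrite H0. ring. Qed.

Lemma Cmult_neq0_r (x y : C) : x * y <> 0 -> y <> 0.
Proof. intros H H0. apply H. rewrite H0. ring. Qed.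

Lemma qpoch_S (x q : C) (n : nat) :
  qpoch x q (S n) = qpoch x q n * (1 - x * q ^ n).
Proof. reflexivity. Qed.

Lemma qpoch_S_l (x q : C) (n : nat) :
  qpoch x q (S n) = (1 - x) * qpoch (x * q) q n.
Proof.
  induction n as [|n IH]. simpl; ring.
  rewrite qpoch_S, IH, qpoch_S, Cpow_S. ring.
Qed.

Lemma qpoch_add (x q : C) (n m : nat) :
  qpoch x q (n + m) = qpoch x q n * qpoch (x * q ^ n) q m.
Proof.
  induction m as [|m IH].
  - rewrite Nat.add_0_r. simpl. ring.
  - rewrite Nat.add_succ_r, !qpoch_S, IH, Cpow_add_r. ring.
Qed.

Lemma Cpow_sq (q : C) (n : nat) : (q ^ 2) ^ n = q ^ n * q ^ n.
Proof. rewrite <- Cpow_add_r, <- Cpow_mult_r. f_equal. lia. Qed.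

Lemma Cpow_double (q : C) (n : nat) : q ^ (2 * n) = q ^ n * q ^ n.
Proof. rewrite <- Cpow_add_r. f_equal. lia. Qed.

Lemma qpoch_even (x q : C) (n : nat) :
  qpoch x q (2 * n) = qpoch x (q ^ 2) n * qpoch (x * q) (q ^ 2) n.
Proof.
  induction n as [|n IH]. simpl; ring.
  replace (2 * S n)%nat with (S (S (2 * n))) by lia.
  rewrite !qpoch_S, IH, (Cpow_S q (2 * n)), Cpow_double, Cpow_sq. ring.
Qed.

Lemma qpoch_sq (x q : C) (n : nat) :
  qpoch x q n * qpoch (- x) q n = qpoch (x ^ 2) (q ^ 2) n.
Proof.
  induction n as [|n IH]. simpl; ring.
  rewrite !qpoch_S, <- IH, Cpow_sq. ring.
Qed.

Lemma qpoch_neq0 (x q : C) (n : nat) :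
  (forall j, (j < n)%nat -> 1 - x * q ^ j <> 0) -> qpoch x q n <> 0.
Proof.
  induction n as [|n IH]; intros H. simpl. apply C1_nz.
  rewrite qpoch_S. apply Cmult_neq_0; auto.
Qed.

Lemma qpoch_nonvanishing (x q : C) (n : nat) : nonvanishing x q -> qpoch x q n <> 0.
Proof. intros H. apply qpoch_neq0. intros; apply H. Qed.

Lemma qpoch_factor_neq0 (x q : C) (n j : nat) :
  qpoch x q n <> 0 -> (j < n)%nat -> 1 - x * q ^ j <> 0.
Proof.
  intros H Hj H0. apply H. replace n with (S j + (n - S j))%nat by lia.
  rewrite qpoch_add, qpoch_S, H0. ring.
Qed.

Lemma qpoch_neq0_le (x q : C) (n m : nat) :
  qpoch x q n <> 0 -> (m <= n)%nat -> qpoch x q m <> 0.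
Proof.
  intros H Hm. apply qpoch_neq0. intros j Hj. apply (qpoch_factor_neq0 _ _ n); auto. lia.
Qed.

Lemma qpoch_zero (x q : C) (n j : nat) :
  1 - x * q ^ j = 0 -> (j < n)%nat -> qpoch x q n = 0.
Proof.
  intros H Hj. replace n with (S j + (n - S j))%nat by lia.
  rewrite qpoch_add, qpoch_S, H. ring.
Qed.

Lemma nonvanishing_shift (x q : C) (n : nat) :
  nonvanishing x q -> nonvanishing (x * q ^ n) q.
Proof.
  intros H j. rewrite <- Cmult_assoc, <- Cpow_add_r. apply H.
Qed.

Lemma nonvanishing_shift1 (x q : C) : nonvanishing x q -> nonvanishing (x * q) q.
Proof.
  intros H. replace (x * q) with (x * q ^ 1) by ring. now apply nonvanishing_shift.
Qed.

(** From [1 + t <= exp t], applied to each factor. *)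
Definition poch_bound (x q : C) : R := exp (Cmod x / (1 - Cmod q)).

Lemma poch_bound_pos (x q : C) : (0 < poch_bound x q)%R.
Proof. apply exp_pos. Qed.

Lemma qpoch_upper (x q : C) (n : nat) :
  (Cmod q < 1)%R -> (Cmod (qpoch x q n) <= poch_bound x q)%R.
Proof.
  intros Hq. assert (Hq0 := Cmod_ge_0 q). assert (Hx0 := Cmod_ge_0 x).
  set (p := Cmod q) in *.
  assert (H : (Cmod (qpoch x q n) <= exp (Cmod x * (1 - p ^ n) / (1 - p)))%R).
  { induction n as [|n IH].
    - simpl. rewrite Cmod_1. rewrite <- exp_0 at 1. right. f_equal.
      field. lra.
    - rewrite qpoch_S, Cmod_mult.
      replace (Cmod x * (1 - p ^ S n) / (1 - p))%R
        with (Cmod x * (1 - p ^ n) / (1 - p) + Cmod x * p ^ n)%R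
        by (simpl; field; lra).
      rewrite exp_plus.
      apply Rmult_le_compat; try apply Cmod_ge_0. exact IH.
      eapply Rle_trans. apply Cmod_triangle.
      rewrite Cmod_1, Cmod_opp, Cmod_mult, Cmod_pow. apply exp_ineq1_le. }
  eapply Rle_trans. exact H. unfold poch_bound. fold p.
  assert (Hp := pow_le p n Hq0).
  assert (Hle : (Cmod x * (1 - p ^ n) / (1 - p) <= Cmod x / (1 - p))%R).
  { unfold Rdiv. apply Rmult_le_compat_r. left. apply Rinv_0_lt_compat. lra. nra. }
  destruct Hle as [Hlt|Heq]. left. now apply exp_increasing. right. now f_equal.
Qed.

Lemma Cmod_pow_le1 (q : C) (n : nat) : (Cmod q < 1)%R -> (Cmod (q ^ n) <= 1)%R.
Proof.
  intros Hq. rewrite Cmod_pow. rewrite <- (pow1 n).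
  apply pow_incr. split. apply Cmod_ge_0. lra.
Qed.

Lemma poch_bound_mono (x y q : C) :
  (Cmod q < 1)%R -> (Cmod x <= Cmod y)%R -> (poch_bound x q <= poch_bound y q)%R.
Proof.
  intros Hq H. unfold poch_bound.
  assert (Hle : (Cmod x / (1 - Cmod q) <= Cmod y / (1 - Cmod q))%R).
  { apply Rmult_le_compat_r. left. apply Rinv_0_lt_compat. lra. exact H. }
  destruct Hle as [Hlt|Heq]. left. now apply exp_increasing. right. now f_equal.
Qed.

Lemma Cmod_shift_le (x q : C) (N : nat) :
  (Cmod q < 1)%R -> (Cmod (x * q ^ N) <= Cmod x)%R.
Proof.
  intros Hq. rewrite Cmod_mult. assert (H := Cmod_pow_le1 q N Hq).
  assert (Hx := Cmod_ge_0 x). nra.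
Qed.

Lemma qpoch_upper_shift (x q : C) (N n : nat) :
  (Cmod q < 1)%R -> (Cmod (qpoch (x * q ^ N) q n) <= poch_bound x q)%R.
Proof.
  intros Hq. eapply Rle_trans. now apply qpoch_upper.
  apply poch_bound_mono. exact Hq. now apply Cmod_shift_le.
Qed.

Lemma qpoch_small (x q : C) (n : nat) :
  (Cmod q < 1)%R -> (Cmod x <= (1 - Cmod q) / 2)%R ->
  (1 / 2 <= Cmod (qpoch x q n))%R.
Proof.
  intros Hq Hx. assert (Hq0 := Cmod_ge_0 q). assert (Hx0 := Cmod_ge_0 x).
  set (p := Cmod q) in *.
  assert (H : forall n, (1 - Cmod x / (1 - p) * (1 - p ^ n)
      <= Cmod (qpoch x q n))%R).
  { clear n. induction n as [|n IH].
    - simpl. rewrite Cmod_1. lra.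
    - rewrite qpoch_S, Cmod_mult.
      assert (H1 : (1 - Cmod x * p ^ n <= Cmod (1 - x * q ^ n))%R).
      { assert (Ht := Cmod_triangle (1 - x * q ^ n) (x * q ^ n)).
        replace (1 - x * q ^ n + x * q ^ n) with (RtoC 1) in Ht by ring.
        rewrite Cmod_1, Cmod_mult, Cmod_pow in Ht. fold p in Ht. lra. }
      assert (Hp := pow_le p n Hq0).
      assert (Hp1 : (p ^ n <= 1)%R) by (rewrite <- (pow1 n); apply pow_incr; lra).
      set (d := (Cmod x / (1 - p))%R) in *.
      assert (Hd : (0 <= d <= 1 / 2)%R).
      { unfold d. split. apply Rdiv_le_0_compat; lra.
        apply Rle_div_l; lra. }
      replace (Cmod x) with (d * (1 - p))%R in H1 by (unfold d; field; lra).
      clearbody d.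
      simpl.
      assert (He : (0 <= (1 - p) * p ^ n <= 1)%R) by nra.
      assert (0 <= 1 - d * (1 - p) * p ^ n)%R by nra.
      assert (0 <= 1 - d * (1 - p ^ n))%R by nra.
      eapply Rle_trans; [|apply Rmult_le_compat; [| |exact IH|exact H1]]; try lra.
      assert (0 <= d * (1 - p ^ n) * (d * (1 - p) * p ^ n))%R.
      { repeat apply Rmult_le_pos; lra. }
      nra. }
  specialize (H n).
  assert (Hp := pow_le p n Hq0).
  assert (Hd : (0 <= Cmod x / (1 - p) <= 1 / 2)%R).
  { split. apply Rdiv_le_0_compat; lra. apply Rle_div_l; lra. }
  nra.
Qed.

(** A q-shifted factorial without zero factor stays away from zero, and so do
    all its tails: from some index on the factors are close to 1. *)
Lemma qpoch_lower (x q : C) :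
  (Cmod q < 1)%R -> nonvanishing x q ->
  exists lo, (0 < lo)%R /\ forall N n, (lo <= Cmod (qpoch (x * q ^ N) q n))%R.
Proof.
  intros Hq Hx.
  assert (Hlim := tends_scal x _ _ (tends_pow_geom q Hq)).
  replace (x * 0) with (RtoC 0) in Hlim by ring.
  destruct (tends_eps _ _ ((1 - Cmod q) / 2) Hlim ltac:(lra)) as [M HM].
  specialize (HM M (Nat.le_refl _)).
  replace (x * q ^ M - 0) with (x * q ^ M) in HM by ring.
  set (K := poch_bound x q).
  assert (HK : (0 < K)%R) by apply poch_bound_pos.
  assert (HM0 : (0 < Cmod (qpoch x q M))%R)
    by (apply Cmod_gt_0; now apply qpoch_nonvanishing).
  assert (H1 : forall n, (Cmod (qpoch x q M) / 2 <= Cmod (qpoch x q (M + n)))%R).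
  { intros n. rewrite qpoch_add, Cmod_mult.
    assert (Hs := qpoch_small (x * q ^ M) q n Hq ltac:(lra)). nra. }
  (* below index M the factorial is recovered from its value at M *)
  assert (H2 : exists lo0, (0 < lo0)%R /\ forall n, (lo0 <= Cmod (qpoch x q n))%R).
  { exists (Cmod (qpoch x q M) / 2 / (1 + K))%R. split.
    - apply Rdiv_lt_0_compat; lra.
    - intros n. apply Rle_div_l. lra.
      destruct (Nat.le_gt_cases M n) as [Hn|Hn].
      + replace n with (M + (n - M))%nat by lia. specialize (H1 (n - M)%nat).
        assert (H0 := Cmod_ge_0 (qpoch x q (M + (n - M)))). nra.
      + assert (Heq : qpoch x q M = qpoch x q n * qpoch (x * q ^ n) q (M - n)).
        { rewrite <- qpoch_add. f_equal. lia. }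
        rewrite Heq, Cmod_mult.
        assert (Hu := qpoch_upper_shift x q n (M - n) Hq). fold K in Hu.
        assert (H0 := Cmod_ge_0 (qpoch x q n)).
        assert (H3 := Cmod_ge_0 (qpoch (x * q ^ n) q (M - n))). nra. }
  destruct H2 as [lo0 [Hlo0 H2]].
  exists (lo0 / K)%R. split. now apply Rdiv_lt_0_compat.
  intros N n. apply Rle_div_l. exact HK.
  specialize (H2 (N + n)%nat). rewrite qpoch_add, Cmod_mult in H2.
  assert (Hu := qpoch_upper x q N Hq). fold K in Hu.
  assert (H3 := Cmod_ge_0 (qpoch (x * q ^ N) q n)). nra.
Qed.

Lemma qpoch_lower0 (x p : C) :
  (Cmod p < 1)%R -> nonvanishing x p ->
  exists lo, (0 < lo)%R /\ forall n, (lo <= Cmod (qpoch x p n))%R.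
Proof.
  intros Hp Hx. destruct (qpoch_lower x p Hp Hx) as [lo [Hlo H]].
  exists lo. split. exact Hlo. intros n. specialize (H 0%nat n).
  replace (x * p ^ 0) with x in H by (simpl; ring). exact H.
Qed.

Lemma qpoch_tends_ex (x q : C) :
  (Cmod q < 1)%R -> exists l, tends (qpoch x q) l.
Proof.
  intros Hq. assert (Hq0 := Cmod_ge_0 q).
  set (K := poch_bound x q).
  destruct (summable_dom (fun n => qpoch x q n * (- (x * q ^ n)))
    (fun n => (K * Cmod x) * Cmod q ^ n)%R) as [l Hl].
  - intros n. rewrite Cmod_mult, Cmod_opp, Cmod_mult, Cmod_pow, Rmult_assoc.
    apply Rmult_le_compat_r.
    + apply Rmult_le_pos. apply Cmod_ge_0. apply pow_le, Cmod_ge_0.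
    + now apply qpoch_upper.
  - apply ex_series_geom_scal. lra.
  - exists (1 + l). apply (tends_ext (fun n => 1 + csum (fun n => qpoch x q n * (- (x * q ^ n))) n)).
    + induction n as [|n IH]. simpl; ring. rewrite csum_S, qpoch_S, Cplus_assoc, IH. ring.
    + apply tends_plus. apply tends_const. exact Hl.
Qed.

Lemma qpoch_tends (x q : C) : (Cmod q < 1)%R -> tends (qpoch x q) (qpoch_inf x q).
Proof.
  intros Hq. destruct (qpoch_tends_ex x q Hq) as [l Hl].
  unfold qpoch_inf. now rewrite (tends_CLim_seq _ _ Hl).
Qed.

Lemma qpoch_inf_split (x q : C) (n : nat) :
  (Cmod q < 1)%R -> qpoch_inf x q = qpoch x q n * qpoch_inf (x * q ^ n) q.
Proof.
  intros Hq. apply (tends_unique (fun m => qpoch x q (m + n))).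
  - apply tends_shift. now apply qpoch_tends.
  - apply (tends_ext (fun m => qpoch x q n * qpoch (x * q ^ n) q m)).
    + intros m. now rewrite <- qpoch_add, Nat.add_comm.
    + apply tends_scal. now apply qpoch_tends.
Qed.

Lemma qpoch_inf_S (x q : C) :
  (Cmod q < 1)%R -> qpoch_inf x q = (1 - x) * qpoch_inf (x * q) q.
Proof.
  intros Hq. rewrite (qpoch_inf_split x q 1 Hq). simpl.
  replace (x * (q * 1)) with (x * q) by ring. ring.
Qed.

Lemma Cmod_sq_lt1 (q : C) : (Cmod q < 1)%R -> (Cmod (q ^ 2) < 1)%R.
Proof.
  intros Hq. rewrite Cmod_pow. assert (H := Cmod_ge_0 q). simpl. nra.
Qed.

Lemma qpoch_inf_sq (x q : C) :
  (Cmod q < 1)%R ->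
  qpoch_inf x q * qpoch_inf (- x) q = qpoch_inf (x ^ 2) (q ^ 2).
Proof.
  intros Hq. apply (tends_unique (qpoch (x ^ 2) (q ^ 2))).
  - apply (tends_ext (fun n => qpoch x q n * qpoch (- x) q n)).
    + intros n. apply qpoch_sq.
    + apply tends_mult; now apply qpoch_tends.
  - apply qpoch_tends. now apply Cmod_sq_lt1.
Qed.

Lemma qpoch_inf_neq0 (x q : C) :
  (Cmod q < 1)%R -> nonvanishing x q -> qpoch_inf x q <> 0.
Proof.
  intros Hq Hx H0. destruct (qpoch_lower0 x q Hq Hx) as [lo [Hlo H]].
  assert (Ht := qpoch_tends x q Hq). rewrite H0 in Ht.
  destruct (tends_eps _ _ lo Ht Hlo) as [N HN]. specialize (HN N (Nat.le_refl _)).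
  replace (qpoch x q N - 0) with (qpoch x q N) in HN by ring.
  specialize (H N). lra.
Qed.

Lemma tends_qpoch_arg (u : nat -> C) (x q : C) (n : nat) :
  tends u x -> tends (fun N => qpoch (u N) q n) (qpoch x q n).
Proof.
  intros H. induction n as [|n IH]. exact (tends_const 1).
  simpl. apply tends_mult. exact IH.
  apply tends_minus. apply tends_const. apply tends_mult. exact H. apply tends_const.
Qed.

Lemma qpoch_0_l (q : C) (n : nat) : qpoch 0 q n = 1.
Proof.
  induction n as [|n IH]. reflexivity. rewrite qpoch_S, IH. ring.
Qed.

Ltac neq0 :=
  first [ assumption
        | match goal with
          | H : ?u <> RtoC 0 |- ?v <> RtoC 0 =>
              replace v with u by ring; exact H
          end ].

(** * A non-terminating q-Watson summation *)

(** The very-well-poised factor [(l;q)_m (1 - l q^(2m)) / (1 - l)], with the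
    factor [1 - l] cancelled so that [l = 1] is no exception. *)
Definition vwp (l q : C) (m : nat) : C :=
  match m with
  | O => 1
  | S i => (1 - l * (q ^ S i * q ^ S i)) * qpoch (l * q) q i
  end.

(** The ratio [(c;q^2)_m / (c;q)_m], with the common factor [1 - c] cancelled.
    The case [c = 1] is the source of the theta function identity below. *)
Definition dup (c q : C) (m : nat) : C :=
  match m with
  | O => 1
  | S i => qpoch (c * q ^ 2) (q ^ 2) i / qpoch (c * q) q i
  end.

(** The product [(1/P;q)_m (- q P)^m] in a form which is polynomial in [P], so
    that [P] may tend to zero. *)
Fixpoint eprod (q P : C) (m : nat) : C :=
  match m with
  | O => 1
  | S i => eprod q P i * (q * q ^ i - q * P)
  end.

(** With [l = A B P] and [c = A B q P^2] this is the general term of the series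
    [8W7(l; A, B, 1/P, sqrt c, - sqrt c; q, - q P)], whose value is the
    non-terminating q-analogue of Watson's 3F2 summation. *)
Definition watson_term (q A B P : C) (m : nat) : C :=
  vwp (A * B * P) q m * qpoch A q m * qpoch B q m * eprod q P m
  * dup (A * B * q * P ^ 2) q m
  / (qpoch q q m * qpoch (B * q * P) q m * qpoch (A * q * P) q m
     * qpoch (A * B * q) (q ^ 2) m).

(** The certificate of a creative telescoping in the parameter [P]: a
    combination of the terms for [P] and for [q P] is the difference of two
    consecutive values of it. *)
Definition watson_cert (q A B P : C) (m : nat) : C :=
  match m with
  | O => 0
  | S i =>
    (1 - A * B * q ^ 3 * P ^ 3 * q ^ i) * qpoch (A * B * P * q) q i
    * qpoch A q (S i) * qpoch B q (S i) * eprod q P i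
    * qpoch (A * B * q * P ^ 2 * q ^ 2) (q ^ 2) i
    / (qpoch (A * B * q * P ^ 2 * q) q (S i) * qpoch q q i
       * qpoch (B * q * P) q (S i) * qpoch (A * q * P) q (S i)
       * qpoch (A * B * q) (q ^ 2) i)
  end.

Lemma eprod_shift (q P : C) (i : nat) :
  eprod q (q * P) (S i) = q * q ^ i * (1 - q * P) * eprod q P i.
Proof.
  induction i as [|i IH]. simpl; ring.
  change (eprod q (q * P) (S (S i)))
    with (eprod q (q * P) (S i) * (q * q ^ S i - q * (q * P))).
  rewrite IH. simpl. ring.
Qed.

Lemma Cdiv_of_mult (x y z : C) : y <> 0 -> x * y = z -> x = z / y.
Proof. intros Hy <-. field. exact Hy. Qed.

Lemma Cmult_eq_l (z x y : C) : z <> 0 -> z * x = z * y -> x = y.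
Proof.
  intros Hz H. replace x with (z * x / z) by (field; auto). rewrite H. field. auto.
Qed.

(** The rational identity behind the telescoping of Watson's series, without the
    factors that its four terms have in common. *)
Lemma watson_core (q A B P x : C) :
  (1 + q * P) * (1 - A * B * P * (q * x * (q * x))) * (q * x - q * P)
  * (1 - B * q * P * (q * x)) * (1 - A * q * P * (q * x))
  * (1 - A * B * q * P ^ 2 * q * x) * (1 - A * B * q * P ^ 2 * q * (q * x))
  - (1 - A * B * P * q * x) * (1 - A * q ^ 2 * P ^ 2) * (1 - B * q ^ 2 * P ^ 2)
  * (1 - A * B * (q * P) * (q * x * (q * x))) * (q * x * (1 - q * P))
  * (1 - A * B * q * P ^ 2 * q ^ 2 * (x * x))
  = q * P * ((1 - A * B * q ^ 3 * P ^ 3 * (q * x)) * (1 - A * B * P * q * x)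
    * (1 - A * (q * x)) * (1 - B * (q * x)) * (q * x - q * P)
    * (1 - A * B * q * P ^ 2 * q ^ 2 * (x * x))
   - (1 - A * B * q ^ 3 * P ^ 3 * x) * (1 - q * x) * (1 - A * B * q * (x * x))
    * (1 - B * q * P * (q * x)) * (1 - A * q * P * (q * x))
    * (1 - A * B * q * P ^ 2 * q * (q * x))).
Proof. ring. Qed.

(** Expressing the factorials at [q P] by those at [P] reduces this to
    [watson_core]. *)
Lemma watson_step (q A B P : C) (m : nat) :
  qpoch q q m <> 0 ->
  nonvanishing (B * q * P) q -> nonvanishing (A * q * P) q ->
  qpoch (A * B * q) (q ^ 2) m <> 0 ->
  qpoch (A * B * q * P ^ 2 * q) q (S m) <> 0 ->
  (1 + q * P) * (1 - A * q * P) * (1 - B * q * P) * (1 - A * B * q ^ 2 * P ^ 2)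
    * watson_term q A B P m
  - (1 - A * B * P * q) * (1 - A * q ^ 2 * P ^ 2) * (1 - B * q ^ 2 * P ^ 2)
    * watson_term q A B (q * P) m
  = q * P * (1 - A * q * P) * (1 - B * q * P) * (1 - A * B * q ^ 2 * P ^ 2)
    * (watson_cert q A B P (S m) - watson_cert q A B P m).
Proof.
  intros HQ HB HA HAB HC.
  assert (HB0 := HB 0%nat). assert (HA0 := HA 0%nat).
  assert (HC0 := qpoch_factor_neq0 _ _ _ 0 HC (Nat.lt_0_succ _)).
  simpl in HB0, HA0, HC0. rewrite !Cmult_1_r in HB0, HA0, HC0.
  destruct m as [|i].
  - unfold watson_term, watson_cert. simpl.
    field. repeat split; neq0.
  - assert (HC1 := qpoch_factor_neq0 _ _ _ 1 HC ltac:(lia)).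
    assert (HBi := HB i). assert (HAi := HA i).
    assert (HBSi := HB (S i)). assert (HASi := HA (S i)).
    assert (HBp := qpoch_nonvanishing _ _ i HB).
    assert (HAp := qpoch_nonvanishing _ _ i HA).
    rewrite qpoch_S in HQ, HAB. rewrite !qpoch_S in HC.
    unfold watson_term, watson_cert, dup, vwp.
    rewrite eprod_shift.
    assert (E1 : (1 - A * B * P * q) * qpoch (A * B * (q * P) * q) q i
      = qpoch (A * B * P * q) q i * (1 - A * B * P * q * q ^ i)).
    { rewrite <- qpoch_S, qpoch_S_l. do 2 f_equal. ring. }
    assert (E2 : qpoch (B * q * (q * P)) q (S i) = qpoch (B * q * P) q i
      * (1 - B * q * P * q ^ i) * (1 - B * q * P * q ^ S i) / (1 - B * q * P)).
    { apply Cdiv_of_mult. exact HB0. rewrite <- !qpoch_S, (qpoch_S_l (B * q * P)).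
      replace (B * q * (q * P)) with (B * q * P * q) by ring. ring. }
    assert (E3 : qpoch (A * q * (q * P)) q (S i) = qpoch (A * q * P) q i
      * (1 - A * q * P * q ^ i) * (1 - A * q * P * q ^ S i) / (1 - A * q * P)).
    { apply Cdiv_of_mult. exact HA0. rewrite <- !qpoch_S, (qpoch_S_l (A * q * P)).
      replace (A * q * (q * P)) with (A * q * P * q) by ring. ring. }
    assert (E4 : qpoch (A * B * q * (q * P) ^ 2 * q ^ 2) (q ^ 2) i
      = qpoch (A * B * q * P ^ 2 * q ^ 2) (q ^ 2) i
        * (1 - A * B * q * P ^ 2 * q ^ 2 * (q ^ i * q ^ i))
        / (1 - A * B * q * P ^ 2 * q * q ^ 1)).
    { apply Cdiv_of_mult. exact HC1.
      rewrite <- Cpow_sq, <- qpoch_S, qpoch_S_l.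
      replace (A * B * q * (q * P) ^ 2 * q ^ 2) with (A * B * q * P ^ 2 * q ^ 2 * q ^ 2)
        by ring.
      ring. }
    assert (E5 : qpoch (A * B * q * (q * P) ^ 2 * q) q i
      = qpoch (A * B * q * P ^ 2 * q) q i
        * (1 - A * B * q * P ^ 2 * q * q ^ i) * (1 - A * B * q * P ^ 2 * q * q ^ S i)
        / ((1 - A * B * q * P ^ 2 * q) * (1 - A * B * q * P ^ 2 * q * q ^ 1))).
    { apply Cdiv_of_mult. now apply Cmult_neq_0.
      rewrite <- !qpoch_S, !qpoch_S_l.
      replace (A * B * q * (q * P) ^ 2 * q) with (A * B * q * P ^ 2 * q * q * q) by ring.
      simpl. ring. }
    rewrite E2, E3, E4, E5.
    rewrite !qpoch_S.
    rewrite (Cpow_sq q i) in *.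
    change (eprod q P (S i)) with (eprod q P i * (q * q ^ i - q * P)).
    rewrite !(Cpow_S q i) in *.
    clear E2 E3 E4 E5. set (x := q ^ i) in *.
    assert (Hcore := watson_core q A B P x).
    replace (1 - A * B * q ^ 2 * P ^ 2) with (1 - A * B * q * P ^ 2 * q) by ring.
    (* with the factors as atoms only monomials have to be compared *)
    set (g := 1 - A * B * P * q) in *. set (g' := 1 - A * B * P * q * x) in *.
    set (b0 := 1 - B * q * P) in *. set (b1 := 1 - B * q * P * x) in *.
    set (b2 := 1 - B * q * P * (q * x)) in *. set (b3 := 1 - B * q ^ 2 * P ^ 2) in *.
    set (a0 := 1 - A * q * P) in *. set (a1 := 1 - A * q * P * x) in *.
    set (a2 := 1 - A * q * P * (q * x)) in *. set (a3 := 1 - A * q ^ 2 * P ^ 2) in *.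
    set (c1 := 1 - A * B * q * P ^ 2 * q) in *.
    set (c2 := 1 - A * B * q * P ^ 2 * q * q ^ 1) in *.
    set (c3 := 1 - A * B * q * P ^ 2 * q * x) in *.
    set (c4 := 1 - A * B * q * P ^ 2 * q * (q * x)) in *.
    set (h' := 1 - A * B * q * P ^ 2 * q ^ 2 * (x * x)) in *.
    set (l1 := 1 - A * B * P * (q * x * (q * x))) in *.
    set (l2 := 1 - A * B * (q * P) * (q * x * (q * x))) in *.
    set (u1 := 1 - A * B * q ^ 3 * P ^ 3 * x) in *.
    set (u2 := 1 - A * B * q ^ 3 * P ^ 3 * (q * x)) in *.
    set (z1 := 1 - A * B * q * (x * x)) in *. set (q1 := 1 - q * x) in *.
    set (d1 := 1 - A * x). set (d2 := 1 - A * (q * x)) in *.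
    set (f1 := 1 - B * x). set (f2 := 1 - B * (q * x)) in *.
    set (e1 := q * x - q * P) in *. set (e2 := q * x * (1 - q * P)) in *.
    set (p := 1 + q * P) in *. set (K := q * P) in *.
    set (V := qpoch (A * B * P * q) q i) in *.
    set (V' := qpoch (A * B * K * q) q i) in *.
    assert (Hc1 : c1 <> 0).
    { intros H. apply HC0. rewrite <- H. unfold c1. ring. }
    assert (HQ1 := Cmult_neq0_l _ _ HQ). assert (HQ2 := Cmult_neq0_r _ _ HQ).
    assert (HZ1 := Cmult_neq0_l _ _ HAB). assert (HZ2 := Cmult_neq0_r _ _ HAB).
    assert (HC1' := Cmult_neq0_l _ _ (Cmult_neq0_l _ _ HC)).
    assert (HC3 := Cmult_neq0_r _ _ (Cmult_neq0_l _ _ HC)).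
    assert (HC4 := Cmult_neq0_r _ _ HC).
    clear HQ HAB HC HC0 HA HB.
    clearbody g g' b0 b1 b2 b3 a0 a1 a2 a3 c1 c2 c3 c4 h' l1 l2 u1 u2 z1 q1 d1 d2 f1 f2
      e1 e2 p K V V'.
    generalize dependent (qpoch q q i). intros Q HQ1.
    generalize dependent (qpoch (A * B * q) (q ^ 2) i). intros Z HZ1.
    generalize dependent (qpoch (B * q * P) q i). intros U HU.
    generalize dependent (qpoch (A * q * P) q i). intros W HW.
    generalize dependent (qpoch (A * B * q * P ^ 2 * q) q i). intros c Hc.
    generalize (qpoch (A * B * q * P ^ 2 * q ^ 2) (q ^ 2) i). intros h.
    generalize (qpoch A q i) (qpoch B q i) (eprod q P i). intros a b e.
    set (M := a0 * b0 * c1 * a * d1 * b * f1 * e * h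
      / (c * c3 * c4 * Q * q1 * U * b1 * b2 * W * a1 * a2 * Z * z1)).
    transitivity (M * (V * (p * l1 * e1 * b2 * a2 * c3 * c4)
      - g * V' * (a3 * b3 * l2 * e2 * h'))).
    unfold M. field. repeat split; assumption.
    rewrite E1.
    transitivity (M * V * (p * l1 * e1 * b2 * a2 * c3 * c4 - g' * a3 * b3 * l2 * e2 * h')).
    ring. rewrite Hcore. unfold M. field. repeat split; assumption.
Qed.

Definition watson_regular (q A B P : C) : Prop :=
  nonvanishing (B * q * P) q /\ nonvanishing (A * q * P) q
  /\ nonvanishing (A * B * q) (q ^ 2) /\ nonvanishing (A * B * q * P ^ 2 * q) q.

Lemma nonvanishing_base (q : C) : (Cmod q < 1)%R -> nonvanishing q q.
Proof.
  intros Hq j H. rewrite <- Cpow_S in H.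
  assert (H1 : q ^ S j = 1).
  { replace (q ^ S j) with (1 - (1 - q ^ S j)) by ring. rewrite H. ring. }
  apply (f_equal Cmod) in H1. rewrite Cmod_1, Cmod_pow in H1.
  assert (H2 := pow_lt_1_compat (Cmod q) (S j) (conj (Cmod_ge_0 q) Hq) (Nat.lt_0_succ j)).
  lra.
Qed.

Lemma watson_partial (q A B P : C) (M : nat) :
  (Cmod q < 1)%R ->
  nonvanishing (B * q * P) q -> nonvanishing (A * q * P) q ->
  nonvanishing (A * B * q) (q ^ 2) ->
  qpoch (A * B * q * P ^ 2 * q) q M <> 0 ->
  (1 + q * P) * (1 - A * q * P) * (1 - B * q * P) * (1 - A * B * q ^ 2 * P ^ 2)
    * csum (watson_term q A B P) M
  - (1 - A * B * P * q) * (1 - A * q ^ 2 * P ^ 2) * (1 - B * q ^ 2 * P ^ 2)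
    * csum (watson_term q A B (q * P)) M
  = q * P * (1 - A * q * P) * (1 - B * q * P) * (1 - A * B * q ^ 2 * P ^ 2)
    * watson_cert q A B P M.
Proof.
  intros Hq HB HA HAB. induction M as [|M IH]; intros HC.
  - simpl. ring.
  - rewrite !csum_S.
    assert (Hs := watson_step q A B P M
      (qpoch_nonvanishing _ _ _ (nonvanishing_base q Hq)) HB HA
      (qpoch_nonvanishing _ _ _ HAB) HC).
    rewrite qpoch_S in HC. specialize (IH (Cmult_neq0_l _ _ HC)).
    set (X := (1 + q * P) * (1 - A * q * P) * (1 - B * q * P)
      * (1 - A * B * q ^ 2 * P ^ 2)) in *.
    set (Y := (1 - A * B * P * q) * (1 - A * q ^ 2 * P ^ 2)
      * (1 - B * q ^ 2 * P ^ 2)) in *.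
    set (Kg := q * P * (1 - A * q * P) * (1 - B * q * P)
      * (1 - A * B * q ^ 2 * P ^ 2)) in *.
    transitivity ((X * csum (watson_term q A B P) M
      - Y * csum (watson_term q A B (q * P)) M)
      + (X * watson_term q A B P M - Y * watson_term q A B (q * P) M)).
    ring. rewrite IH, Hs. ring.
Qed.

Lemma Cmod_mult_le (x y : C) (X Y : R) :
  (Cmod x <= X)%R -> (Cmod y <= Y)%R -> (Cmod (x * y) <= X * Y)%R.
Proof.
  intros Hx Hy. rewrite Cmod_mult. apply Rmult_le_compat; auto using Cmod_ge_0.
Qed.

Lemma Cmod_div_le (x y : C) (X lo : R) :
  (Cmod x <= X)%R -> (0 < lo)%R -> (lo <= Cmod y)%R -> (Cmod (x / y) <= X / lo)%R.
Proof.
  intros Hx Hlo Hy. unfold Cdiv. apply Cmod_mult_le. exact Hx.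
  rewrite Cmod_inv. 2: apply Cmod_gt_0; lra.
  now apply Rinv_le_contravar.
Qed.

Lemma Cmod_mult_ge (x y : C) (X Y : R) :
  (0 <= X)%R -> (0 <= Y)%R ->
  (X <= Cmod x)%R -> (Y <= Cmod y)%R -> (X * Y <= Cmod (x * y))%R.
Proof. intros. rewrite Cmod_mult. now apply Rmult_le_compat. Qed.

Lemma Cmod_one_minus_le (x : C) : (Cmod (1 - x) <= 1 + Cmod x)%R.
Proof.
  eapply Rle_trans. apply Cmod_triangle. rewrite Cmod_1, Cmod_opp. lra.
Qed.

Lemma vwp_upper (l q : C) (N m : nat) :
  (Cmod q < 1)%R ->
  (Cmod (vwp (l * q ^ N) q m) <= (1 + Cmod l) * poch_bound (l * q) q)%R.
Proof.
  intros Hq. assert (Hl := Cmod_ge_0 l).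
  assert (Hb : (1 <= poch_bound (l * q) q)%R).
  { assert (H := qpoch_upper (l * q) q 0 Hq). simpl in H. rewrite Cmod_1 in H. exact H. }
  destruct m as [|i].
  - simpl. rewrite Cmod_1. nra.
  - unfold vwp. apply Cmod_mult_le.
    + eapply Rle_trans. apply Cmod_one_minus_le. apply Rplus_le_compat_l.
      rewrite <- Cpow_add_r, <- Cmult_assoc, <- Cpow_add_r. now apply Cmod_shift_le.
    + replace (l * q ^ N * q) with (l * q * q ^ N) by ring.
      now apply qpoch_upper_shift.
Qed.

(** All factors except [eprod] are bounded above, respectively away from zero,
    uniformly under [P -> q^N P]. *)
Lemma watson_term_bound (q A B P : C) :
  (Cmod q < 1)%R -> watson_regular q A B P ->
  exists K, (0 <= K)%R /\ forall N m,
    (Cmod (watson_term q A B (q ^ N * P) m) <= K * Cmod (eprod q (q ^ N * P) m))%R.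
Proof.
  intros Hq [HB [HA [HAB HC]]].
  assert (Hq2 := Cmod_sq_lt1 q Hq).
  destruct (qpoch_lower _ _ Hq HB) as [lB [HlB HB']].
  destruct (qpoch_lower _ _ Hq HA) as [lA [HlA HA']].
  destruct (qpoch_lower0 _ _ Hq2 HAB) as [lAB [HlAB HAB']].
  destruct (qpoch_lower _ _ Hq HC) as [lC [HlC HC']].
  destruct (qpoch_lower0 _ _ Hq (nonvanishing_base q Hq)) as [lq [Hlq Hq']].
  set (C2 := A * B * q * P ^ 2) in *.
  set (D := (1 + poch_bound (C2 * q ^ 2) (q ^ 2) / lC)%R).
  assert (HD : (1 <= D)%R).
  { unfold D. assert (0 < poch_bound (C2 * q ^ 2) (q ^ 2) / lC)%R.
    apply Rdiv_lt_0_compat; [apply poch_bound_pos | exact HlC]. lra. }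
  assert (HdN : forall N m, (Cmod (dup (A * B * q * (q ^ N * P) ^ 2) q m) <= D)%R).
  { intros N [|i]; unfold dup. rewrite Cmod_1. exact HD.
    unfold D. apply Rle_trans with (poch_bound (C2 * q ^ 2) (q ^ 2) / lC)%R; [|lra].
    apply Cmod_div_le. 2: exact HlC.
    - replace (A * B * q * (q ^ N * P) ^ 2 * q ^ 2) with (C2 * q ^ 2 * (q ^ 2) ^ N)
        by (rewrite Cpow_sq; unfold C2; ring).
      now apply qpoch_upper_shift.
    - replace (A * B * q * (q ^ N * P) ^ 2 * q) with (C2 * q * q ^ (2 * N))
        by (rewrite Cpow_double; unfold C2; ring).
      apply HC'. }
  set (b := poch_bound).
  exists ((1 + Cmod (A * B * P)%C) * b (A * B * P * q)%C q * b A q * b B q * D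
    / (lq * lB * lA * lAB))%R.
  assert (Hl : (0 < lq * lB * lA * lAB)%R) by (repeat apply Rmult_lt_0_compat; assumption).
  assert (Hb : forall x p, (0 <= b x p)%R) by (intros; left; apply poch_bound_pos).
  split.
  - apply Rdiv_le_0_compat; [|exact Hl].
    assert (H0 := Cmod_ge_0 (A * B * P)).
    repeat apply Rmult_le_pos; try apply Hb; lra.
  - intros N m. unfold watson_term.
    replace (vwp (A * B * (q ^ N * P)) q m * qpoch A q m * qpoch B q m
      * eprod q (q ^ N * P) m * dup (A * B * q * (q ^ N * P) ^ 2) q m
      / (qpoch q q m * qpoch (B * q * (q ^ N * P)) q m
         * qpoch (A * q * (q ^ N * P)) q m * qpoch (A * B * q) (q ^ 2) m))
    with ((vwp (A * B * (q ^ N * P)) q m * qpoch A q m * qpoch B q m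
      * dup (A * B * q * (q ^ N * P) ^ 2) q m
      / (qpoch q q m * qpoch (B * q * (q ^ N * P)) q m
         * qpoch (A * q * (q ^ N * P)) q m * qpoch (A * B * q) (q ^ 2) m))
      * eprod q (q ^ N * P) m) by (unfold Cdiv; ring).
    apply Cmod_mult_le; [|lra].
    replace (A * B * (q ^ N * P)) with (A * B * P * q ^ N) by ring.
    replace (B * q * (q ^ N * P)) with (B * q * P * q ^ N) by ring.
    replace (A * q * (q ^ N * P)) with (A * q * P * q ^ N) by ring.
    apply Cmod_div_le. 2: exact Hl.
    + repeat apply Cmod_mult_le.
      now apply vwp_upper. now apply qpoch_upper. now apply qpoch_upper. apply HdN.
    + repeat apply Cmod_mult_ge; try (left; assumption);
        try (left; repeat apply Rmult_lt_0_compat; assumption); auto.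
Qed.

(** A series which terminates through [A] or [B] converges for every [P]. *)
Definition terminating (q A B : C) : Prop :=
  exists j, 1 - A * q ^ j = 0 \/ 1 - B * q ^ j = 0.

Definition watson_convergent (q A B P : C) : Prop :=
  (Cmod (q * P) < 1)%R \/ terminating q A B.

Lemma watson_regular_shift (q A B P : C) (N : nat) :
  watson_regular q A B P -> watson_regular q A B (q ^ N * P).
Proof.
  intros [HB [HA [HAB HC]]]. repeat split.
  - replace (B * q * (q ^ N * P)) with (B * q * P * q ^ N) by ring.
    now apply nonvanishing_shift.
  - replace (A * q * (q ^ N * P)) with (A * q * P * q ^ N) by ring.
    now apply nonvanishing_shift.
  - exact HAB.
  - replace (A * B * q * (q ^ N * P) ^ 2 * q)
      with (A * B * q * P ^ 2 * q * q ^ (2 * N)) by (rewrite Cpow_double; ring).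
    now apply nonvanishing_shift.
Qed.

Lemma watson_convergent_shift (q A B P : C) (N : nat) :
  (Cmod q < 1)%R -> watson_convergent q A B P -> watson_convergent q A B (q ^ N * P).
Proof.
  intros Hq [H|H]; [left|right; exact H].
  eapply Rle_lt_trans; [|exact H].
  replace (q * (q ^ N * P)) with (q * P * q ^ N) by ring. now apply Cmod_shift_le.
Qed.

Lemma eprod_poch (q P : C) (m : nat) :
  P <> 0 -> eprod q P m = (- (q * P)) ^ m * qpoch (/ P) q m.
Proof.
  intros HP. induction m as [|m IH]. simpl; ring.
  simpl. rewrite IH. field. exact HP.
Qed.

(** This bound gives convergence for fixed [P] with [|q P| < 1],
    the next one the majorant for [P -> 0]. *)
Lemma eprod_upper (q P : C) (m : nat) :
  (Cmod q < 1)%R -> P <> 0 ->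
  (Cmod (eprod q P m) <= poch_bound (/ P) q * Cmod (q * P) ^ m)%R.
Proof.
  intros Hq HP. rewrite eprod_poch by exact HP. rewrite Cmult_comm.
  apply Cmod_mult_le. now apply qpoch_upper. rewrite Cmod_pow, Cmod_opp. lra.
Qed.

Lemma eprod_upper_small (q P : C) (m : nat) :
  (Cmod q < 1)%R ->
  (Cmod (eprod q P m) <= (Cmod q * (1 + Cmod P)) ^ m)%R.
Proof.
  intros Hq. induction m as [|m IH]. simpl. rewrite Cmod_1. lra.
  simpl. rewrite Rmult_comm. apply Cmod_mult_le. exact IH.
  replace (q * q ^ m - q * P) with (q * (q ^ m + - P)) by ring.
  apply Cmod_mult_le. lra.
  eapply Rle_trans. apply Cmod_triangle. rewrite Cmod_opp.
  assert (H := Cmod_pow_le1 q m Hq). lra.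
Qed.

Lemma terminating_zero (q A B : C) :
  terminating q A B ->
  exists j, forall m, (j < m)%nat -> qpoch A q m * qpoch B q m = 0.
Proof.
  intros [j [H|H]]; exists j; intros m Hm; rewrite (qpoch_zero _ _ m j H Hm); ring.
Qed.

Lemma watson_summable (q A B P : C) :
  (Cmod q < 1)%R -> P <> 0 -> watson_regular q A B P -> watson_convergent q A B P ->
  exists S, sums (watson_term q A B P) S.
Proof.
  intros Hq HP Hr [Hc|Ht].
  - destruct (watson_term_bound q A B P Hq Hr) as [K [HK Hb]].
    apply (summable_dom _ (fun m => (K * poch_bound (/ P) q) * Cmod (q * P) ^ m)%R).
    + intros m. specialize (Hb 0%nat m).
      replace (q ^ 0 * P) with P in Hb by (simpl; ring).
      eapply Rle_trans. exact Hb. rewrite Rmult_assoc.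
      apply Rmult_le_compat_l. exact HK. now apply eprod_upper.
    + apply ex_series_geom_scal. split; [apply Cmod_ge_0 | exact Hc].
  - destruct (terminating_zero q A B Ht) as [j Hj].
    exists (csum (watson_term q A B P) (S j)). apply sums_finite.
    intros n Hn. unfold watson_term.
    replace (vwp (A * B * P) q n * qpoch A q n * qpoch B q n)
      with (vwp (A * B * P) q n * (qpoch A q n * qpoch B q n)) by ring.
    rewrite Hj by lia. unfold Cdiv. ring.
Qed.

Lemma watson_cert_tends (q A B P : C) :
  (Cmod q < 1)%R -> P <> 0 -> watson_regular q A B P -> watson_convergent q A B P ->
  tends (watson_cert q A B P) 0.
Proof.
  intros Hq HP [HB [HA [HAB HC]]] [Hc|Ht].
  - assert (Hq2 := Cmod_sq_lt1 q Hq).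
    destruct (qpoch_lower0 _ _ Hq HB) as [lB [HlB HB']].
    destruct (qpoch_lower0 _ _ Hq HA) as [lA [HlA HA']].
    destruct (qpoch_lower0 _ _ Hq2 HAB) as [lAB [HlAB HAB']].
    destruct (qpoch_lower0 _ _ Hq HC) as [lC [HlC HC']].
    destruct (qpoch_lower0 _ _ Hq (nonvanishing_base q Hq)) as [lq [Hlq Hq']].
    set (C2 := A * B * q * P ^ 2) in *.
    set (b := poch_bound).
    set (K := ((1 + Cmod (A * B * q ^ 3 * P ^ 3)%C) * b (A * B * P * q)%C q * b A q * b B q
      * b (C2 * q ^ 2)%C (q ^ 2)%C / (lC * lq * lB * lA * lAB) * b (/ P)%C q)%R).
    apply (tends_unshift _ _ 1).
    apply (tends_squeeze _ _ (fun i => K * Cmod (q * P) ^ i)%R 0).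
    + intros i _. rewrite Nat.add_1_r. unfold watson_cert. fold C2.
      match goal with |- (Cmod (Cminus ?f _) <= _)%R =>
        replace (f - 0) with (((1 - A * B * q ^ 3 * P ^ 3 * q ^ i)
          * qpoch (A * B * P * q) q i * qpoch A q (S i) * qpoch B q (S i)
          * qpoch (C2 * q ^ 2) (q ^ 2) i
          / (qpoch (C2 * q) q (S i) * qpoch q q i * qpoch (B * q * P) q (S i)
             * qpoch (A * q * P) q (S i) * qpoch (A * B * q) (q ^ 2) i))
          * eprod q P i) by (unfold Cdiv; ring)
      end.
      unfold K. rewrite Rmult_assoc. apply Cmod_mult_le.
      * apply Cmod_div_le.
        -- repeat apply Cmod_mult_le; try (now apply qpoch_upper).
           eapply Rle_trans. apply Cmod_one_minus_le. apply Rplus_le_compat_l.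
           now apply Cmod_shift_le.
        -- repeat apply Rmult_lt_0_compat; assumption.
        -- repeat apply Cmod_mult_ge; try (left; assumption);
           try (left; repeat apply Rmult_lt_0_compat; assumption); auto.
      * now apply eprod_upper.
    + apply is_lim_seq_scal_geom. split; [apply Cmod_ge_0 | exact Hc].
  - destruct (terminating_zero q A B Ht) as [j Hj].
    apply (tends_ext_ev (fun _ => 0) _ _ (S j)); [|apply tends_const].
    intros [|i] Hi. lia. unfold watson_cert. cbv beta.
    match goal with |- _ = ?u * ?v * ?a * ?b * ?e * ?h / ?d =>
      replace (u * v * a * b * e * h) with (u * v * (a * b) * e * h) by ring end.
    rewrite Hj by lia. unfold Cdiv. ring.
Qed.

(** The certificate tends to zero at infinity, so the telescoped identity
    becomes a first-order recursion for the sum under [P -> q P]. *)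
Lemma watson_rec (q A B P S S' : C) :
  (Cmod q < 1)%R -> P <> 0 -> watson_regular q A B P -> watson_convergent q A B P ->
  sums (watson_term q A B P) S -> sums (watson_term q A B (q * P)) S' ->
  (1 + q * P) * (1 - A * q * P) * (1 - B * q * P) * (1 - A * B * q ^ 2 * P ^ 2) * S
  = (1 - A * B * P * q) * (1 - A * q ^ 2 * P ^ 2) * (1 - B * q ^ 2 * P ^ 2) * S'.
Proof.
  intros Hq HP Hr Hc HS HS'.
  assert (Hr' := Hr). destruct Hr' as [HB [HA [HAB HC]]].
  assert (H1 := tends_minus _ _ _ _ (tends_scal ((1 + q * P) * (1 - A * q * P)
    * (1 - B * q * P) * (1 - A * B * q ^ 2 * P ^ 2)) _ _ HS)
    (tends_scal ((1 - A * B * P * q) * (1 - A * q ^ 2 * P ^ 2)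
    * (1 - B * q ^ 2 * P ^ 2)) _ _ HS')).
  assert (H2 := tends_scal (q * P * (1 - A * q * P) * (1 - B * q * P)
    * (1 - A * B * q ^ 2 * P ^ 2)) _ _ (watson_cert_tends q A B P Hq HP Hr Hc)).
  assert (H3 := tends_unique _ _ _
    (tends_ext _ _ _ (fun M => watson_partial q A B P M Hq HB HA HAB
       (qpoch_nonvanishing _ _ _ HC)) H1) H2).
  match goal with |- ?u = ?v => replace u with (u - v + v) by ring end.
  rewrite H3. ring.
Qed.

Lemma watson_iterate (q A B P : C) (s : nat -> C) (j : nat) :
  q <> 0 -> (Cmod q < 1)%R -> P <> 0 ->
  watson_regular q A B P -> watson_convergent q A B P ->
  (forall N, sums (watson_term q A B (q ^ N * P)) (s N)) ->
  qpoch (- (q * P)) q j * qpoch (A * q * P) q j * qpoch (B * q * P) q j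
    * qpoch (A * B * q ^ 2 * P ^ 2) (q ^ 2) j * s 0%nat
  = qpoch (A * B * P * q) q j * qpoch (A * q ^ 2 * P ^ 2) (q ^ 2) j
    * qpoch (B * q ^ 2 * P ^ 2) (q ^ 2) j * s j.
Proof.
  intros Hq0 Hq HP Hr Hc Hs. induction j as [|j IH].
  - simpl. ring.
  - assert (H := watson_rec q A B (q ^ j * P) (s j) (s (S j)) Hq
      (Cmult_neq_0 _ _ (Cpow_nz _ _ Hq0) HP)
      (watson_regular_shift _ _ _ _ _ Hr)
      (watson_convergent_shift _ _ _ _ _ Hq Hc) (Hs j)).
    specialize (H ltac:(replace (q * (q ^ j * P)) with (q ^ S j * P) by (simpl; ring);
      apply Hs)).
    rewrite !qpoch_S, Cpow_sq.
    match goal with |- ?l1 * ?f1 * (?l2 * ?f2) * (?l3 * ?f3) * (?l4 * ?f4) * ?s0 = _ =>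
      transitivity ((l1 * l2 * l3 * l4 * s0) * (f1 * f2 * f3 * f4));
      [ring | rewrite IH] end.
    match goal with |- ?u * s j * ?f = _ =>
      transitivity (u * (f * s j)); [ring|] end.
    match goal with |- ?u * (?f * s j) = ?rhs =>
      replace (f * s j) with ((1 - A * B * (q ^ j * P) * q)
        * (1 - A * q ^ 2 * (q ^ j * P) ^ 2)
        * (1 - B * q ^ 2 * (q ^ j * P) ^ 2) * s (S j)) end.
    + ring.
    + rewrite <- H. ring.
Qed.

(** * The q-analogue of Gauss's second summation theorem *)

(** Watson's series at [P = 0]. *)
Definition gauss_term (q A B : C) (m : nat) : C :=
  qpoch A q m * qpoch B q m * eprod q 0 m
  / (qpoch q q m * qpoch (A * B * q) (q ^ 2) m).

Definition gauss_cert (q A B : C) (m : nat) : C :=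
  match m with
  | O => 0
  | S i => A * qpoch (A * q) q i * qpoch B q (S i) * eprod q 0 (S i)
           / (qpoch q q i * qpoch (A * B * q) (q ^ 2) (S i))
  end.

(** The same telescoping method, now in the parameter [A -> A q^2]. *)
Lemma gauss_step (q A B : C) (m : nat) :
  nonvanishing q q -> nonvanishing (A * B * q) (q ^ 2) ->
  (1 - A * B * q) * gauss_term q A B m - (1 - A * q) * gauss_term q (A * q ^ 2) B m
  = (1 - A * B * q) * (gauss_cert q A B (S m) - gauss_cert q A B m).
Proof.
  intros HQ HAB.
  assert (H0 := HAB 0%nat). rewrite Cmult_1_r in H0.
  destruct m as [|i].
  - unfold gauss_term, gauss_cert. simpl. field. neq0.
  - unfold gauss_term, gauss_cert.
    assert (HQi := qpoch_nonvanishing _ _ i HQ).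
    assert (HZi := qpoch_nonvanishing _ _ i HAB).
    assert (HQSi := HQ i). assert (HZ1 := HAB i). assert (HZ2 := HAB (S i)).
    rewrite Cpow_sq in HZ1, HZ2. rewrite (Cpow_S q i) in HZ2.
    assert (E1 : qpoch A q (S i) = (1 - A) * qpoch (A * q) q i) by apply qpoch_S_l.
    assert (E2 : (1 - A * q) * qpoch (A * q ^ 2) q (S i)
      = qpoch (A * q) q i * (1 - A * q * q ^ i) * (1 - A * q * (q * q ^ i))).
    { rewrite <- Cpow_S, <- !qpoch_S, (qpoch_S_l (A * q)). do 2 f_equal. ring. }
    assert (E3 : qpoch (A * q ^ 2 * B * q) (q ^ 2) (S i)
      = qpoch (A * B * q) (q ^ 2) i * (1 - A * B * q * (q ^ i * q ^ i))
        * (1 - A * B * q * (q * q ^ i * (q * q ^ i))) / (1 - A * B * q)).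
    { apply Cdiv_of_mult. exact H0.
      rewrite <- Cpow_S, <- !Cpow_sq, <- !qpoch_S, (qpoch_S_l (A * B * q)).
      rewrite Cmult_comm. do 2 f_equal. ring. }
    change (eprod q 0 (S (S i))) with (eprod q 0 (S i) * (q * q ^ S i - q * 0)).
    rewrite E1, E3, !qpoch_S, !Cpow_sq, (Cpow_S q i).
    match goal with |- _ - ?u * ((qpoch (A * q ^ 2) q i * ?f * ?b * ?e) / ?d) = _ =>
      replace (u * ((qpoch (A * q ^ 2) q i * f * b * e) / d))
        with (((1 - A * q) * qpoch (A * q ^ 2) q (S i)) * b * e / d)
        by (rewrite qpoch_S; unfold Cdiv; ring) end.
    rewrite E2.
    field. repeat split; neq0.
Qed.

Lemma gauss_partial (q A B : C) (M : nat) :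
  nonvanishing q q -> nonvanishing (A * B * q) (q ^ 2) ->
  (1 - A * B * q) * csum (gauss_term q A B) M
  - (1 - A * q) * csum (gauss_term q (A * q ^ 2) B) M
  = (1 - A * B * q) * gauss_cert q A B M.
Proof.
  intros HQ HAB. induction M as [|M IH]. simpl; ring.
  rewrite !csum_S. assert (H := gauss_step q A B M HQ HAB).
  transitivity (((1 - A * B * q) * csum (gauss_term q A B) M
    - (1 - A * q) * csum (gauss_term q (A * q ^ 2) B) M)
    + ((1 - A * B * q) * gauss_term q A B M
       - (1 - A * q) * gauss_term q (A * q ^ 2) B M)).
  ring. rewrite IH, H. ring.
Qed.

Lemma eprod_0_upper (q : C) (m : nat) :
  (Cmod q < 1)%R -> (Cmod (eprod q 0 m) <= Cmod q ^ m)%R.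
Proof.
  intros Hq. eapply Rle_trans. now apply eprod_upper_small.
  rewrite Cmod_0. replace (Cmod q * (1 + 0))%R with (Cmod q) by ring. lra.
Qed.

Lemma gauss_term_bound (q A B : C) :
  (Cmod q < 1)%R -> nonvanishing (A * B * q) (q ^ 2) ->
  exists K, (0 <= K)%R /\ forall N m,
    (Cmod (gauss_term q (A * (q ^ 2) ^ N) B m) <= K * Cmod q ^ m)%R.
Proof.
  intros Hq HAB. assert (Hq2 := Cmod_sq_lt1 q Hq).
  destruct (qpoch_lower _ _ Hq2 HAB) as [lAB [HlAB HAB']].
  destruct (qpoch_lower0 _ _ Hq (nonvanishing_base q Hq)) as [lq [Hlq Hq']].
  exists (poch_bound A q * poch_bound B q / (lq * lAB))%R.
  assert (Hl : (0 < lq * lAB)%R) by now apply Rmult_lt_0_compat.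
  split.
  - apply Rdiv_le_0_compat; [|exact Hl].
    apply Rmult_le_pos; left; apply poch_bound_pos.
  - intros N m. unfold gauss_term.
    match goal with |- (Cmod (?a * ?b * ?e / ?d) <= _)%R =>
      replace (a * b * e / d) with (a * b / d * e) by (unfold Cdiv; ring) end.
    apply Cmod_mult_le; [|now apply eprod_0_upper].
    apply Cmod_div_le. 2: exact Hl.
    + apply Cmod_mult_le. 2: now apply qpoch_upper.
      rewrite <- Cpow_mult_r. now apply qpoch_upper_shift.
    + apply Cmod_mult_ge; try (left; assumption).
      * apply Hq'.
      * replace (A * (q ^ 2) ^ N * B * q) with (A * B * q * (q ^ 2) ^ N) by ring.
        apply HAB'.
Qed.

Lemma gauss_summable (q A B : C) :
  (Cmod q < 1)%R -> nonvanishing (A * B * q) (q ^ 2) ->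
  exists S, sums (gauss_term q A B) S.
Proof.
  intros Hq HAB. destruct (gauss_term_bound q A B Hq HAB) as [K [HK Hb]].
  apply (summable_dom _ (fun m => K * Cmod q ^ m)%R).
  - intros m. specialize (Hb 0%nat m).
    replace (A * (q ^ 2) ^ 0) with A in Hb by (simpl; ring). exact Hb.
  - apply ex_series_geom_scal. split; [apply Cmod_ge_0 | exact Hq].
Qed.

Lemma gauss_cert_tends (q A B : C) :
  (Cmod q < 1)%R -> nonvanishing (A * B * q) (q ^ 2) ->
  tends (gauss_cert q A B) 0.
Proof.
  intros Hq HAB. assert (Hq2 := Cmod_sq_lt1 q Hq).
  destruct (qpoch_lower0 _ _ Hq2 HAB) as [lAB [HlAB HAB']].
  destruct (qpoch_lower0 _ _ Hq (nonvanishing_base q Hq)) as [lq [Hlq Hq']].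
  set (K := (Cmod A * poch_bound (A * q)%C q * poch_bound B q / (lq * lAB))%R).
  apply (tends_unshift _ _ 1).
  apply (tends_squeeze _ _ (fun i => K * Cmod q ^ S i)%R 0).
  - intros i _. rewrite Nat.add_1_r. unfold gauss_cert.
    match goal with |- (Cmod (Cminus (?x * ?a * ?b * ?e / ?d) _) <= _)%R =>
      replace (x * a * b * e / d - 0) with (x * a * b / d * e) by (unfold Cdiv; ring) end.
    apply Cmod_mult_le. 2: now apply eprod_0_upper.
    apply Cmod_div_le.
    + repeat apply Cmod_mult_le; try now apply qpoch_upper. lra.
    + now apply Rmult_lt_0_compat.
    + apply Cmod_mult_ge; auto; left; assumption.
  - apply (is_lim_seq_incr_1 (fun i => K * Cmod q ^ i)%R).
    apply is_lim_seq_scal_geom. split; [apply Cmod_ge_0 | exact Hq].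
Qed.

Lemma gauss_rec (q A B S S' : C) :
  (Cmod q < 1)%R -> nonvanishing (A * B * q) (q ^ 2) ->
  sums (gauss_term q A B) S -> sums (gauss_term q (A * q ^ 2) B) S' ->
  (1 - A * B * q) * S = (1 - A * q) * S'.
Proof.
  intros Hq HAB HS HS'.
  assert (H1 := tends_minus _ _ _ _ (tends_scal (1 - A * B * q) _ _ HS)
    (tends_scal (1 - A * q) _ _ HS')).
  assert (H2 := tends_scal (1 - A * B * q) _ _ (gauss_cert_tends q A B Hq HAB)).
  assert (H3 := tends_unique _ _ _ (tends_ext _ _ _
    (fun M => gauss_partial q A B M (nonvanishing_base q Hq) HAB) H1) H2).
  match goal with |- ?u = ?v => replace u with (u - v + v) by ring end.
  rewrite H3. ring.
Qed.

(** Iteration of [gauss_rec] moves [A] to [0], the limit being justified by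
    [tannery]. *)
Lemma gauss_to_zero (q A B S : C) :
  (Cmod q < 1)%R -> nonvanishing (A * B * q) (q ^ 2) ->
  sums (gauss_term q A B) S ->
  exists S0, sums (gauss_term q 0 B) S0 /\
    qpoch_inf (A * B * q) (q ^ 2) * S = qpoch_inf (A * q) (q ^ 2) * S0.
Proof.
  intros Hq HAB HS. assert (Hq2 := Cmod_sq_lt1 q Hq).
  assert (HABN : forall N, nonvanishing (A * (q ^ 2) ^ N * B * q) (q ^ 2)).
  { intros N. replace (A * (q ^ 2) ^ N * B * q) with (A * B * q * (q ^ 2) ^ N) by ring.
    now apply nonvanishing_shift. }
  assert (Hex : forall N, sums (gauss_term q (A * (q ^ 2) ^ N) B)
    (CSeries (gauss_term q (A * (q ^ 2) ^ N) B))).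
  { intros N. destruct (gauss_summable q _ B Hq (HABN N)) as [l Hl].
    now rewrite (sums_CSeries _ _ Hl). }
  set (s := fun N => CSeries (gauss_term q (A * (q ^ 2) ^ N) B)) in *.
  assert (Hit : forall j, qpoch (A * B * q) (q ^ 2) j * S
    = qpoch (A * q) (q ^ 2) j * s j).
  { induction j as [|j IH].
    - simpl. unfold s. replace (A * (q ^ 2) ^ 0) with A by (simpl; ring).
      rewrite (sums_CSeries _ _ HS). ring.
    - assert (H := gauss_rec q (A * (q ^ 2) ^ j) B (s j) (s (Datatypes.S j)) Hq (HABN j) (Hex j)).
      specialize (H ltac:(replace (A * (q ^ 2) ^ j * q ^ 2)
        with (A * (q ^ 2) ^ Datatypes.S j)
        by (rewrite (Cpow_S (q ^ 2)); ring); apply Hex)).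
      rewrite !qpoch_S.
      transitivity ((qpoch (A * B * q) (q ^ 2) j * S) * (1 - A * B * q * (q ^ 2) ^ j)).
      ring. rewrite IH.
      transitivity (qpoch (A * q) (q ^ 2) j * ((1 - A * (q ^ 2) ^ j * B * q) * s j)).
      ring. rewrite H. ring. }
  destruct (gauss_term_bound q A B Hq HAB) as [K [HK Hb]].
  destruct (tannery (fun N => gauss_term q (A * (q ^ 2) ^ N) B) (gauss_term q 0 B)
    s K (Cmod q) 0 (conj (Cmod_ge_0 q) Hq) HK) as [S0 [HS0 Hlim]].
  - intros N m _. apply Hb.
  - intros m. unfold gauss_term.
    assert (HA0 : tends (fun N => A * (q ^ 2) ^ N) 0).
    { replace (RtoC 0) with (A * 0) by ring. apply tends_scal.
      now apply tends_pow_geom. }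
    apply tends_div.
    + apply tends_mult; [|apply tends_const].
      apply tends_mult; [|apply tends_const]. now apply tends_qpoch_arg.
    + apply tends_scal. apply tends_qpoch_arg.
      apply (tends_ext (fun N => (B * q) * (A * (q ^ 2) ^ N))). intros; ring.
      replace (0 * B * q) with ((B * q) * 0) by ring. now apply tends_scal.
    + apply Cmult_neq_0.
      * apply qpoch_nonvanishing. now apply nonvanishing_base.
      * replace (0 * B * q) with (RtoC 0) by ring. rewrite qpoch_0_l. apply C1_nz.
  - exact Hex.
  - exists S0. split. exact HS0.
    apply (tends_unique (fun j => qpoch (A * B * q) (q ^ 2) j * S)).
    + apply tends_mult; [now apply qpoch_tends | apply tends_const].
    + apply (tends_ext (fun j => qpoch (A * q) (q ^ 2) j * s j)).
      intros j. now rewrite Hit.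
      apply tends_mult; [now apply qpoch_tends | exact Hlim].
Qed.

Lemma qpoch_inf_0_l (q : C) : (Cmod q < 1)%R -> qpoch_inf 0 q = 1.
Proof.
  intros Hq. apply (tends_unique (qpoch 0 q)). now apply qpoch_tends.
  apply (tends_ext (fun _ => 1)). intros n. now rewrite qpoch_0_l. apply tends_const.
Qed.

Lemma nonvanishing_0 (q : C) : nonvanishing 0 q.
Proof. intros j. replace (1 - 0 * q ^ j) with (RtoC 1) by ring. apply C1_nz. Qed.

(** The series is symmetric in [A] and [B], hence both can be moved to [0]. The
    series for [A = B = 0] is then evaluated by moving [A] back to [1], where
    only the first term survives. *)
Lemma gauss_second (q A B S : C) :
  (Cmod q < 1)%R -> nonvanishing (A * B * q) (q ^ 2) ->
  sums (gauss_term q A B) S ->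
  qpoch_inf q (q ^ 2) * qpoch_inf (A * B * q) (q ^ 2) * S
  = qpoch_inf (A * q) (q ^ 2) * qpoch_inf (B * q) (q ^ 2).
Proof.
  intros Hq HAB HS. assert (Hq2 := Cmod_sq_lt1 q Hq).
  assert (Hz : forall X, nonvanishing (X * 0 * q) (q ^ 2)).
  { intros X. replace (X * 0 * q) with (RtoC 0) by ring. apply nonvanishing_0. }
  destruct (gauss_to_zero q A B S Hq HAB HS) as [S1 [HS1 E1]].
  assert (HS1' : sums (gauss_term q B 0) S1).
  { apply (tends_ext (csum (gauss_term q 0 B))); [|exact HS1].
    intros n. apply csum_ext. intros i _. unfold gauss_term.
    replace (0 * B * q) with (B * 0 * q) by ring.
    rewrite (Cmult_comm (qpoch 0 q i)). reflexivity. }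
  destruct (gauss_to_zero q B 0 S1 Hq (Hz B) HS1') as [S2 [HS2 E2]].
  assert (HS3 : sums (gauss_term q 1 0) 1).
  { replace (RtoC 1) with (csum (gauss_term q 1 0) 1) at 2.
    - apply sums_finite. intros [|n] Hn. lia. unfold gauss_term.
      rewrite qpoch_S_l. unfold Cdiv. ring.
    - unfold gauss_term. simpl. field. }
  destruct (gauss_to_zero q 1 0 1 Hq (Hz 1) HS3) as [S4 [HS4 E4]].
  assert (HE : S4 = S2) by exact (tends_unique _ _ _ HS4 HS2).
  subst S4. replace (1 * 0 * q) with (RtoC 0) in E4 by ring.
  replace (B * 0 * q) with (RtoC 0) in E2 by ring.
  rewrite qpoch_inf_0_l in E4, E2 by exact Hq2. rewrite Cmult_1_l in E4, E2.
  replace (1 * q) with q in E4 by ring.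
  rewrite <- Cmult_assoc, E1, E2.
  transitivity (qpoch_inf q (q ^ 2) * S2 * (qpoch_inf (A * q) (q ^ 2)
    * qpoch_inf (B * q) (q ^ 2))). ring.
  rewrite <- E4. ring.
Qed.

(** * The sum of Watson's series *)
Lemma watson_term_0 (q A B : C) (m : nat) :
  watson_term q A B 0 m = gauss_term q A B m.
Proof.
  unfold watson_term, gauss_term.
  replace (A * B * q * 0 ^ 2) with (RtoC 0) by ring.
  replace (A * B * 0) with (RtoC 0) by ring.
  replace (B * q * 0) with (RtoC 0) by ring.
  replace (A * q * 0) with (RtoC 0) by ring. rewrite qpoch_0_l.
  assert (H1 : vwp 0 q m = 1).
  { destruct m as [|i]. reflexivity. unfold vwp.
    replace (0 * q) with (RtoC 0) by ring. rewrite qpoch_0_l. ring. }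
  assert (H2 : dup 0 q m = 1).
  { destruct m as [|i]. reflexivity. unfold dup.
    replace (0 * q) with (RtoC 0) by ring. replace (0 * q ^ 2) with (RtoC 0) by ring.
    rewrite !qpoch_0_l. field. }
  rewrite H1, H2, !Cmult_1_r, Cmult_1_l. reflexivity.
Qed.

Lemma watson_term_tends_0 (q A B P : C) (m : nat) :
  (Cmod q < 1)%R -> nonvanishing (A * B * q) (q ^ 2) ->
  tends (fun N => watson_term q A B (q ^ N * P) m) (gauss_term q A B m).
Proof.
  intros Hq HAB. rewrite <- watson_term_0.
  assert (HP : tends (fun N => q ^ N * P) 0).
  { replace (RtoC 0) with (0 * P) by ring. apply tends_mult.
    now apply tends_pow_geom. apply tends_const. }
  assert (HC : tends (fun N => A * B * q * (q ^ N * P) ^ 2) (A * B * q * 0 ^ 2)).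
  { apply tends_scal. apply (tends_mult _ (fun N => q ^ N * P * 1)). exact HP.
    apply tends_mult. exact HP. apply tends_const. }
  unfold watson_term. apply tends_div.
  - apply tends_mult. apply tends_mult. apply tends_mult; [|apply tends_const].
    apply tends_mult; [|apply tends_const].
    + destruct m as [|i]. exact (tends_const 1). unfold vwp.
      apply tends_mult.
      * apply tends_minus. apply tends_const. apply tends_mult; [|apply tends_const].
        now apply tends_scal.
      * apply tends_qpoch_arg. apply tends_mult; [|apply tends_const].
        now apply tends_scal.
    + induction m as [|m IH]. exact (tends_const 1). simpl.
      apply tends_mult. exact IH. apply tends_minus. apply tends_const.
      now apply tends_scal.
    + destruct m as [|i]. exact (tends_const 1). unfold dup.
      apply tends_div.
      * apply tends_qpoch_arg. apply tends_mult; [exact HC|apply tends_const].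
      * apply tends_qpoch_arg. apply tends_mult; [exact HC|apply tends_const].
      * replace (A * B * q * 0 ^ 2 * q) with (RtoC 0) by ring.
        rewrite qpoch_0_l. apply C1_nz.
  - apply tends_mult; [|apply tends_const].
    apply tends_mult. apply tends_scal.
    + apply tends_qpoch_arg. now apply tends_scal.
    + apply tends_qpoch_arg. now apply tends_scal.
  - replace (B * q * 0) with (RtoC 0) by ring.
    replace (A * q * 0) with (RtoC 0) by ring. rewrite qpoch_0_l.
    repeat apply Cmult_neq_0; try apply C1_nz;
      apply qpoch_nonvanishing; [now apply nonvanishing_base | exact HAB].
Qed.

Definition watson_den (q A B P : C) : C :=
  qpoch_inf (A * q * P) q * qpoch_inf (B * q * P) q * qpoch_inf (- (q * P)) q
  * qpoch_inf q (q ^ 2) * qpoch_inf (A * B * q) (q ^ 2)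
  * qpoch_inf (A * B * q ^ 2 * P ^ 2) (q ^ 2).

Definition watson_num (q A B P : C) : C :=
  qpoch_inf (A * B * P * q) q * qpoch_inf (A * q) (q ^ 2) * qpoch_inf (B * q) (q ^ 2)
  * qpoch_inf (A * q ^ 2 * P ^ 2) (q ^ 2) * qpoch_inf (B * q ^ 2 * P ^ 2) (q ^ 2).

(** Iterating the recursion in [P] reduces the series to its limit [P = 0],
    which is Gauss's second theorem. *)
Lemma watson_sum (q A B P S : C) :
  q <> 0 -> (Cmod q < 1)%R -> P <> 0 ->
  watson_regular q A B P -> watson_convergent q A B P ->
  sums (watson_term q A B P) S ->
  watson_den q A B P * S = watson_num q A B P.
Proof.
  intros Hq0 Hq HP Hr Hc HS. assert (Hq2 := Cmod_sq_lt1 q Hq).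
  assert (Hr' := Hr). destruct Hr' as [_ [_ [HAB _]]].
  assert (Hex : forall N, sums (watson_term q A B (q ^ N * P))
    (CSeries (watson_term q A B (q ^ N * P)))).
  { intros N. destruct (watson_summable q A B (q ^ N * P) Hq
      (Cmult_neq_0 _ _ (Cpow_nz _ _ Hq0) HP)
      (watson_regular_shift _ _ _ _ _ Hr)
      (watson_convergent_shift _ _ _ _ _ Hq Hc)) as [l Hl].
    now rewrite (sums_CSeries _ _ Hl). }
  set (s := fun N => CSeries (watson_term q A B (q ^ N * P))) in *.
  assert (Hs0 : s 0%nat = S).
  { unfold s. replace (q ^ 0 * P) with P by (simpl; ring). now apply sums_CSeries. }
  destruct (watson_term_bound q A B P Hq Hr) as [K [HK Hb]].
  (* from some N0 on the geometric ratio |q| (1 + |q^N P|) is bounded by w < 1 *)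
  set (w := ((1 + Cmod q) / 2)%R).
  assert (Hqp := Cmod_ge_0 q).
  assert (Hw : (0 <= w < 1)%R) by (unfold w; lra).
  assert (HPl : tends (fun N => q ^ N * P) 0).
  { replace (RtoC 0) with (0 * P) by ring. apply tends_mult.
    now apply tends_pow_geom. apply tends_const. }
  destruct (tends_eps _ _ ((1 - Cmod q) / 2) HPl ltac:(lra)) as [N0 HN0].
  destruct (tannery (fun N => watson_term q A B (q ^ N * P)) (gauss_term q A B)
    s K w N0 Hw HK) as [S0 [HS0 Hlim]].
  - intros N m HN. eapply Rle_trans. apply Hb.
    apply Rmult_le_compat_l. exact HK.
    eapply Rle_trans. now apply eprod_upper_small.
    specialize (HN0 N HN).
    replace (q ^ N * P - 0) with (q ^ N * P) in HN0 by ring.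
    assert (H0 := Cmod_ge_0 (q ^ N * P)).
    apply pow_incr. split. apply Rmult_le_pos; lra. unfold w. nra.
  - intros m. now apply watson_term_tends_0.
  - exact Hex.
  - assert (HG := gauss_second q A B S0 Hq HAB HS0).
    assert (E : qpoch_inf (- (q * P)) q * qpoch_inf (A * q * P) q
      * qpoch_inf (B * q * P) q * qpoch_inf (A * B * q ^ 2 * P ^ 2) (q ^ 2) * S
      = qpoch_inf (A * B * P * q) q * qpoch_inf (A * q ^ 2 * P ^ 2) (q ^ 2)
        * qpoch_inf (B * q ^ 2 * P ^ 2) (q ^ 2) * S0).
    { apply (tends_unique (fun j => qpoch (- (q * P)) q j * qpoch (A * q * P) q j
        * qpoch (B * q * P) q j
        * qpoch (A * B * q ^ 2 * P ^ 2) (q ^ 2) j * S)).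
      - repeat apply tends_mult; try (now apply qpoch_tends). apply tends_const.
      - apply (tends_ext (fun j => qpoch (A * B * P * q) q j
          * qpoch (A * q ^ 2 * P ^ 2) (q ^ 2) j
          * qpoch (B * q ^ 2 * P ^ 2) (q ^ 2) j * s j)).
        + intros j. rewrite <- Hs0. symmetry. now apply watson_iterate.
        + repeat apply tends_mult; try (now apply qpoch_tends). exact Hlim. }
    unfold watson_den, watson_num.
    transitivity (qpoch_inf q (q ^ 2) * qpoch_inf (A * B * q) (q ^ 2)
      * (qpoch_inf (- (q * P)) q * qpoch_inf (A * q * P) q
      * qpoch_inf (B * q * P) q * qpoch_inf (A * B * q ^ 2 * P ^ 2) (q ^ 2) * S)).
    ring. rewrite E.
    transitivity (qpoch_inf (A * B * P * q) q * qpoch_inf (A * q ^ 2 * P ^ 2) (q ^ 2)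
        * qpoch_inf (B * q ^ 2 * P ^ 2) (q ^ 2)
        * (qpoch_inf q (q ^ 2) * qpoch_inf (A * B * q) (q ^ 2) * S0)).
    ring. rewrite HG. ring.
Qed.

(** * A very-well-poised sum of WP Bailey type *)

(** The upper index of the sum is [S n'], a successor, because the numerator
    factor [(k;q)_(n+r) / (1 - k)] is written as [(k q;q)_(n'+r)]. *)
Definition wp_term (q a k : C) (n' r : nat) : C :=
  qpoch (k * q) q (n' + r) * qpoch (k / a) q (S n' - r) * vwp a q r
  * qpoch (k / a) q r * qpoch (a ^ 2 / k) q (2 * r) * (k / a) ^ r
  / (qpoch q q (S n' - r) * qpoch (a * q) q (S n' + r) * qpoch q q r
     * qpoch (a ^ 2 / k * q) q r * qpoch (k * q) q (2 * r)).

Lemma vwp_S (l q : C) (r : nat) :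
  vwp l q (S r) * (1 - l * (q ^ r * q ^ r))
  = vwp l q r * (1 - l * q ^ r) * (1 - l * (q * q ^ r * (q * q ^ r))).
Proof.
  destruct r as [|i]; unfold vwp.
  - simpl. ring.
  - rewrite qpoch_S. rewrite !Cpow_S. ring.
Qed.

Lemma wp_term_up (q a k : C) (n' r : nat) :
  (r <= S n')%nat ->
  wp_term q a k (S n') r
  = wp_term q a k n' r * (1 - k * q ^ S n' * q ^ r) * (1 - k / a * q ^ (S n' - r))
    / ((1 - q * q ^ (S n' - r)) * (1 - a * q * q ^ S n' * q ^ r)).
Proof.
  intros Hr. unfold wp_term.
  change (S n' + r)%nat with (S (n' + r)).
  change (S (S n') + r)%nat with (S (S (n' + r))).
  replace (S (S n') - r)%nat with (S (S n' - r)) by lia.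
  rewrite (qpoch_S (k * q) q (n' + r)), (qpoch_S (a * q) q (S (n' + r))).
  rewrite (qpoch_S (k / a)), (qpoch_S q q (S n' - r)).
  replace (a * q * q ^ S n' * q ^ r) with (a * q * q ^ S (n' + r))
    by (rewrite !Cpow_S, Cpow_add_r; ring).
  rewrite (Cpow_add_r q n' r), (Cpow_S q n').
  unfold Cdiv. rewrite !Cinv_mult. ring.
Qed.

(** A telescoping certificate, divided by the summand: with [x = q^r],
    [y = q^n] and [w = y / x], [wp_cert] is the certificate at [r] divided by the
    summand at [r], and [wp_cert_next] is the certificate at [r + 1] divided by
    the same summand. *)
Definition wp_cert (q a k w x y : C) : C :=
  - (q ^ 2 * y ^ 2) * (1 - x) * (1 - a ^ 2 / k * x) * (1 - k * x ^ 2 / q) * (1 - k * x ^ 2)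
  * (1 - k / a * w) / ((1 - a * x ^ 2) * (1 - q * w) * x
    * ((1 - q * y) * (1 - a ^ 2 / k * q * y) * (1 - k * q ^ 2 * y ^ 2))).

Definition wp_cert_next (q a k x y : C) : C :=
  - (q * y ^ 2 * (k / a) / x) * (1 - k * y * x) * (1 - a * x) * (1 - k / a * x)
  * (1 - a ^ 2 / k * x ^ 2) * (1 - a ^ 2 / k * q * x ^ 2)
  / ((1 - a * q * y * x) * (1 - a * x ^ 2)
    * ((1 - q * y) * (1 - a ^ 2 / k * q * y) * (1 - k * q ^ 2 * y ^ 2))).

(** The weighted sums [wp_X] and [wp_Y] do not satisfy separate first-order
    recursions in [n], but together they satisfy a linear system. Its matrix,
    at [y = q^n] and up to the factor [wp_D], has the four entries that
    follow. *)
Definition wp_XX (q a k y : C) : C :=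
  1 - (k + k ^ 2 / a ^ 2) * y + (1 + q) * (q * a - k ^ 2 / a) * y ^ 2
  + q ^ 2 * (k + a ^ 2) * y ^ 3 - k ^ 2 * q ^ 2 * y ^ 4.
Definition wp_XY (q a k y : C) : C :=
  (k - a) * (/ a + q / k) * y + (k + a ^ 2) * (k / a ^ 2 - q ^ 2 / k) * y ^ 2
  + (k - a) * (q ^ 2 + q * k / a) * y ^ 3.
Definition wp_YX (q a k y : C) : C :=
  (k + a) * y * ((q - k / a) * (1 + k * q * y ^ 2) + q * (a - k) * (a ^ 2 + k) / a ^ 2 * y).
Definition wp_YY (q a k y : C) : C :=
  1 - q * (1 + a ^ 2 / k) * y - (1 + q) * (q * a - k ^ 2 / a) * y ^ 2
  + q * (k ^ 2 / a ^ 2) * (k + a ^ 2) * y ^ 3 - k ^ 2 * q ^ 2 * y ^ 4.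
Definition wp_D (q a k y : C) : C :=
  (1 - q * y) * (1 - a ^ 2 / k * q * y) * (1 - k * q ^ 2 * y ^ 2).

Lemma clear_k_neq0 (q a k y : C) :
  k <> 0 -> 1 - a ^ 2 / k * q * y <> 0 -> k - a ^ 2 * q * y <> 0.
Proof.
  intros Hk H. replace (k - a ^ 2 * q * y) with (k * (1 - a ^ 2 / k * q * y))
    by (field; auto). now apply Cmult_neq_0.
Qed.

Lemma wp_D_factors (q a k y : C) :
  k <> 0 -> wp_D q a k y <> 0 ->
  1 - q * y <> 0 /\ 1 - a ^ 2 / k * q * y <> 0 /\ 1 - k * q ^ 2 * y ^ 2 <> 0
  /\ k - a ^ 2 * q * y <> 0.
Proof.
  unfold wp_D. intros Hk HD.
  assert (H1 := Cmult_neq0_l _ _ HD). assert (H2 := Cmult_neq0_r _ _ H1).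
  repeat split; [exact (Cmult_neq0_l _ _ H1) | exact H2 | exact (Cmult_neq0_r _ _ HD)
    | now apply clear_k_neq0].
Qed.

(** The summands of the two rows of the system telescope. Division by the
    summand leaves identities between rational functions of [x] and [w]. *)
Lemma wp_core_Y (q a k x w y : C) :
  y = x * w ->
  q <> 0 -> a <> 0 -> k <> 0 -> x <> 0 -> 1 - a * x ^ 2 <> 0 -> 1 - q * w <> 0 ->
  1 - a * q * y * x <> 0 ->
  wp_D q a k y <> 0 ->
  wp_D q a k y
    * ((1 - k / a * w) * (1 - k * y * x) / ((1 - q * w) * (1 - a * q * y * x)))
    * ((k + a) * x)
  - wp_YX q a k y * (1 + a * x ^ 2) - wp_YY q a k y * ((k + a) * x)
  = wp_D q a k y * (k + a)
    * (wp_cert_next q a k x y - wp_cert q a k w x y).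
Proof.
  intros -> Hq Ha Hk Hx H1 H2 H3 HD.
  destruct (wp_D_factors _ _ _ _ Hk HD) as [D1 [D2 [D3 D4]]]. clear HD.
  unfold wp_D, wp_cert_next, wp_cert, wp_YX, wp_YY.
  field. repeat split; neq0.
Qed.

Lemma wp_core_X (q a k x w y : C) :
  y = x * w ->
  q <> 0 -> a <> 0 -> k <> 0 -> x <> 0 -> w <> 0 ->
  1 - a * x ^ 2 <> 0 -> 1 - q * w <> 0 ->
  1 - a * q * y * x <> 0 ->
  wp_D q a k y <> 0 ->
  wp_D q a k y
    * ((1 - k / a * w) * (1 - k * y * x) / ((1 - q * w) * (1 - a * q * y * x)))
    * (1 + a * x ^ 2)
  - wp_XX q a k y * (1 + a * x ^ 2) - wp_XY q a k y * ((k + a) * x)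
  = wp_D q a k y * ((1 + a * q ^ 2 * y ^ 2) / (q * y))
    * (wp_cert_next q a k x y - wp_cert q a k w x y).
Proof.
  intros -> Hq Ha Hk Hx Hw H1 H2 H3 HD.
  destruct (wp_D_factors _ _ _ _ Hk HD) as [D1 [D2 [D3 D4]]]. clear HD.
  unfold wp_D, wp_cert_next, wp_cert, wp_XX, wp_XY.
  field. repeat split; neq0.
Qed.

(** The two descriptions of the certificate agree. *)
Lemma wp_cert_shift (q a k : C) (n' r : nat) :
  q <> 0 -> a <> 0 -> k <> 0 -> wp_D q a k (q ^ S n') <> 0 -> 1 - a * q ^ r * q ^ r <> 0 -> 1 - a * q ^ S r * q ^ S r <> 0 ->
  (r <= n')%nat ->
  qpoch q q (S n' - r) <> 0 -> qpoch (a * q) q (S n' + S r) <> 0 -> qpoch q q (S r) <> 0 ->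
  qpoch (a ^ 2 / k * q) q (S r) <> 0 -> qpoch (k * q) q (2 * S r) <> 0 ->
  wp_cert_next q a k (q ^ r) (q ^ S n') * wp_term q a k n' r
  = wp_cert q a k (q ^ (S n' - S r)) (q ^ S r) (q ^ S n') * wp_term q a k n' (S r).
Proof.
  intros Hq Ha Hk HD Hx Hqx Hr H1 H2 H3 H4 H5.
  assert (Hxr := Cpow_nz q r Hq).
  unfold wp_term, wp_cert, wp_cert_next.
  assert (HV := vwp_S a q r).
  replace (vwp a q (S r)) with (vwp a q r * (1 - a * q ^ r)
    * (1 - a * (q * q ^ r * (q * q ^ r))) / (1 - a * q ^ r * q ^ r)).
  2:{ symmetry. apply Cdiv_of_mult. exact Hx. rewrite <- HV. ring. }
  clear HV.
  assert (Hy : q ^ S n' = q * q ^ r * q ^ (n' - r)).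
  { rewrite <- Cpow_S, <- Cpow_add_r. f_equal. lia. }
  replace (S n' - r)%nat with (S (n' - r)) in * by lia.
  replace (S n' - S r)%nat with (n' - r)%nat by lia.
  replace (n' + S r)%nat with (S (n' + r)) by lia.
  replace (S n' + S r)%nat with (S (S n' + r)) in * by lia.
  replace (2 * S r)%nat with (S (S (2 * r))) in * by lia.
  repeat rewrite qpoch_S in *.
  repeat rewrite (Cpow_S q (2 * r)) in *.
  repeat rewrite Cpow_double in *.
  repeat rewrite (Cpow_S q (S n' + r)) in *. 
  change (S n' + r)%nat with (S (n' + r)) in *.
  repeat rewrite (Cpow_S q (n' + r)) in *. 
  replace (q ^ (n' + r)) with (q ^ r * q ^ (n' - r) * q ^ r) in *
    by (rewrite <- !Cpow_add_r; f_equal; lia).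
  repeat rewrite Hy in *. clear Hy.
  repeat rewrite (Cpow_S q r) in *.
  rewrite (Cpow_S (k / a)).
  generalize dependent (q ^ r). intros x HD Hx Hqx H2 H3 H4 H5 Hxr.
  destruct (wp_D_factors _ _ _ _ Hk HD) as [D1 [D2 [D3 D4]]]. clear HD.
  assert (H1l := Cmult_neq0_l _ _ H1). assert (H1r := Cmult_neq0_r _ _ H1).
  assert (H2l := Cmult_neq0_l _ _ H2). assert (H2r := Cmult_neq0_r _ _ H2).
  assert (H3l := Cmult_neq0_l _ _ H3). assert (H3r := Cmult_neq0_r _ _ H3).
  assert (H4l := Cmult_neq0_l _ _ H4). assert (H4r := Cmult_neq0_r _ _ H4).
  assert (H5r := Cmult_neq0_r _ _ H5).
  assert (H5m := Cmult_neq0_r _ _ (Cmult_neq0_l _ _ H5)).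
  assert (H5l := Cmult_neq0_l _ _ (Cmult_neq0_l _ _ H5)).
  assert (D5 := clear_k_neq0 _ _ _ _ Hk H4r). clear H1 H2 H3 H4 H5.
  generalize dependent (qpoch (k * q) q (2 * r)). intros.
  field. repeat split; neq0.
Qed.

(** The boundary term of the telescoping at [r = n] is, up to the weight,
    the opposite of the summand [r = n + 1] which only occurs for the larger
    upper index. *)
Lemma wp_end (q a k : C) (n' : nat) :
  q <> 0 -> a <> 0 -> k <> 0 -> wp_D q a k (q ^ S n') <> 0 ->
  1 - a * q ^ S n' * q ^ S n' <> 0 ->
  qpoch q q (S (S n')) <> 0 -> qpoch (a * q) q (2 * S (S n')) <> 0 ->
  qpoch (a ^ 2 / k * q) q (S (S n')) <> 0 -> qpoch (k * q) q (2 * S (S n')) <> 0 ->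
  wp_cert_next q a k (q ^ S n') (q ^ S n') * wp_term q a k n' (S n')
  = - (q * q ^ S n') * wp_term q a k (S n') (S (S n')).
Proof.
  intros Hq Ha Hk HD Hx H1 H2 H3 H4.
  set (n := S n') in *.
  assert (Hy0 := Cpow_nz q n Hq).
  unfold wp_term, wp_cert_next. fold n.
  assert (HV := vwp_S a q n).
  replace (vwp a q (S n)) with (vwp a q n * (1 - a * q ^ n)
    * (1 - a * (q * q ^ n * (q * q ^ n))) / (1 - a * q ^ n * q ^ n)).
  2:{ symmetry. apply Cdiv_of_mult. exact Hx. rewrite <- HV. ring. }
  clear HV.
  replace (n - n)%nat with 0%nat by lia. replace (S n - S n)%nat with 0%nat by lia.
  assert (E0 : qpoch (k * q) q (2 * n) = qpoch (k * q) q (n' + n) * (1 - k * (q ^ n * q ^ n))).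
  { replace (2 * n)%nat with (S (n' + n)) by (unfold n; lia). rewrite qpoch_S, Cpow_add_r.
    f_equal. unfold n. rewrite Cpow_S. ring. }
  assert (HKe : qpoch (k * q) q (2 * S n) = qpoch (k * q) q (n' + n)
    * (1 - k * (q ^ n * q ^ n)) * (1 - k * q * (q ^ n * q ^ n))
    * (1 - k * q * (q * (q ^ n * q ^ n)))).
  { replace (2 * S n)%nat with (S (S (2 * n))) by lia.
    rewrite !qpoch_S, E0, (Cpow_S q (2 * n)), Cpow_double. reflexivity. }
  rewrite HKe in *. rewrite E0.
  replace (n + S n)%nat with (S (2 * n)) by lia.
  replace (n + n)%nat with (2 * n)%nat by lia.
  replace (S n + S n)%nat with (S (S (2 * n))) by lia.
  replace (2 * S n)%nat with (S (S (2 * n))) in * by lia.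
  repeat rewrite qpoch_S in *.
  rewrite E0 in *. clear E0 HKe.
  repeat rewrite (Cpow_S q (2 * n)) in *.
  repeat rewrite Cpow_double in *.
  rewrite (Cpow_S (k / a)).
  replace (n' + S n)%nat with (2 * n)%nat by (unfold n; lia).
  repeat rewrite (Cpow_S q n) in *.
  change (qpoch (k / a) q 0) with (RtoC 1). change (qpoch q q 0) with (RtoC 1).
  clearbody n.
  generalize dependent (q ^ n). intros y. intros.
  destruct (wp_D_factors _ _ _ _ Hk HD) as [D1 [D2 [D3 D4]]]. clear HD.
  assert (H2l := Cmult_neq0_l _ _ (Cmult_neq0_l _ _ H2)).
  assert (H2r := Cmult_neq0_r _ _ H2).
  assert (H2m := Cmult_neq0_r _ _ (Cmult_neq0_l _ _ H2)).
  assert (H1l := Cmult_neq0_l _ _ H1). assert (H1r := Cmult_neq0_r _ _ H1).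
  assert (H3l := Cmult_neq0_l _ _ H3). assert (H3r := Cmult_neq0_r _ _ H3).
  assert (H4a := Cmult_neq0_r _ _ H4).
  assert (H4b := Cmult_neq0_r _ _ (Cmult_neq0_l _ _ H4)).
  assert (H4' := Cmult_neq0_l _ _ (Cmult_neq0_l _ _ H4)).
  assert (H4c := Cmult_neq0_r _ _ H4'). assert (H4d := Cmult_neq0_l _ _ H4').
  clear H4' H1 H2 H3 H4.
  generalize dependent (qpoch (k * q) q (n' + n)). intros.
  field. repeat split; neq0.
Qed.

Lemma wp_telescope (q a k cX cY kappa : C) (W : nat -> C) (n' M : nat) :
  q <> 0 -> a <> 0 -> k <> 0 -> wp_D q a k (q ^ S n') <> 0 -> 1 - a <> 0 ->
  qpoch q q (S n') <> 0 -> qpoch (a * q) q (2 * S n') <> 0 ->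
  qpoch (a ^ 2 / k * q) q (S n') <> 0 -> qpoch (k * q) q (2 * S n') <> 0 ->
  (forall r, (r <= S n')%nat ->
    wp_D q a k (q ^ S n') * ((1 - k / a * q ^ (S n' - r)) * (1 - k * q ^ S n' * q ^ r)
      / ((1 - q * q ^ (S n' - r)) * (1 - a * q * q ^ S n' * q ^ r))) * W r
    - cX * (1 + a * (q ^ r) ^ 2) - cY * ((k + a) * q ^ r)
    = wp_D q a k (q ^ S n') * kappa
      * (wp_cert_next q a k (q ^ r) (q ^ S n')
         - wp_cert q a k (q ^ (S n' - r)) (q ^ r) (q ^ S n'))) ->
  (M <= S n')%nat ->
  wp_D q a k (q ^ S n') * csum (fun r => wp_term q a k (S n') r * W r) (S M)
  - cX * csum (fun r => wp_term q a k n' r * (1 + a * (q ^ r) ^ 2)) (S M)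
  - cY * csum (fun r => wp_term q a k n' r * ((k + a) * q ^ r)) (S M)
  = wp_D q a k (q ^ S n') * kappa
    * (wp_cert_next q a k (q ^ M) (q ^ S n') * wp_term q a k n' M).
Proof.
  intros Hq Ha Hk HD Ha1 HQ HA HC HK HW.
  assert (Hterm : forall r, (r <= S n')%nat ->
    wp_D q a k (q ^ S n') * (wp_term q a k (S n') r * W r)
    - cX * (wp_term q a k n' r * (1 + a * (q ^ r) ^ 2))
    - cY * (wp_term q a k n' r * ((k + a) * q ^ r))
    = wp_D q a k (q ^ S n') * kappa
      * (wp_cert_next q a k (q ^ r) (q ^ S n')
         - wp_cert q a k (q ^ (S n' - r)) (q ^ r) (q ^ S n')) * wp_term q a k n' r).
  { intros r Hr. rewrite <- HW by exact Hr. rewrite wp_term_up by exact Hr.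
    unfold Cdiv. ring. }
  assert (Hax : forall r, (r <= S n')%nat -> 1 - a * q ^ r * q ^ r <> 0).
  { intros [|r] Hr.
    - replace (1 - a * q ^ 0 * q ^ 0) with (1 - a) by ring. exact Ha1.
    - replace (a * q ^ S r * q ^ S r) with (a * q * q ^ (S (2 * r)))
        by (rewrite !Cpow_S, Cpow_double; ring).
      apply (qpoch_factor_neq0 _ _ _ _ HA). lia. }
  induction M as [|M IH]; intros HM.
  - specialize (Hterm 0%nat HM). simpl csum.
    transitivity (wp_D q a k (q ^ S n') * (wp_term q a k (S n') 0 * W 0%nat)
    - cX * (wp_term q a k n' 0 * (1 + a * (q ^ 0) ^ 2))
    - cY * (wp_term q a k n' 0 * ((k + a) * q ^ 0))). simpl; ring.
    rewrite Hterm.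
    replace (wp_cert q a k (q ^ (S n' - 0)) (q ^ 0) (q ^ S n')) with (RtoC 0).
    ring. unfold wp_cert, Cdiv. replace (1 - q ^ 0) with (RtoC 0) by ring. ring.
  - specialize (IH ltac:(lia)). specialize (Hterm (S M) HM).
    rewrite 3(csum_S _ (S M)).
    match goal with |- ?d * (?s1 + ?t1) - ?c1 * (?s2 + ?t2) - ?c2 * (?s3 + ?t3) = _ =>
      transitivity ((d * s1 - c1 * s2 - c2 * s3) + (d * t1 - c1 * t2 - c2 * t3)) end.
    ring. cbv beta. rewrite IH, Hterm.
    rewrite (wp_cert_shift q a k n' M Hq Ha Hk HD (Hax M ltac:(lia)) (Hax (S M) HM)
      ltac:(lia)).
    + ring.
    + apply (qpoch_neq0_le _ _ _ _ HQ). lia.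
    + apply (qpoch_neq0_le _ _ _ _ HA). lia.
    + apply (qpoch_neq0_le _ _ _ _ HQ). lia.
    + apply (qpoch_neq0_le _ _ _ _ HC). lia.
    + apply (qpoch_neq0_le _ _ _ _ HK). lia.
Qed.

Definition wp_X (q a k : C) (n' : nat) : C :=
  csum (fun r => wp_term q a k n' r * (1 + a * (q ^ r) ^ 2)) (S (S n')).
Definition wp_Y (q a k : C) (n' : nat) : C :=
  csum (fun r => wp_term q a k n' r * ((k + a) * q ^ r)) (S (S n')).

Lemma wp_rec (q a k : C) (n' : nat) :
  q <> 0 -> a <> 0 -> k <> 0 -> 1 - a <> 0 ->
  qpoch q q (S (S n')) <> 0 -> qpoch (a * q) q (2 * S (S n')) <> 0 ->
  qpoch (a ^ 2 / k * q) q (S (S n')) <> 0 -> qpoch (k * q) q (2 * S (S n')) <> 0 ->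
  wp_D q a k (q ^ S n') * wp_X q a k (S n')
    = wp_XX q a k (q ^ S n') * wp_X q a k n' + wp_XY q a k (q ^ S n') * wp_Y q a k n' /\
  wp_D q a k (q ^ S n') * wp_Y q a k (S n')
    = wp_YX q a k (q ^ S n') * wp_X q a k n' + wp_YY q a k (q ^ S n') * wp_Y q a k n'.
Proof.
  intros Hq Ha Hk Ha1 HQ HA HC HK.
  assert (HD : wp_D q a k (q ^ S n') <> 0).
  { unfold wp_D. repeat apply Cmult_neq_0.
    - apply (qpoch_factor_neq0 _ _ _ _ HQ). lia.
    - apply (qpoch_factor_neq0 _ _ _ _ HC). lia.
    - replace (k * q ^ 2 * (q ^ S n') ^ 2) with (k * q * q ^ S (2 * S n'))
        by (rewrite (Cpow_S q (2 * S n')), Cpow_double; ring).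
      apply (qpoch_factor_neq0 _ _ _ _ HK). lia. }
  assert (HQ' : qpoch q q (S n') <> 0).
  { apply (qpoch_neq0_le _ _ _ _ HQ). lia. }
  assert (HA' : qpoch (a * q) q (2 * S n') <> 0).
  { apply (qpoch_neq0_le _ _ _ _ HA). lia. }
  assert (HC' : qpoch (a ^ 2 / k * q) q (S n') <> 0).
  { apply (qpoch_neq0_le _ _ _ _ HC). lia. }
  assert (HK' : qpoch (k * q) q (2 * S n') <> 0).
  { apply (qpoch_neq0_le _ _ _ _ HK). lia. }
  assert (Hax : forall r, (r <= S n')%nat -> 1 - a * (q ^ r) ^ 2 <> 0).
  { intros [|r] Hr.
    - replace (1 - a * (q ^ 0) ^ 2) with (1 - a) by ring. exact Ha1.
    - replace (a * (q ^ S r) ^ 2) with (a * q * q ^ (S (2 * r)))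
        by (rewrite !Cpow_S, Cpow_double; ring).
      apply (qpoch_factor_neq0 _ _ _ _ HA). lia. }
  assert (Haxy : forall r, (r <= S n')%nat -> 1 - a * q * q ^ S n' * q ^ r <> 0).
  { intros r Hr. rewrite <- Cmult_assoc, <- Cpow_add_r.
    apply (qpoch_factor_neq0 _ _ _ _ HA). lia. }
  assert (Hend := wp_end q a k n' Hq Ha Hk HD).
  specialize (Hend ltac:(replace (a * q ^ S n' * q ^ S n') with (a * (q ^ S n') ^ 2)
    by ring; apply Hax; lia) HQ HA HC HK).
  assert (Hw : forall r, (r <= S n')%nat -> 1 - q * q ^ (S n' - r) <> 0).
  { intros r Hr. apply (qpoch_factor_neq0 _ _ _ _ HQ). lia. }
  assert (Hyx : forall r, (r <= S n')%nat -> q ^ S n' = q ^ r * q ^ (S n' - r)).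
  { intros r Hr. rewrite <- Cpow_add_r. f_equal. lia. }
  assert (Hy0 := Cpow_nz q (S n') Hq).
  split.
  - assert (HT := wp_telescope q a k (wp_XX q a k (q ^ S n')) (wp_XY q a k (q ^ S n'))
      ((1 + a * q ^ 2 * (q ^ S n') ^ 2) / (q * q ^ S n'))
      (fun r => 1 + a * (q ^ r) ^ 2) n' (S n') Hq Ha Hk HD Ha1 HQ' HA' HC' HK').
    specialize (HT ltac:(intros r Hr; apply wp_core_X; auto using Cpow_nz) (le_n _)).
    rewrite Hend in HT. unfold wp_X at 1. rewrite csum_S, Cmult_plus_distr_l.
    fold (wp_X q a k n') in HT. fold (wp_Y q a k n') in HT.
    match type of HT with ?u - ?v - ?w = ?z =>
      replace u with (u - v - w + v + w) by ring end.
    rewrite HT. rewrite (Cpow_S q (S n')). field. auto.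
  - assert (HT := wp_telescope q a k (wp_YX q a k (q ^ S n')) (wp_YY q a k (q ^ S n'))
      (k + a)
      (fun r => (k + a) * q ^ r) n' (S n') Hq Ha Hk HD Ha1 HQ' HA' HC' HK').
    specialize (HT ltac:(intros r Hr; apply wp_core_Y; auto using Cpow_nz) (le_n _)).
    rewrite Hend in HT. unfold wp_Y at 1. rewrite csum_S, Cmult_plus_distr_l.
    fold (wp_X q a k n') in HT. fold (wp_Y q a k n') in HT.
    match type of HT with ?u - ?v - ?w = ?z =>
      replace u with (u - v - w + v + w) by ring end.
    rewrite HT. rewrite (Cpow_S q (S n')). ring.
Qed.

Definition wp_C (q a k : C) (n' : nat) : C :=
  qpoch (k ^ 2 / a ^ 2) q (S n') / (qpoch q q (S n') * (1 - k * (q ^ S n') ^ 2)).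

Lemma wp_closed_step_X (q a k y : C) :
  a <> 0 -> k <> 0 ->
  wp_XX q a k y * (1 + a * y) + wp_XY q a k y * (k * y + a)
  = (1 - k ^ 2 / a ^ 2 * y) * (1 - a ^ 2 / k * q * y) * (1 - k * y ^ 2) * (1 + a * (q * y)).
Proof. intros Ha Hk. unfold wp_XX, wp_XY. field. auto. Qed.

Lemma wp_closed_step_Y (q a k y : C) :
  a <> 0 -> k <> 0 ->
  wp_YX q a k y * (1 + a * y) + wp_YY q a k y * (k * y + a)
  = (1 - k ^ 2 / a ^ 2 * y) * (1 - a ^ 2 / k * q * y) * (1 - k * y ^ 2) * (k * (q * y) + a).
Proof. intros Ha Hk. unfold wp_YX, wp_YY. field. auto. Qed.

(** The closed forms satisfy the system by the two preceding identities, and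
    the initial values agree. *)
Lemma wp_closed (q a k : C) (n' : nat) :
  q <> 0 -> a <> 0 -> k <> 0 -> 1 - a <> 0 ->
  qpoch q q (S n') <> 0 -> qpoch (a * q) q (2 * S n') <> 0 ->
  qpoch (a ^ 2 / k * q) q (S n') <> 0 -> qpoch (k * q) q (2 * S n') <> 0 ->
  wp_X q a k n' = wp_C q a k n' * (1 + a * q ^ S n') /\
  wp_Y q a k n' = wp_C q a k n' * (k * q ^ S n' + a).
Proof.
  intros Hq Ha Hk Ha1. induction n' as [|n' IH]; intros HQ HA HC HK.
  - simpl in HQ, HA, HC, HK.
    assert (Q1 := Cmult_neq0_r _ _ HQ). assert (A2 := Cmult_neq0_r _ _ HA).
    assert (A1 := Cmult_neq0_r _ _ (Cmult_neq0_l _ _ HA)).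
    assert (C1 := Cmult_neq0_r _ _ HC). assert (K2 := Cmult_neq0_r _ _ HK).
    assert (K1 := Cmult_neq0_r _ _ (Cmult_neq0_l _ _ HK)).
    assert (D := clear_k_neq0 _ _ _ _ Hk C1).
    clear HQ HA HC HK C1.
    unfold wp_X, wp_Y, wp_C, wp_term. simpl.
    split; field; repeat split; neq0.
  - destruct (wp_rec q a k n' Hq Ha Hk Ha1 HQ HA HC HK) as [EX EY].
    assert (HQ' : qpoch q q (S n') <> 0).
    { apply (qpoch_neq0_le _ _ _ _ HQ). lia. }
    assert (HA' : qpoch (a * q) q (2 * S n') <> 0).
    { apply (qpoch_neq0_le _ _ _ _ HA). lia. }
    assert (HC' : qpoch (a ^ 2 / k * q) q (S n') <> 0).
    { apply (qpoch_neq0_le _ _ _ _ HC). lia. }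
    assert (HK' : qpoch (k * q) q (2 * S n') <> 0).
    { apply (qpoch_neq0_le _ _ _ _ HK). lia. }
    destruct (IH HQ' HA' HC' HK') as [IX IY].
    assert (D1 : 1 - q * q ^ S n' <> 0) by (apply (qpoch_factor_neq0 _ _ _ _ HQ); lia).
    assert (D2 : 1 - a ^ 2 / k * q * q ^ S n' <> 0)
      by (apply (qpoch_factor_neq0 _ _ _ _ HC); lia).
    assert (D3 : 1 - k * q ^ 2 * (q ^ S n') ^ 2 <> 0).
    { replace (k * q ^ 2 * (q ^ S n') ^ 2) with (k * q * q ^ S (2 * S n'))
        by (rewrite (Cpow_S q (2 * S n')), Cpow_double; ring).
      apply (qpoch_factor_neq0 _ _ _ _ HK). lia. }
    assert (D4 : 1 - k * (q ^ S n') ^ 2 <> 0).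
    { replace (k * (q ^ S n') ^ 2) with (k * q * q ^ S (2 * n'))
        by (rewrite !Cpow_S, Cpow_double; ring).
      apply (qpoch_factor_neq0 _ _ _ _ HK). lia. }
    assert (HD : wp_D q a k (q ^ S n') <> 0)
      by (unfold wp_D; repeat apply Cmult_neq_0; assumption).
    assert (FX := wp_closed_step_X q a k (q ^ S n') Ha Hk).
    assert (FY := wp_closed_step_Y q a k (q ^ S n') Ha Hk).
    assert (EC : wp_D q a k (q ^ S n') * wp_C q a k (S n') = wp_C q a k n'
      * ((1 - k ^ 2 / a ^ 2 * q ^ S n') * (1 - a ^ 2 / k * q * q ^ S n')
         * (1 - k * (q ^ S n') ^ 2))).
    { unfold wp_C, wp_D. rewrite !(qpoch_S _ _ (S n')), (Cpow_S q (S n')).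
      assert (Dk := clear_k_neq0 _ _ _ _ Hk D2).
      field. repeat split; neq0. }
    split; apply (Cmult_eq_l _ _ _ HD).
    + rewrite EX, IX, IY, (Cpow_S q (S n')).
      transitivity (wp_C q a k n' * (wp_XX q a k (q ^ S n') * (1 + a * q ^ S n')
        + wp_XY q a k (q ^ S n') * (k * q ^ S n' + a))). ring.
      rewrite FX.
      transitivity (wp_D q a k (q ^ S n') * wp_C q a k (S n') * (1 + a * (q * q ^ S n'))).
      rewrite EC. ring. ring.
    + rewrite EY, IX, IY, (Cpow_S q (S n')).
      transitivity (wp_C q a k n' * (wp_YX q a k (q ^ S n') * (1 + a * q ^ S n')
        + wp_YY q a k (q ^ S n') * (k * q ^ S n' + a))). ring.
      rewrite FY.
      transitivity (wp_D q a k (q ^ S n') * wp_C q a k (S n') * (k * (q * q ^ S n') + a)).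
      rewrite EC. ring. ring.
Qed.

(** The coefficients of the WP Bailey pair used in the double sum, indexed by
    [m = n - r] and [r]. *)
Definition beta_term (q a s : C) (m r : nat) : C :=
  vwp (s ^ 2 * q ^ (2 * r)) q m * qpoch (s ^ 2 / a) q m * qpoch (s ^ 2 / a) q r
  * (s ^ 2 / a) ^ r * qpoch (a ^ 2 / s ^ 2 * q) (q ^ 2) r
  * qpoch (a / s) q r * qpoch (- (a * q / s)) q r * (1 + s * q ^ r)
  / ((1 + s) * qpoch q q m * qpoch q q r * qpoch (a ^ 2 / s ^ 2 * q) q r
     * qpoch (a * q ^ r) q r * qpoch (a * q ^ (2 * r + 1)) q m).

Lemma vwp_join (l q : C) (m r : nat) :
  (1 <= m + r)%nat ->
  vwp (l * q ^ (2 * r)) q m * qpoch (l * q) q (2 * r)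
  = (1 - l * (q ^ (m + r)) ^ 2) * qpoch (l * q) q (pred (m + r) + r).
Proof.
  intros H. destruct m as [|i].
  - destruct r as [|r]. lia. unfold vwp.
    replace (2 * S r)%nat with (S (r + S r)) by lia. rewrite qpoch_S.
    replace (pred (0 + S r)) with r by reflexivity.
    replace (0 + S r)%nat with (S r) by reflexivity.
    rewrite Cpow_add_r, !Cpow_S. ring.
  - unfold vwp. replace (pred (S i + r) + r)%nat with (2 * r + i)%nat by (simpl; lia).
    rewrite (qpoch_add (l * q)).
    replace (l * q * q ^ (2 * r)) with (l * q ^ (2 * r) * q) by ring.
    rewrite Cpow_add_r, Cpow_double. ring.
Qed.

Lemma vwp_split (a q : C) (m r : nat) :
  vwp a q r * (qpoch (a * q ^ r) q r * qpoch (a * q ^ (2 * r + 1)) q m)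
  = qpoch (a * q) q (m + r + r).
Proof.
  destruct r as [|r].
  - simpl. rewrite !Nat.add_0_r. replace (a * (q * 1)) with (a * q) by ring. ring.
  - replace (m + S r + S r)%nat with (r + (S r + 1 + m))%nat by lia.
    rewrite (qpoch_add (a * q) q r), (qpoch_add _ q (S r + 1)), (qpoch_add _ q (S r)).
    unfold vwp. rewrite (qpoch_S _ _ 0). change (qpoch (a * q * q ^ r * q ^ S r) q 0) with (RtoC 1).
    replace (a * q * q ^ r * q ^ (S r + 1)) with (a * q ^ (2 * S r + 1))
      by (rewrite !Cpow_add_r, !Cpow_double, !Cpow_S; ring).
    replace (a * q * q ^ r) with (a * q ^ S r) by (rewrite Cpow_S; ring).
    replace (a * q ^ S r * q ^ S r * q ^ 0) with (a * (q ^ S r * q ^ S r)) by ring.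
    ring.
Qed.

(** The two weights combine because
    [1 + a x^2 + (s^2 + a) x / s = (1 + s x) (1 + a x / s)]. *)
Lemma beta_from_wp (q a s : C) (n' r : nat) :
  a <> 0 -> s <> 0 -> 1 + s <> 0 -> 1 + a / s <> 0 ->
  qpoch q q (S n') <> 0 -> qpoch (a ^ 2 / s ^ 2 * q) q (S n') <> 0 ->
  qpoch (a * q) q (2 * S n') <> 0 -> qpoch (s ^ 2 * q) q (2 * S n') <> 0 ->
  (r <= S n')%nat ->
  beta_term q a s (S n' - r) r
  = (1 - s ^ 2 * (q ^ S n') ^ 2) / ((1 + a / s) * (1 + s))
    * (wp_term q a (s ^ 2) n' r * (1 + a * (q ^ r) ^ 2)
       + wp_term q a (s ^ 2) n' r * ((s ^ 2 + a) * q ^ r) / s).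
Proof.
  intros Ha Hs Hs1 Has HQ HC HA HK Hr.
  set (m := (S n' - r)%nat).
  assert (Hmr : (m + r = S n')%nat) by (unfold m; lia).
  assert (EV := vwp_join (s ^ 2) q m r ltac:(lia)). rewrite Hmr in EV.
  change (pred (S n')) with n' in EV.
  assert (EA := vwp_split a q m r). rewrite Hmr in EA.
  assert (HAn : qpoch (a * q) q (S n' + r) <> 0).
  { apply (qpoch_neq0_le _ _ _ _ HA). lia. }
  assert (HK2 : qpoch (s ^ 2 * q) q (2 * r) <> 0).
  { apply (qpoch_neq0_le _ _ _ _ HK). lia. }
  rewrite <- EA in HAn.
  assert (A1 := Cmult_neq0_l _ _ HAn). assert (A2 := Cmult_neq0_r _ _ HAn).
  assert (A3 := Cmult_neq0_l _ _ A2). assert (A4 := Cmult_neq0_r _ _ A2).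
  assert (EC : qpoch (a ^ 2 / s ^ 2) q (2 * r) * (1 + a * q ^ r / s)
    = qpoch (a / s) q r * (1 + a / s) * qpoch (- (a * q / s)) q r
      * qpoch (a ^ 2 / s ^ 2 * q) (q ^ 2) r).
  { rewrite qpoch_even. replace (a ^ 2 / s ^ 2) with ((a / s) ^ 2) at 1 by (field; auto).
    rewrite <- (qpoch_sq (a / s)).
    assert (E : qpoch (- (a / s)) q r * (1 + a * q ^ r / s)
      = (1 + a / s) * qpoch (- (a * q / s)) q r).
    { transitivity (qpoch (- (a / s)) q (S r)).
      rewrite qpoch_S. unfold Cdiv. f_equal. ring.
      rewrite qpoch_S_l. unfold Cdiv. f_equal. ring. f_equal. ring. }
    transitivity (qpoch (a / s) q r * (qpoch (- (a / s)) q r * (1 + a * q ^ r / s))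
      * qpoch (a ^ 2 / s ^ 2 * q) (q ^ 2) r). ring. rewrite E. ring. }
  unfold beta_term, wp_term. fold m. rewrite <- EA.
  replace (vwp (s ^ 2 * q ^ (2 * r)) q m) with ((1 - s ^ 2 * (q ^ S n') ^ 2)
    * qpoch (s ^ 2 * q) q (n' + r) / qpoch (s ^ 2 * q) q (2 * r)).
  2:{ symmetry. apply Cdiv_of_mult; assumption. }
  assert (HQm : qpoch q q m <> 0).
  { apply (qpoch_neq0_le _ _ _ _ HQ). lia. }
  assert (HQr : qpoch q q r <> 0).
  { apply (qpoch_neq0_le _ _ _ _ HQ). lia. }
  assert (HCr : qpoch (a ^ 2 / s ^ 2 * q) q r <> 0).
  { apply (qpoch_neq0_le _ _ _ _ HC). lia. }
  assert (Has' : s + a <> 0).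
  { replace (s + a) with (s * (1 + a / s)) by (field; auto). now apply Cmult_neq_0. }
  assert (EC' : a * q ^ r * qpoch (a ^ 2 / s ^ 2) q (2 * r)
    = qpoch (a / s) q r * (s + a) * qpoch (- (a * q / s)) q r
      * qpoch (a ^ 2 / s ^ 2 * q) (q ^ 2) r - s * qpoch (a ^ 2 / s ^ 2) q (2 * r)).
  { transitivity (s * (qpoch (a ^ 2 / s ^ 2) q (2 * r) * (1 + a * q ^ r / s))
      - s * qpoch (a ^ 2 / s ^ 2) q (2 * r)). field; auto. rewrite EC. field; auto. }
  clear EC EV EA HAn A2.
  set (c2 := qpoch (a ^ 2 / s ^ 2) q (2 * r)) in *.
  set (c1 := qpoch (a ^ 2 / s ^ 2 * q) (q ^ 2) r) in *.
  set (c0 := qpoch (a ^ 2 / s ^ 2 * q) q r) in *.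
  set (u := qpoch (a / s) q r) in *. set (v := qpoch (- (a * q / s)) q r) in *.
  set (g := qpoch (s ^ 2 / a) q m) in *. set (h := qpoch (s ^ 2 / a) q r) in *.
  set (e := (s ^ 2 / a) ^ r) in *.
  clearbody c2 c1 c0 u v g h e.
  field [EC']. repeat split; neq0.
Qed.

Lemma beta_sum_generic (q a s : C) (n' : nat) :
  q <> 0 -> a <> 0 -> s <> 0 -> 1 - a <> 0 -> 1 + s <> 0 -> 1 + a / s <> 0 ->
  qpoch q q (S n') <> 0 -> qpoch (a ^ 2 / s ^ 2 * q) q (S n') <> 0 ->
  qpoch (a * q) q (2 * S n') <> 0 -> qpoch (s ^ 2 * q) q (2 * S n') <> 0 ->
  csum (fun r => beta_term q a s (S n' - r) r) (S (S n'))
  = qpoch ((s ^ 2 / a) ^ 2) q (S n') * (1 + s * q ^ S n') / (qpoch q q (S n') * (1 + s)).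
Proof.
  intros Hq Ha Hs Ha1 Hs1 Has HQ HC HA HK.
  assert (Hk : s ^ 2 <> 0) by (now apply Cpow_nz).
  destruct (wp_closed q a (s ^ 2) n' Hq Ha Hk Ha1 HQ HA HC HK) as [EX EY].
  rewrite (csum_ext _ (fun r => (1 - s ^ 2 * (q ^ S n') ^ 2) / ((1 + a / s) * (1 + s))
    * (wp_term q a (s ^ 2) n' r * (1 + a * (q ^ r) ^ 2)
       + / s * (wp_term q a (s ^ 2) n' r * ((s ^ 2 + a) * q ^ r))))).
  - rewrite csum_scal, csum_plus, csum_scal.
    fold (wp_X q a (s ^ 2) n'). fold (wp_Y q a (s ^ 2) n'). rewrite EX, EY.
    unfold wp_C. replace ((s ^ 2) ^ 2 / a ^ 2) with ((s ^ 2 / a) ^ 2) by (field; auto).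
    assert (Has' : s + a <> 0).
    { replace (s + a) with (s * (1 + a / s)) by (field; auto). now apply Cmult_neq_0. }
    assert (D4 : 1 - s ^ 2 * (q ^ S n') ^ 2 <> 0).
    { replace (s ^ 2 * (q ^ S n') ^ 2) with (s ^ 2 * q * q ^ S (2 * n'))
        by (rewrite (Cpow_S q n'), (Cpow_S q (2 * n')), Cpow_double; ring).
      apply (qpoch_factor_neq0 _ _ _ _ HK). lia. }
    set (g := qpoch ((s ^ 2 / a) ^ 2) q (S n')). clearbody g.
    field. repeat split; neq0.
  - intros r Hr. rewrite beta_from_wp by (auto || lia). unfold Cdiv. ring.
Qed.

Lemma tends_vwp (u : nat -> C) (l q : C) (m : nat) :
  tends u l -> tends (fun j => vwp (u j) q m) (vwp l q m).
Proof.
  intros H. destruct m as [|i]. exact (tends_const 1). unfold vwp.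
  apply tends_mult.
  - apply tends_minus. apply tends_const. apply tends_mult. exact H. apply tends_const.
  - apply tends_qpoch_arg. apply tends_mult. exact H. apply tends_const.
Qed.

Lemma tends_pow (u : nat -> C) (l : C) (n : nat) :
  tends u l -> tends (fun j => u j ^ n) (l ^ n).
Proof.
  intros H. induction n as [|n IH]. exact (tends_const 1). simpl. now apply tends_mult.
Qed.

Lemma tends_neq0 (u : nat -> C) (l : C) :
  tends u l -> l <> 0 -> exists N, forall n, (N <= n)%nat -> u n <> 0.
Proof.
  intros H Hl. destruct (tends_away u l H Hl) as [N HN]. exists N. intros n Hn.
  specialize (HN n Hn). apply Cmod_gt_0. apply Cmod_gt_0 in Hl. lra.
Qed.

Lemma tends_csum (T : nat -> nat -> C) (t : nat -> C) (n : nat) :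
  (forall r, (r < n)%nat -> tends (fun j => T j r) (t r)) ->
  tends (fun j => csum (T j) n) (csum t n).
Proof.
  intros H. induction n as [|n IH]. exact (tends_const 0). simpl.
  apply tends_plus. apply IH. auto. apply H. lia.
Qed.

Lemma tends_beta_term (q a s : C) (u : nat -> C) (m r : nat) :
  (Cmod q < 1)%R -> a <> 0 -> s <> 0 -> 1 + s <> 0 ->
  qpoch (a ^ 2 / s ^ 2 * q) q (m + r) <> 0 -> qpoch (a * q) q (2 * (m + r)) <> 0 ->
  tends u s -> tends (fun j => beta_term q a (u j) m r) (beta_term q a s m r).
Proof.
  intros Hq Ha Hs Hs1 HC HA Hu.
  assert (Hu2 := tends_pow u s 2 Hu).
  assert (HE : tends (fun j => u j ^ 2 / a) (s ^ 2 / a)).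
  { apply tends_div. exact Hu2. apply tends_const. exact Ha. }
  assert (Hc : tends (fun j => a ^ 2 / u j ^ 2 * q) (a ^ 2 / s ^ 2 * q)).
  { apply tends_mult; [|apply tends_const].
    apply tends_div. apply tends_const. exact Hu2. now apply Cpow_nz. }
  unfold beta_term. apply tends_div.
  - repeat apply tends_mult.
    + apply tends_vwp. apply tends_mult. exact Hu2. apply tends_const.
    + now apply tends_qpoch_arg.
    + now apply tends_qpoch_arg.
    + now apply tends_pow.
    + now apply tends_qpoch_arg.
    + apply tends_qpoch_arg. apply tends_div; auto. apply tends_const.
    + apply tends_qpoch_arg. apply tends_opp. apply tends_div; auto. apply tends_const.
    + apply tends_plus. apply tends_const. apply tends_mult. exact Hu. apply tends_const.
  - repeat apply tends_mult; try apply tends_const.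
    + apply tends_plus. apply tends_const. exact Hu.
    + now apply tends_qpoch_arg.
  - assert (Hb := nonvanishing_base q Hq).
    repeat apply Cmult_neq_0; try (now apply qpoch_nonvanishing). exact Hs1.
    + apply (qpoch_neq0_le _ _ _ _ HC). lia.
    + apply qpoch_neq0. intros j Hj.
      replace (a * q ^ r * q ^ j) with (a * q * q ^ (pred r + j)).
      apply (qpoch_factor_neq0 _ _ _ _ HA). lia.
      destruct r as [|r]. lia. simpl pred. rewrite Cpow_add_r, (Cpow_S q r). ring.
    + apply qpoch_neq0. intros j Hj.
      replace (a * q ^ (2 * r + 1) * q ^ j) with (a * q * q ^ (2 * r + j))
        by (rewrite !Cpow_add_r; ring).
      apply (qpoch_factor_neq0 _ _ _ _ HA). lia.
Qed.

(** The sum of this WP Bailey pair. When [a = - s] the reduction to the two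
    weighted sums divides by [1 + a / s = 0]; this case follows from the others
    by continuity in [s]. *)
Lemma beta_sum (q a s : C) (n : nat) :
  q <> 0 -> (Cmod q < 1)%R -> a <> 0 -> s <> 0 -> 1 - a <> 0 -> 1 + s <> 0 ->
  nonvanishing (a ^ 2 / s ^ 2 * q) q -> nonvanishing (s ^ 2 * q) q ->
  qpoch (a * q) q (2 * n) <> 0 ->
  csum (fun r => beta_term q a s (n - r) r) (S n)
  = qpoch ((s ^ 2 / a) ^ 2) q n * (1 + s * q ^ n) / (qpoch q q n * (1 + s)).
Proof.
  intros Hq Hq1 Ha Hs Ha1 Hs1 HC HK HA.
  destruct n as [|n'].
  { unfold beta_term. simpl. field. repeat split; neq0. }
  assert (HQ := qpoch_nonvanishing q q (S n') (nonvanishing_base q Hq1)).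
  destruct (classic (1 + a / s = 0)) as [Has|Has].
  2:{ apply beta_sum_generic; auto using qpoch_nonvanishing. }
  assert (Hu : tends (fun j => s + q ^ j) s).
  { assert (H := tends_plus _ _ _ _ (tends_const s) (tends_pow_geom q Hq1)).
    replace (s + 0) with s in H by ring. exact H. }
  assert (Hu2 := tends_pow _ _ 2 Hu). cbv beta in Hu2.
  assert (Hk0 : s ^ 2 <> 0) by (now apply Cpow_nz).
  assert (Hc : tends (fun j => a ^ 2 / (s + q ^ j) ^ 2 * q) (a ^ 2 / s ^ 2 * q)).
  { apply tends_mult; [|apply tends_const].
    apply tends_div; auto. apply tends_const. }
  assert (Hk : tends (fun j => (s + q ^ j) ^ 2 * q) (s ^ 2 * q)).
  { apply tends_mult; [exact Hu2|apply tends_const]. }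
  destruct (tends_neq0 _ _ Hu Hs) as [N1 HN1].
  destruct (tends_neq0 _ _ (tends_plus _ _ _ _ (tends_const 1) Hu) Hs1) as [N2 HN2].
  destruct (tends_neq0 _ _ (tends_qpoch_arg _ _ q (S n') Hc)
    (qpoch_nonvanishing _ _ _ HC)) as [N3 HN3].
  destruct (tends_neq0 _ _ (tends_qpoch_arg _ _ q (2 * S n') Hk)
    (qpoch_nonvanishing _ _ _ HK)) as [N4 HN4].
  apply (tends_unique (fun j => csum (fun r => beta_term q a (s + q ^ j) (S n' - r) r) (S (S n')))).
  - apply tends_csum. intros r Hr. apply tends_beta_term; auto.
    + now apply qpoch_nonvanishing.
    + replace (S n' - r + r)%nat with (S n') by lia. exact HA.
  - apply (tends_ext_ev (fun j => qpoch (((s + q ^ j) ^ 2 / a) ^ 2) q (S n')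
      * (1 + (s + q ^ j) * q ^ S n') / (qpoch q q (S n') * (1 + (s + q ^ j)))) _ _
      (N1 + N2 + N3 + N4)).
    + intros j Hj. symmetry.
      assert (Hsj := HN1 j ltac:(lia)).
      apply beta_sum_generic; auto. apply HN2; lia.
      * intros H0.
        assert (Hsa : a = - s).
        { replace a with (s * ((1 + a / s) - 1)) by (field; auto). rewrite Has. ring. }
        assert (Hqj : q ^ j = (s + q ^ j) * (1 + a / (s + q ^ j))).
        { rewrite Hsa. field. auto. }
        apply (Cpow_nz q j Hq). rewrite Hqj, H0. ring.
      * apply HN3; lia.
      * apply HN4; lia.
    + apply tends_div.
      * apply tends_mult.
        -- apply tends_qpoch_arg. apply tends_pow. apply tends_div; auto. apply tends_const.
        -- apply tends_plus. apply tends_const. apply tends_mult. exact Hu. apply tends_const.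
      * apply tends_scal. apply tends_plus. apply tends_const. exact Hu.
      * apply Cmult_neq_0; assumption.
Qed.

(** * A theta function identity *)

(** The condition makes the duplication ratio at index [m + 1] equal to
    [(q^2;q^2)_m / (q;q)_m]. Up to a factor absorbed by [(q;q)_(m+1)] this is the
    duplication ratio at index [m] for [A q] and [B q]. *)
Lemma watson_term_tail (q A B P : C) (m : nat) :
  q <> 0 -> (Cmod q < 1)%R -> P <> 0 -> A * B * q * P ^ 2 = 1 ->
  nonvanishing (B * q * P) q -> nonvanishing (A * q * P) q ->
  nonvanishing (A * B * q) (q ^ 2) ->
  watson_term q A B P (S m)
  = (1 - q / P) * (1 - A) * (1 - B) * (q * (1 - P))
    / ((1 - q) * (1 - B * q * P) * (1 - A * q * P) * (1 - A * B * q))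
    * watson_term q (A * q) (B * q) P m.
Proof.
  intros Hq0 Hq HP HC HB HA HAB.
  assert (Hl : A * B * P * q = / P).
  { replace (/ P) with ((A * B * q * P ^ 2) / P) by (rewrite HC; unfold Cdiv; ring).
    field. exact HP. }
  assert (Hl' : A * B * P = / (P * q)).
  { replace (A * B * P) with (A * B * P * q / q) by (field; auto). rewrite Hl.
    field. auto. }
  assert (HQ := nonvanishing_base q Hq).
  assert (HQ0 := HQ 0%nat). assert (HB0 := HB 0%nat).
  assert (HA0 := HA 0%nat). assert (HAB0 := HAB 0%nat).
  rewrite Cmult_1_r in HQ0, HB0, HA0, HAB0.
  unfold watson_term. rewrite HC.
  replace (A * q * (B * q) * q * P ^ 2) with (q ^ 2 * (A * B * q * P ^ 2)) by ring.
  replace (A * q * (B * q) * P) with (A * B * P * q * q) by ring.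
  rewrite HC, Hl, Hl'.
  rewrite !(qpoch_S_l _ _ m).
  replace (B * q * P * q) with (B * q * q * P) by ring.
  replace (A * q * P * q) with (A * q * q * P) by ring.
  replace (A * B * q * q ^ 2) with (A * q * (B * q) * q) by ring.
  assert (HBm : qpoch (B * q * q * P) q m <> 0).
  { apply qpoch_nonvanishing. replace (B * q * q * P) with (B * q * P * q) by ring.
    now apply nonvanishing_shift1. }
  assert (HAm : qpoch (A * q * q * P) q m <> 0).
  { apply qpoch_nonvanishing. replace (A * q * q * P) with (A * q * P * q) by ring.
    now apply nonvanishing_shift1. }
  assert (HABm : qpoch (A * q * (B * q) * q) (q ^ 2) m <> 0).
  { apply qpoch_nonvanishing.
    replace (A * q * (B * q) * q) with (A * B * q * (q ^ 2) ^ 1) by ring.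
    now apply nonvanishing_shift. }
  assert (HQm := qpoch_nonvanishing (q * q) q m (nonvanishing_shift1 _ _ HQ)).
  assert (HQm' := qpoch_nonvanishing q q m HQ).
  destruct m as [|i].
  - simpl. field. repeat split; neq0.
  - assert (HQi := qpoch_nonvanishing q q i HQ).
    assert (HQ1 := HQ i). assert (HQ2 := HQ (S i)). assert (HQ3 := HQ 1%nat).
    unfold vwp, dup.
    rewrite !eprod_poch by exact HP.
    assert (E1 : qpoch (/ P) q (S (S i)) = (1 - / P) * (1 - / P * q) * qpoch (/ P * q * q) q i).
    { rewrite !qpoch_S_l. ring. }
    rewrite E1.
    replace (1 * q) with q by ring. replace (1 * q ^ 2) with (q ^ 2) by ring.
    replace (/ (P * q) * q) with (/ P) by (field; auto).
    rewrite (qpoch_S_l (q ^ 2) (q ^ 2) i).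
    replace (q ^ 2 * 1 * q ^ 2) with (q ^ 2 * q ^ 2) by ring.
    assert (E2 : qpoch (q ^ 2 * 1 * q) q i = qpoch q q i * (1 - q * q ^ i)
      * (1 - q * q ^ S i) / ((1 - q) * (1 - q * q))).
    { apply Cdiv_of_mult. apply Cmult_neq_0; neq0.
      rewrite <- !qpoch_S, !qpoch_S_l. replace (q ^ 2 * 1 * q) with (q * q * q) by ring.
      ring. }
    assert (E3 : qpoch (q * q) q (S i) = qpoch q q i * (1 - q * q ^ i)
      * (1 - q * q ^ S i) / (1 - q)).
    { apply Cdiv_of_mult. neq0. rewrite <- !qpoch_S, !(qpoch_S_l q). ring. }
    rewrite E2, E3, !(qpoch_S q q i).
    rewrite !(Cpow_S q (S i)), !(Cpow_S q i), (Cpow_S (- (q * P)) (S i)).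
    rewrite !(qpoch_S _ _ i) in *.
    set (x := q ^ i) in *.
    rewrite (Cpow_S q i) in HQ2. fold x in HQ2.
    assert (B1 := Cmult_neq0_l _ _ HBm). assert (B2 := Cmult_neq0_r _ _ HBm).
    assert (A1 := Cmult_neq0_l _ _ HAm). assert (A2 := Cmult_neq0_r _ _ HAm).
    assert (AB1 := Cmult_neq0_l _ _ HABm). assert (AB2 := Cmult_neq0_r _ _ HABm).
    clear E1 E2 E3.
    replace (1 - / (P * q) * (q * (q * x) * (q * (q * x))))
      with (1 - / P * q * (q * x * (q * x))) by (field; auto).
    replace (1 - q / P) with (1 - / P * q) by (unfold Cdiv; ring).
    replace (1 - q ^ 2) with (1 - q * q) by ring.
    replace (q * (1 - P)) with (- (q * P) * (1 - / P)) by (field; auto).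
    assert (HQ4 : 1 - q * q <> 0) by neq0.
    (* with the factors as atoms only monomials have to be compared *)
    generalize dependent (qpoch (B * q * q * P) q i).
    generalize dependent (qpoch (A * q * q * P) q i).
    generalize dependent (qpoch (A * q * (B * q) * q) (q ^ 2) i).
    generalize dependent (qpoch q q i).
    generalize dependent (1 - B * q * q * P * x).
    generalize dependent (1 - A * q * q * P * x).
    generalize dependent (1 - A * q * (B * q) * q * (q ^ 2) ^ i).
    generalize dependent (1 - q * (q * x)). generalize dependent (1 - q * x).
    generalize dependent (1 - B * q * P). generalize dependent (1 - A * q * P).
    generalize dependent (1 - A * B * q). generalize dependent (1 - q * q).
    generalize (1 - / P * q * (q * x * (q * x))) (1 - / P * x) (1 - A * q * x)
      (1 - B * q * x) (1 - / P * q) (1 - A) (1 - B) (1 - / P) (- (q * P)).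
    generalize dependent (1 - q). intros.
    field. repeat split; assumption.
Qed.

(** A three-term relation between theta functions: with
    [theta(x) = (x, q^2/x; q^2)] and [B = 1 / (A q P^2)], the right-hand side is
    [theta(A q) theta(B q) + q P theta(A) theta(B)]. *)
Definition theta_identity (q A P : C) : Prop :=
  qpoch_inf (A * q * P) q * qpoch_inf (/ (A * P)) q * qpoch_inf (- (q * P)) q
    * qpoch_inf (- / P) q * qpoch_inf q (q ^ 2) ^ 2
  = qpoch_inf (A * q) (q ^ 2) * qpoch_inf (q / A) (q ^ 2)
      * qpoch_inf (/ (A * P ^ 2)) (q ^ 2) * qpoch_inf (A * q ^ 2 * P ^ 2) (q ^ 2)
    + q * P * (qpoch_inf A (q ^ 2) * qpoch_inf (q ^ 2 / A) (q ^ 2)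
      * qpoch_inf (/ (A * q * P ^ 2)) (q ^ 2) * qpoch_inf (A * q ^ 3 * P ^ 2) (q ^ 2)).

Lemma csum_S_l (u : nat -> C) (n : nat) :
  csum u (S n) = u 0%nat + csum (fun i => u (S i)) n.
Proof. rewrite <- (Nat.add_1_l n), csum_add. simpl. ring. Qed.

(** Watson's sum applies both to the series with [A B q P^2 = 1] and to its
    tail after the first term, which is a multiple of a series of the same
    kind. The relation [S = 1 + T S'] between the two sums is the identity. *)
Lemma theta_identity_conv (q A P : C) :
  q <> 0 -> (Cmod q < 1)%R -> A <> 0 -> P <> 0 -> (Cmod (q * P) < 1)%R ->
  nonvanishing (A * q * P) q -> nonvanishing (/ (A * P)) q ->
  nonvanishing (/ P ^ 2) (q ^ 2) ->
  theta_identity q A P.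
Proof.
  intros Hq0 Hq HA0 HP Hc HA HB HAB.
  assert (Hq2 := Cmod_sq_lt1 q Hq).
  set (B := / (A * q * P ^ 2)).
  assert (HC : A * B * q * P ^ 2 = 1) by (unfold B; field; auto).
  assert (HBq : B * q * P = / (A * P)) by (unfold B; field; auto).
  assert (HABq : A * B * q = / P ^ 2) by (unfold B; field; auto).
  assert (HB' : nonvanishing (B * q * P) q) by (rewrite HBq; exact HB).
  assert (HAB' : nonvanishing (A * B * q) (q ^ 2)) by (rewrite HABq; exact HAB).
  assert (HQ := nonvanishing_base q Hq).
  assert (Hr : watson_regular q A B P).
  { repeat split; auto. rewrite HC. replace (1 * q) with q by ring. exact HQ. }
  assert (Hr' : watson_regular q (A * q) (B * q) P).
  { repeat split.
    - replace (B * q * q * P) with (B * q * P * q) by ring. now apply nonvanishing_shift1.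
    - replace (A * q * q * P) with (A * q * P * q) by ring. now apply nonvanishing_shift1.
    - replace (A * q * (B * q) * q) with (A * B * q * q ^ 2) by ring.
      now apply nonvanishing_shift1.
    - replace (A * q * (B * q) * q * P ^ 2 * q) with (A * B * q * P ^ 2 * q * q ^ 2) by ring.
      rewrite HC. replace (1 * q) with q by ring. now apply nonvanishing_shift. }
  destruct (watson_summable q A B P Hq HP Hr (or_introl Hc)) as [S HS].
  destruct (watson_summable q (A * q) (B * q) P Hq HP Hr' (or_introl Hc)) as [S' HS'].
  assert (W1 := watson_sum q A B P S Hq0 Hq HP Hr (or_introl Hc) HS).
  assert (W2 := watson_sum q (A * q) (B * q) P S' Hq0 Hq HP Hr' (or_introl Hc) HS').
  set (T1 := (1 - q / P) * (1 - A) * (1 - B) * (q * (1 - P))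
    / ((1 - q) * (1 - B * q * P) * (1 - A * q * P) * (1 - A * B * q))) in *.
  assert (ES : S = 1 + T1 * S').
  { apply (tends_unique (fun n => csum (watson_term q A B P) (n + 1))).
    - now apply (tends_shift (csum (watson_term q A B P))).
    - apply (tends_ext (fun n => 1 + T1 * csum (watson_term q (A * q) (B * q) P) n)).
      + intros n. rewrite Nat.add_1_r, csum_S_l. f_equal.
        * unfold watson_term. simpl. field.
        * rewrite <- csum_scal. apply csum_ext. intros i _.
          symmetry. now apply watson_term_tail.
      + apply tends_plus. apply tends_const. now apply tends_scal. }
  assert (HQ0 := HQ 0%nat). assert (HB0 := HB' 0%nat).
  assert (HA1 := HA 0%nat). assert (HAB0 := HAB' 0%nat).
  rewrite Cmult_1_r in HQ0, HB0, HA1, HAB0.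
  assert (HPinv : 1 - / P <> 0).
  { intros H. apply HAB0. rewrite HABq.
    replace (1 - / P ^ 2) with ((1 - / P) * (1 + / P)) by (field; auto). rewrite H. ring. }
  assert (HqP : qpoch_inf (/ P * q) q <> 0).
  { intros H0. assert (HI := qpoch_inf_neq0 _ _ Hq2 HAB). apply HI.
    replace (/ P ^ 2) with ((/ P) ^ 2) by (field; auto).
    rewrite <- qpoch_inf_sq, (qpoch_inf_S (/ P)), H0 by exact Hq. ring. }
  assert (ED : watson_den q A B P = (1 - A * q * P) * (1 - B * q * P) * (1 - A * B * q)
    * (1 - q) * watson_den q (A * q) (B * q) P).
  { unfold watson_den.
    rewrite (qpoch_inf_S (A * q * P)), (qpoch_inf_S (B * q * P)) by exact Hq.
    rewrite (qpoch_inf_S (A * B * q)) by exact Hq2.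
    rewrite (qpoch_inf_S (A * B * q ^ 2 * P ^ 2)) by exact Hq2.
    replace (A * q * P * q) with (A * q * q * P) by ring.
    replace (B * q * P * q) with (B * q * q * P) by ring.
    replace (A * B * q * q ^ 2) with (A * q * (B * q) * q) by ring.
    replace (A * B * q ^ 2 * P ^ 2 * q ^ 2) with (A * q * (B * q) * q ^ 2 * P ^ 2) by ring.
    replace (A * B * q ^ 2 * P ^ 2) with q
      by (replace (A * B * q ^ 2 * P ^ 2) with (q * (A * B * q * P ^ 2)) by ring;
          rewrite HC; ring).
    ring. }
  assert (EN : watson_den q A B P = watson_num q A B P
    - (1 - q / P) * (1 - A) * (1 - B) * (q * (1 - P)) * watson_num q (A * q) (B * q) P).
  { rewrite <- W1, <- W2, ES, ED. unfold T1. field. repeat split; neq0. }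
  unfold watson_den, watson_num in EN.
  replace (A * B * q ^ 2 * P ^ 2) with q in EN
    by (replace (A * B * q ^ 2 * P ^ 2) with (q * (A * B * q * P ^ 2)) by ring;
        rewrite HC; ring).
  rewrite HBq, HABq in EN.
  replace (A * B * P * q) with (/ P) in EN by (unfold B; field; auto).
  replace (A * q * (B * q) * P * q) with (/ P * q * q) in EN by (unfold B; field; auto).
  replace (B * q) with (/ (A * P ^ 2)) in EN by (unfold B; field; auto).
  replace (B * q ^ 2 * P ^ 2) with (q / A) in EN by (unfold B; field; auto).
  replace (/ (A * P ^ 2) * q) with (B * q ^ 2) in EN by (unfold B; field; auto).
  replace (A * q * q ^ 2 * P ^ 2) with (A * q ^ 3 * P ^ 2) in EN by ring.
  replace (/ (A * P ^ 2) * q ^ 2 * P ^ 2) with (q ^ 2 / A) in EN by (field; auto).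
  replace (A * q * q) with (A * q ^ 2) in EN by ring.
  replace (/ P ^ 2) with ((/ P) ^ 2) in EN by (field; auto).
  rewrite <- qpoch_inf_sq in EN by exact Hq.
  rewrite (qpoch_inf_S (/ P)) in EN by exact Hq.
  unfold theta_identity. fold B.
  rewrite (qpoch_inf_S A), (qpoch_inf_S B) by exact Hq2.
  apply (Cmult_eq_l _ _ _ (Cmult_neq_0 _ _ HPinv HqP)).
  match type of EN with ?l = _ =>
    match goal with |- ?g = _ => transitivity l; [ring|] end end.
  rewrite EN, (qpoch_inf_S (/ P * q)) by exact Hq.
  field. auto.
Qed.

(** Both sides are multiplied by [- 1 / (A q^2 P^2)] under [P -> q P]. *)
Lemma theta_identity_shift (q A P : C) :
  q <> 0 -> (Cmod q < 1)%R -> A <> 0 -> P <> 0 ->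
  theta_identity q A P <-> theta_identity q A (q * P).
Proof.
  intros Hq0 Hq HA HP. assert (Hq2 := Cmod_sq_lt1 q Hq).
  unfold theta_identity.
  rewrite (qpoch_inf_S (A * q * P)), (qpoch_inf_S (/ (A * (q * P)))) by exact Hq.
  rewrite (qpoch_inf_S (- (q * P))), (qpoch_inf_S (- / (q * P))) by exact Hq.
  rewrite (qpoch_inf_S (A * q ^ 2 * P ^ 2)), (qpoch_inf_S (/ (A * (q * P) ^ 2))) by exact Hq2.
  rewrite (qpoch_inf_S (A * q ^ 3 * P ^ 2)), (qpoch_inf_S (/ (A * q * (q * P) ^ 2))) by exact Hq2.
  replace (A * q * (q * P)) with (A * q * P * q) by ring.
  replace (/ (A * (q * P)) * q) with (/ (A * P)) by (field; auto).
  replace (- (q * (q * P))) with (- (q * P) * q) by ring.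
  replace (- / (q * P) * q) with (- / P) by (field; auto).
  replace (A * q ^ 2 * (q * P) ^ 2) with (A * q ^ 2 * P ^ 2 * q ^ 2) by ring.
  replace (/ (A * (q * P) ^ 2) * q ^ 2) with (/ (A * P ^ 2)) by (field; auto).
  replace (A * q ^ 3 * (q * P) ^ 2) with (A * q ^ 3 * P ^ 2 * q ^ 2) by ring.
  replace (/ (A * q * (q * P) ^ 2) * q ^ 2) with (/ (A * q * P ^ 2)) by (field; auto).
  set (mu := - / (A * q ^ 2 * P ^ 2)).
  assert (Hmu : mu <> 0).
  { intros H. apply C1_nz. transitivity (- (A * q ^ 2 * P ^ 2) * mu).
    unfold mu. field. auto. rewrite H. ring. }
  match goal with |- ?l = ?r <-> ?l' = ?r' =>
    assert (El : l' = mu * l) by (unfold mu; field; auto);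
    assert (Er : r' = mu * r) by (unfold mu; field; auto);
    rewrite El, Er end.
  split. intros ->. reflexivity. apply (Cmult_eq_l _ _ _ Hmu).
Qed.

Lemma theta_identity_shift_n (q A P : C) (n : nat) :
  q <> 0 -> (Cmod q < 1)%R -> A <> 0 -> P <> 0 ->
  theta_identity q A P <-> theta_identity q A (q ^ n * P).
Proof.
  intros Hq0 Hq HA HP. induction n as [|n IH].
  - replace (q ^ 0 * P) with P by ring. reflexivity.
  - rewrite IH, theta_identity_shift by auto using Cmult_neq_0, Cpow_nz.
    replace (q * (q ^ n * P)) with (q ^ S n * P) by (rewrite Cpow_S; ring). reflexivity.
Qed.

(** On the left a factor vanishes. On the right the two products of theta
    functions are exchanged, up to a factor, by [theta(1/x) = - theta(x) / x]. *)
Lemma theta_identity_m1 (q A : C) :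
  q <> 0 -> (Cmod q < 1)%R -> A <> 0 -> theta_identity q A (- (1)).
Proof.
  intros Hq0 Hq HA. assert (Hq2 := Cmod_sq_lt1 q Hq). unfold theta_identity.
  rewrite (qpoch_inf_S (- / - (1))) by exact Hq.
  replace (/ (A * (- (1)) ^ 2)) with (/ A) by (field; auto).
  replace (A * q ^ 2 * (- (1)) ^ 2) with (A * q ^ 2) by ring.
  replace (/ (A * q * (- (1)) ^ 2)) with (/ (A * q)) by (field; auto).
  replace (A * q ^ 3 * (- (1)) ^ 2) with (A * q * q ^ 2) by ring.
  rewrite (qpoch_inf_S (/ A)), (qpoch_inf_S (/ (A * q))), (qpoch_inf_S A),
    (qpoch_inf_S (A * q)) by exact Hq2.
  replace (/ A * q ^ 2) with (q ^ 2 / A) by (unfold Cdiv; ring).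
  replace (/ (A * q) * q ^ 2) with (q / A) by (field; auto).
  replace (1 - - / - (1)) with (RtoC 0) by field.
  field. auto.
Qed.

Lemma pow_eventually_small (q P : C) :
  (Cmod q < 1)%R -> exists j, (Cmod (q * (q ^ j * P)) < 1)%R.
Proof.
  intros Hq.
  assert (H : tends (fun j => q * (q ^ j * P)) 0).
  { replace (RtoC 0) with (q * (0 * P)) by ring. apply tends_scal.
    apply tends_mult. now apply tends_pow_geom. apply tends_const. }
  destruct (tends_eps _ _ 1 H Rlt_0_1) as [N HN].
  exists N. specialize (HN N (Nat.le_refl _)).
  replace (q * (q ^ N * P) - 0) with (q * (q ^ N * P)) in HN by ring. exact HN.
Qed.

(** Quasi-periodicity moves [P] into the region where Watson's series
    converges. The only additional exception there, [- P] a power of [q], is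
    moved to [P = -1]. *)
Lemma theta_identity_holds (q A P : C) :
  q <> 0 -> (Cmod q < 1)%R -> A <> 0 -> P <> 0 ->
  (forall j n, 1 - A * q * P * q ^ j <> 0 /\ q ^ n - A * P * q ^ j <> 0) ->
  (forall j n, q ^ n - P * q ^ j <> 0) ->
  theta_identity q A P.
Proof.
  intros Hq0 Hq HA HP H1 H2.
  destruct (classic (exists j n, q ^ n + P * q ^ j = 0)) as [[j [n H]]|Hm].
  - apply (theta_identity_shift_n q A P j Hq0 Hq HA HP).
    replace (q ^ j * P) with (q ^ n * - (1)).
    + apply theta_identity_shift_n; auto. 2: now apply theta_identity_m1.
      intros H0. apply C1_nz. transitivity (- - (1)). ring. rewrite H0. ring.
    + transitivity (- q ^ n). ring.
      transitivity (P * q ^ j - (q ^ n + P * q ^ j)). ring. rewrite H. ring.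
  - destruct (pow_eventually_small q P Hq) as [j Hj].
    apply (theta_identity_shift_n q A P j Hq0 Hq HA HP).
    assert (Hj0 := Cpow_nz q j Hq0).
    apply theta_identity_conv; auto using Cmult_neq_0.
    + intros i. replace (A * q * (q ^ j * P) * q ^ i) with (A * q * P * q ^ (j + i))
        by (rewrite Cpow_add_r; ring). apply (H1 _ 0%nat).
    + intros i H0. apply (proj2 (H1 j i)).
      transitivity (- (A * (q ^ j * P)) * (1 - / (A * (q ^ j * P)) * q ^ i)).
      field; auto. rewrite H0. ring.
    + intros i H0. rewrite Cpow_sq in H0.
      assert (H3 : (q ^ i - P * q ^ j) * (q ^ i + P * q ^ j) = 0).
      { transitivity (- (q ^ j * P) ^ 2 * (1 - / (q ^ j * P) ^ 2 * (q ^ i * q ^ i))).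
        field; auto. rewrite H0. ring. }
      destruct (Cmult_integral _ _ H3) as [H4|H4].
      * exact (H2 j i H4).
      * apply Hm. now exists j, i.
Qed.

(** * Watson's series truncated by a degenerate parameter *)

Lemma Cpow_eq_1 (q : C) (n : nat) : (Cmod q < 1)%R -> q ^ S n <> 1.
Proof.
  intros Hq H. apply (nonvanishing_base q Hq n). rewrite <- Cpow_S, H. ring.
Qed.

Lemma qpoch_below_zero (q c : C) (N n : nat) :
  q <> 0 -> (Cmod q < 1)%R -> c * q ^ N = 1 -> (n <= N)%nat -> qpoch c q n <> 0.
Proof.
  intros Hq0 Hq H Hn. apply qpoch_neq0. intros j Hj H0.
  apply (Cpow_eq_1 q (N - S j) Hq).
  replace (S (N - S j)) with (N - j)%nat by lia.
  transitivity (c * q ^ j * q ^ (N - j)).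
  - replace (c * q ^ j) with (1 - (1 - c * q ^ j)) by ring. rewrite H0. ring.
  - rewrite <- Cmult_assoc, <- Cpow_add_r. replace (j + (N - j))%nat with N by lia.
    exact H.
Qed.

(** When the recursion is applied to a sum truncated at [n], the boundary term
    does not vanish but accounts exactly for the last summand, so that the
    truncation at [n] for [P] corresponds to the truncation at [n - 1] for
    [q P]. *)
Lemma watson_last_term (q A B P : C) (i : nat) :
  q <> 0 -> (Cmod q < 1)%R -> P <> 0 ->
  A * B * q * P ^ 2 * q ^ (2 * S i) = 1 ->
  nonvanishing (B * q * P) q -> nonvanishing (A * q * P) q ->
  nonvanishing (A * B * q) (q ^ 2) ->
  (1 + q * P) * watson_term q A B P (S i) = - (q * P) * watson_cert q A B P (S i).
Proof.
  intros Hq0 Hq HP HC HB HA HAB.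
  assert (HQ := nonvanishing_base q Hq).
  assert (HQi := qpoch_nonvanishing q q i HQ). assert (HQ1 := HQ i).
  assert (HBi := HB i). assert (HAi := HA i). assert (HABi := HAB i).
  assert (HBp := qpoch_nonvanishing _ _ i HB).
  assert (HAp := qpoch_nonvanishing _ _ i HA).
  assert (HABp := qpoch_nonvanishing _ _ i HAB).
  assert (HCS : qpoch (A * B * q * P ^ 2 * q) q (S i) <> 0).
  { apply (qpoch_below_zero q _ (2 * i + 1)); auto; [|lia].
    rewrite <- HC. replace (2 * S i)%nat with (S (2 * i + 1)) by lia.
    rewrite (Cpow_S q (2 * i + 1)). ring. }
  rewrite qpoch_S in HCS.
  assert (C1 := Cmult_neq0_l _ _ HCS). assert (C2 := Cmult_neq0_r _ _ HCS). clear HCS.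
  unfold watson_term, watson_cert, vwp, dup.
  rewrite !(qpoch_S _ _ i). change (eprod q P (S i)) with (eprod q P i * (q * q ^ i - q * P)).
  rewrite !(Cpow_S q i).
  replace (2 * S i)%nat with (2 + 2 * i)%nat in HC by lia.
  rewrite Cpow_add_r, Cpow_double in HC. rewrite Cpow_sq in *.
  assert (Hx : q ^ i <> 0) by now apply Cpow_nz.
  assert (HA0 : A <> 0).
  { intros H. apply C1_nz. rewrite <- HC, H. ring. }
  assert (HBe : B = / (A * q ^ 3 * P ^ 2 * (q ^ i * q ^ i))).
  { replace (/ (A * q ^ 3 * P ^ 2 * (q ^ i * q ^ i)))
      with (A * B * q * P ^ 2 * (q ^ 2 * (q ^ i * q ^ i))
        / (A * q ^ 3 * P ^ 2 * (q ^ i * q ^ i))).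
    field. auto. rewrite HC. unfold Cdiv. ring. }
  set (x := q ^ i) in *.
  set (u := qpoch (B * q * P) q i) in *. set (v := qpoch (A * q * P) q i) in *.
  set (z := qpoch (A * B * q) (q ^ 2) i) in *.
  set (c := qpoch (A * B * q * P ^ 2 * q) q i) in *.
  set (h := qpoch (A * B * q * P ^ 2 * q ^ 2) (q ^ 2) i) in *.
  set (V := qpoch (A * B * P * q) q i) in *.
  set (b := qpoch B q i) in *.
  clearbody x u v z c h V b. clear HB HA HAB HC. subst B.
  assert (N1 : A * q ^ 2 * P * x - 1 <> 0).
  { replace (A * q ^ 2 * P * x - 1) with (A * q ^ 2 * P * x
      * (1 - / (A * q ^ 3 * P ^ 2 * (x * x)) * q * P * x)) by (field; auto).
    repeat apply Cmult_neq_0; auto using C1_nz. }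
  assert (N2 : (q * P) ^ 2 - 1 <> 0).
  { replace ((q * P) ^ 2 - 1) with ((q * P) * (q * P)
      * (1 - A * / (A * q ^ 3 * P ^ 2 * (x * x)) * q * (x * x))) by (field; auto).
    repeat apply Cmult_neq_0; auto. }
  assert (N3 : q * x - 1 <> 0).
  { replace (q * x - 1) with (- (1) * (1 - q * x)) by ring.
    apply Cmult_neq_0; auto. intros H. apply C1_nz.
    transitivity (- - (1)). ring. rewrite H. ring. }
  field. repeat split; neq0.
Qed.

(** The recursion ends at [n = 0], where the sum has the single term [1]. *)
Lemma watson_truncated_iterate (q A B P : C) (n : nat) :
  q <> 0 -> (Cmod q < 1)%R -> P <> 0 ->
  A * B * q * P ^ 2 * q ^ (2 * n) = 1 ->
  nonvanishing (B * q * P) q -> nonvanishing (A * q * P) q ->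
  nonvanishing (A * B * q) (q ^ 2) ->
  qpoch (- (q * P)) q n * qpoch (A * q * P) q n * qpoch (B * q * P) q n
    * qpoch (A * B * q ^ 2 * P ^ 2) (q ^ 2) n * csum (watson_term q A B P) (S n)
  = qpoch (A * B * P * q) q n * qpoch (A * q ^ 2 * P ^ 2) (q ^ 2) n
    * qpoch (B * q ^ 2 * P ^ 2) (q ^ 2) n.
Proof.
  intros Hq0 Hq. revert P. induction n as [|n IH]; intros P HP HC HB HA HAB.
  - unfold watson_term. simpl. field.
  - assert (HCS : qpoch (A * B * q * P ^ 2 * q) q (S n) <> 0).
    { apply (qpoch_below_zero q _ (2 * n + 1)); auto; [|lia].
      rewrite <- HC. replace (2 * S n)%nat with (S (2 * n + 1)) by lia.
      rewrite (Cpow_S q (2 * n + 1)). ring. }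
    assert (HP1 := watson_partial q A B P (S n) Hq HB HA HAB HCS).
    assert (HL := watson_last_term q A B P n Hq0 Hq HP HC HB HA HAB).
    assert (HI := IH (q * P)).
    specialize (HI ltac:(now apply Cmult_neq_0)).
    specialize (HI ltac:(rewrite <- HC; replace (2 * S n)%nat with (S (S (2 * n))) by lia;
      rewrite (Cpow_S q (S (2 * n))), (Cpow_S q (2 * n)); ring)).
    specialize (HI ltac:(replace (B * q * (q * P)) with (B * q * P * q) by ring;
      now apply nonvanishing_shift1)).
    specialize (HI ltac:(replace (A * q * (q * P)) with (A * q * P * q) by ring;
      now apply nonvanishing_shift1)).
    specialize (HI HAB).
    rewrite csum_S, !(qpoch_S_l _ _ n).
    replace (- (q * P) * q) with (- (q * (q * P))) by ring.
    replace (A * q * P * q) with (A * q * (q * P)) by ring.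
    replace (B * q * P * q) with (B * q * (q * P)) by ring.
    replace (A * B * q ^ 2 * P ^ 2 * q ^ 2) with (A * B * q ^ 2 * (q * P) ^ 2) by ring.
    replace (A * B * P * q * q) with (A * B * (q * P) * q) by ring.
    replace (A * q ^ 2 * P ^ 2 * q ^ 2) with (A * q ^ 2 * (q * P) ^ 2) by ring.
    replace (B * q ^ 2 * P ^ 2 * q ^ 2) with (B * q ^ 2 * (q * P) ^ 2) by ring.
    set (X := (1 + q * P) * (1 - A * q * P) * (1 - B * q * P)
      * (1 - A * B * q ^ 2 * P ^ 2)) in *.
    assert (HX : X * (csum (watson_term q A B P) (S n) + watson_term q A B P (S n))
      = (1 - A * B * P * q) * (1 - A * q ^ 2 * P ^ 2) * (1 - B * q ^ 2 * P ^ 2)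
        * csum (watson_term q A B (q * P)) (S n)).
    { transitivity ((X * csum (watson_term q A B P) (S n)
       - (1 - A * B * P * q) * (1 - A * q ^ 2 * P ^ 2) * (1 - B * q ^ 2 * P ^ 2)
        * csum (watson_term q A B (q * P)) (S n))
       + (1 - A * B * P * q) * (1 - A * q ^ 2 * P ^ 2) * (1 - B * q ^ 2 * P ^ 2)
        * csum (watson_term q A B (q * P)) (S n)
       + (1 - A * q * P) * (1 - B * q * P) * (1 - A * B * q ^ 2 * P ^ 2)
         * ((1 + q * P) * watson_term q A B P (S n))).
      unfold X; ring. rewrite HP1, HL. ring. }
    match goal with |- ?f1 * ?l1 * (?f2 * ?l2) * (?f3 * ?l3) * (?f4 * ?l4) * ?s = _ =>
      transitivity (l1 * l2 * l3 * l4 * (X * s)); [unfold X; ring|] end.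
    rewrite HX.
    match type of HI with ?l * ?s = ?r =>
      match goal with |- l * (?y * s) = _ =>
        transitivity ((l * s) * y); [ring | rewrite HI; ring] end end.
Qed.

(** Compared with the complete series there is a second product; it comes from
    the theta function identity at [q^n P]. *)
Lemma watson_truncated_sum (q A B P : C) (n : nat) :
  q <> 0 -> (Cmod q < 1)%R -> P <> 0 ->
  A * B * q * P ^ 2 * q ^ (2 * n) = 1 ->
  nonvanishing (B * q * P) q -> nonvanishing (A * q * P) q ->
  nonvanishing (A * B * q) (q ^ 2) -> nonvanishing (q * P) q ->
  watson_den q A B P * csum (watson_term q A B P) (S n)
  = watson_num q A B P
    + q * (q ^ n * P) * qpoch_inf (A * B * P * q) q
      * qpoch (A * q ^ 2 * P ^ 2) (q ^ 2) n * qpoch (B * q ^ 2 * P ^ 2) (q ^ 2) n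
      * (qpoch_inf A (q ^ 2) * qpoch_inf B (q ^ 2)
         * qpoch_inf (A * q ^ (2 * n + 3) * P ^ 2) (q ^ 2)
         * qpoch_inf (B * q ^ (2 * n + 3) * P ^ 2) (q ^ 2)).
Proof.
  intros Hq0 Hq HP HC HB HA HAB HqP.
  assert (Hq2 := Cmod_sq_lt1 q Hq).
  assert (HI := watson_truncated_iterate q A B P n Hq0 Hq HP HC HB HA HAB).
  set (P' := q ^ n * P) in *.
  assert (HP' : P' <> 0) by (apply Cmult_neq_0; auto using Cpow_nz).
  assert (HC' : A * B * q * P' ^ 2 = 1).
  { rewrite <- HC. unfold P'. rewrite Cpow_double. ring. }
  assert (HA0 : A <> 0).
  { intros H. apply C1_nz. rewrite <- HC', H. ring. }
  assert (HBe : B = / (A * q * P' ^ 2)).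
  { replace (/ (A * q * P' ^ 2)) with (A * B * q * P' ^ 2 / (A * q * P' ^ 2)).
    field. auto. rewrite HC'. unfold Cdiv. ring. }
  assert (HT : theta_identity q A P').
  { apply theta_identity_holds; auto.
    - intros j i. split.
      + replace (A * q * P' * q ^ j) with (A * q * P * q ^ (n + j))
          by (unfold P'; rewrite Cpow_add_r; ring). apply HA.
      + intros H0. destruct (Nat.le_gt_cases j i) as [Hji|Hji].
        * apply (HB (n + (i - j))%nat).
          assert (E : q ^ i = q ^ j * q ^ (i - j))
            by (rewrite <- Cpow_add_r; f_equal; lia).
          assert (E' : q ^ (i - j) = A * P').
          { apply (Cmult_eq_l (q ^ j)). now apply Cpow_nz. rewrite <- E.
            transitivity (q ^ i - (q ^ i - A * P' * q ^ j)); [rewrite H0|]; ring. }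
          rewrite Cpow_add_r. replace (B * q * P * (q ^ n * q ^ (i - j)))
            with (B * q * P' * q ^ (i - j)) by (unfold P'; ring).
          rewrite E'. transitivity (1 - A * B * q * P' ^ 2). ring. rewrite HC'. ring.
        * apply (HA (n + (j - S i))%nat).
          assert (E : q ^ j = q ^ i * q * q ^ (j - S i)).
          { rewrite <- (Cpow_1_r q) at 3. rewrite <- !Cpow_add_r. f_equal. lia. }
          apply (Cmult_eq_l (q ^ i)). now apply Cpow_nz.
          transitivity (q ^ i - A * P' * q ^ j); [|rewrite H0; ring].
          rewrite E, Cpow_add_r. unfold P'. ring.
    - intros j i H0. destruct (Nat.le_gt_cases j i) as [Hji|Hji].
      + apply (HAB (i - j)%nat). rewrite Cpow_sq.
        assert (E : q ^ i = q ^ j * q ^ (i - j))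
            by (rewrite <- Cpow_add_r; f_equal; lia).
        assert (E' : q ^ (i - j) = P').
        { apply (Cmult_eq_l (q ^ j)). now apply Cpow_nz. rewrite <- E.
          transitivity (q ^ i - (q ^ i - P' * q ^ j)); [rewrite H0|]; ring. }
        rewrite E'. transitivity (1 - A * B * q * P' ^ 2). ring. rewrite HC'. ring.
      + apply (HqP (n + (j - S i))%nat).
        assert (E : q ^ j = q ^ i * q * q ^ (j - S i)).
        { rewrite <- (Cpow_1_r q) at 3. rewrite <- !Cpow_add_r. f_equal. lia. }
        apply (Cmult_eq_l (q ^ i)). now apply Cpow_nz.
        transitivity (q ^ i - P' * q ^ j); [|rewrite H0; ring].
        rewrite E, Cpow_add_r. unfold P'. ring. }
  unfold theta_identity in HT. unfold watson_den, watson_num.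
  rewrite (qpoch_inf_split (A * q * P) q n), (qpoch_inf_split (B * q * P) q n),
    (qpoch_inf_split (- (q * P)) q n), (qpoch_inf_split (A * B * P * q) q n) by exact Hq.
  rewrite (qpoch_inf_split (A * B * q ^ 2 * P ^ 2) (q ^ 2) n),
    (qpoch_inf_split (A * q ^ 2 * P ^ 2) (q ^ 2) n),
    (qpoch_inf_split (B * q ^ 2 * P ^ 2) (q ^ 2) n) by exact Hq2.
  rewrite !Cpow_sq.
  replace (A * q * P * q ^ n) with (A * q * P') by (unfold P'; ring).
  replace (B * q * P * q ^ n) with (/ (A * P'))
    by (replace (B * q * P * q ^ n) with (B * q * P') by (unfold P'; ring);
        rewrite HBe; field; auto).
  replace (- (q * P) * q ^ n) with (- (q * P')) by (unfold P'; ring).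
  replace (A * B * P * q * q ^ n) with (/ P')
    by (replace (A * B * P * q * q ^ n) with (A * B * P' * q) by (unfold P'; ring);
        rewrite HBe; field; auto).
  replace (A * B * q ^ 2 * P ^ 2 * (q ^ n * q ^ n)) with q
    by (replace (A * B * q ^ 2 * P ^ 2 * (q ^ n * q ^ n))
          with (q * (A * B * q * P' ^ 2)) by (unfold P'; ring);
        rewrite HC'; ring).
  replace (A * q ^ 2 * P ^ 2 * (q ^ n * q ^ n)) with (A * q ^ 2 * P' ^ 2)
    by (unfold P'; ring).
  replace (B * q ^ 2 * P ^ 2 * (q ^ n * q ^ n)) with (q / A)
    by (replace (B * q ^ 2 * P ^ 2 * (q ^ n * q ^ n)) with (B * q ^ 2 * P' ^ 2)
          by (unfold P'; ring); rewrite HBe; field; auto).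
  replace (A * q ^ (2 * n + 3) * P ^ 2) with (A * q ^ 3 * P' ^ 2)
    by (unfold P'; rewrite Cpow_add_r, Cpow_double; ring).
  replace (B * q ^ (2 * n + 3) * P ^ 2) with (q ^ 2 / A)
    by (replace (B * q ^ (2 * n + 3) * P ^ 2) with (B * q ^ 3 * P' ^ 2)
          by (unfold P'; rewrite Cpow_add_r, Cpow_double; ring);
        rewrite HBe; field; auto).
  replace (A * B * q) with ((/ P') ^ 2) by (rewrite HBe; field; auto).
  rewrite <- qpoch_inf_sq by exact Hq.
  replace (qpoch_inf (B * q) (q ^ 2)) with (qpoch_inf (/ (A * P' ^ 2)) (q ^ 2))
    by (f_equal; rewrite HBe; field; auto).
  rewrite <- HBe in HT.
  match type of HI with ?l * ?s = ?r =>
    match type of HT with ?t = ?t' =>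
      transitivity ((l * s) * t * qpoch_inf (/ P') q); [ring | rewrite HI, HT; ring] end end.
Qed.

(** * The double sum *)

(** The parameters of the theorem are encoded by [A = k^2/(ab)], [B = b],
    [P = a/k] and [s = sqrt k], hence [a = A B P^2] and [k = A B P]. In these
    parameters the inner series of the double sum are Watson's series. The
    fields are the conditions on denominators that the hypotheses of the
    theorem provide. *)
Record generic (q A B P s : C) : Prop := Generic {
  g_q : q <> 0;
  g_q1 : (Cmod q < 1)%R;
  g_A : A <> 0;
  g_B : B <> 0;
  g_P : P <> 0;
  g_s : s ^ 2 = A * B * P;
  g_a : nonvanishing (A * B * P ^ 2) (q ^ 2);
  g_BP : nonvanishing (B * q * P) q;
  g_AP : nonvanishing (A * q * P) q;
  g_AB : nonvanishing (A * B * q) (q ^ 2);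
  g_aP : nonvanishing (A * B * P ^ 3 * q) q;
  g_k : nonvanishing (A * B * P * q) q;
  g_ms : nonvanishing (- s) q;
  g_qP : nonvanishing (q * P) q
}.

(** The part of the general term of the 6phi5 which depends on [n = m + r] only
    in the double sum. *)
Definition delta (q A B P : C) (n : nat) : C :=
  qpoch A q n * qpoch B q n * qpoch (A * B * P ^ 2 * q) (q ^ 2) n * (- (q * P)) ^ n
  / (qpoch (B * q * P) q n * qpoch (A * q * P) q n * qpoch (A * B * q) (q ^ 2) n).

Definition left_term (q A B P s : C) (n : nat) : C :=
  qpoch ((/ P) ^ 2) q n * (1 + s * q ^ n) / (qpoch q q n * (1 + s)) * delta q A B P n.

(** Expanding the remaining factors of the 6phi5 by [beta_sum] turns it into
    the sum of these entries over [m + r = n]. *)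
Definition entry (q A B P s : C) (m r : nat) : C :=
  beta_term q (A * B * P ^ 2) s m r * delta q A B P (m + r).

Definition row_factor (q A B P s : C) (r : nat) : C :=
  (- q) ^ r * qpoch (/ P) q r * qpoch (A * B * P ^ 3 * q) (q ^ 2) r
  * qpoch (A * B * P ^ 2 / s) q r * qpoch (- (A * B * P ^ 2 * q / s)) q r
  * (1 + s * q ^ r) * qpoch A q r * qpoch B q r * qpoch (A * B * P ^ 2 * q) (q ^ 2) r
  / ((1 + s) * qpoch q q r * qpoch (A * B * P ^ 3 * q) q r
     * qpoch (A * B * P ^ 2 * q ^ r) q r
     * qpoch (B * q * P) q r * qpoch (A * q * P) q r * qpoch (A * B * q) (q ^ 2) r).

Definition right_coef (q A B P s : C) (r : nat) : C :=
  (- q) ^ r * vwp (A * B * P ^ 2) q r * qpoch (/ P) q r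
  * qpoch (A * B * P ^ 3 * q) (q ^ 2) r
  * qpoch (A * B * P ^ 2 / s) q r * qpoch (- (A * B * P ^ 2 * q / s)) q r
  * (1 + s * q ^ r) * qpoch A q r * qpoch B q r
  / ((1 + s) * qpoch q q r * qpoch (A * B * P ^ 3 * q) q r
     * qpoch (A * B * P * q) q (2 * r)).

(** The general term of one series in base [q] whose even and odd terms make
    up the two series 16W15, including their infinite products. *)
Definition right_term (q A B P s : C) (r : nat) : C :=
  right_coef q A B P s r
  * (qpoch_inf (A * q ^ S r) (q ^ 2) * qpoch_inf (B * q ^ S r) (q ^ 2)
     * qpoch_inf (A * q ^ S (S r) * P ^ 2) (q ^ 2)
     * qpoch_inf (B * q ^ S (S r) * P ^ 2) (q ^ 2)).

Section DoubleSum.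

Variables q A B P s : C.
Hypothesis G : generic q A B P s.

Let a := A * B * P ^ 2.
Let Hq0 := g_q _ _ _ _ _ G.
Let Hq := g_q1 _ _ _ _ _ G.
Let HA := g_A _ _ _ _ _ G.
Let HB := g_B _ _ _ _ _ G.
Let HP := g_P _ _ _ _ _ G.

Lemma generic_s : s <> 0.
Proof.
  intros H. apply (Cmult_neq_0 _ _ (Cmult_neq_0 _ _ HA HB) HP).
  rewrite <- (g_s _ _ _ _ _ G), H. ring.
Qed.

Lemma generic_E : s ^ 2 / a = / P.
Proof. rewrite (g_s _ _ _ _ _ G). unfold a. field. auto. Qed.

Lemma generic_c : a ^ 2 / s ^ 2 * q = A * B * P ^ 3 * q.
Proof. rewrite (g_s _ _ _ _ _ G). unfold a. field. auto. Qed.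

Lemma generic_1s : 1 + s <> 0.
Proof.
  intros H. apply (g_ms _ _ _ _ _ G 0%nat). rewrite <- H. ring.
Qed.

Lemma generic_1sq (r : nat) : 1 + s * q ^ r <> 0.
Proof.
  intros H. apply (g_ms _ _ _ _ _ G r). rewrite <- H. ring.
Qed.

Lemma generic_1a : 1 - a <> 0.
Proof.
  intros H. apply (g_a _ _ _ _ _ G 0%nat). fold a. rewrite <- H. ring.
Qed.

Lemma diagonal_sum (n : nat) :
  qpoch (a * q) q (2 * n) <> 0 ->
  csum (fun r => entry q A B P s (n - r) r) (S n) = left_term q A B P s n.
Proof.
  intros Ha.
  rewrite (csum_ext _ (fun r => delta q A B P n * beta_term q a s (n - r) r)).
  - rewrite csum_scal, beta_sum.
    + rewrite generic_E. unfold left_term. ring.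
    + exact Hq0.
    + exact Hq.
    + unfold a. repeat apply Cmult_neq_0; auto using C1_nz.
    + exact generic_s.
    + exact generic_1a.
    + exact generic_1s.
    + rewrite generic_c. exact (g_aP _ _ _ _ _ G).
    + rewrite (g_s _ _ _ _ _ G). exact (g_k _ _ _ _ _ G).
    + exact Ha.
  - intros r Hr. unfold entry. replace (n - r + r)%nat with n by lia.
    fold a. ring.
Qed.

Lemma dup_quot (c : C) (m : nat) :
  qpoch c q m <> 0 -> qpoch c (q ^ 2) m / qpoch c q m = dup c q m.
Proof.
  destruct m as [|i]; intros H. simpl. field.
  unfold dup. rewrite qpoch_S_l in H. rewrite !qpoch_S_l.
  assert (H1 := Cmult_neq0_l _ _ H). assert (H2 := Cmult_neq0_r _ _ H).
  field. auto.
Qed.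

(** For fixed [r] the entries are proportional to the terms of Watson's series
    with the parameters [A q^r], [B q^r] and [P]. *)
Lemma entry_factor (m r : nat) :
  qpoch (a * q ^ (2 * r + 1)) q m <> 0 ->
  entry q A B P s m r
  = row_factor q A B P s r * watson_term q (A * q ^ r) (B * q ^ r) P m.
Proof.
  intros Ha. unfold entry. fold a. unfold beta_term, row_factor, watson_term.
  rewrite generic_E, generic_c, (g_s _ _ _ _ _ G). fold a.
  replace (A * q ^ r * (B * q ^ r) * q * P ^ 2) with (a * q ^ (2 * r + 1))
    by (unfold a; rewrite Cpow_add_r, Cpow_double; ring).
  rewrite <- dup_quot by exact Ha.
  rewrite (eprod_poch q P m) by exact HP.
  unfold delta. fold a.
  rewrite !(Nat.add_comm m r), !qpoch_add, (Cpow_add_r (- (q * P))).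
  replace (a * q * (q ^ 2) ^ r) with (a * q ^ (2 * r + 1))
    by (rewrite Cpow_add_r, Cpow_double, Cpow_sq; ring).
  replace (A * B * q * (q ^ 2) ^ r) with (A * q ^ r * (B * q ^ r) * q)
    by (rewrite Cpow_sq; ring).
  replace (B * q * P * q ^ r) with (B * q ^ r * q * P) by ring.
  replace (A * q * P * q ^ r) with (A * q ^ r * q * P) by ring.
  replace (A * B * P * q ^ (2 * r)) with (A * q ^ r * (B * q ^ r) * P)
    by (rewrite Cpow_double; ring).
  replace ((- q) ^ r) with ((/ P) ^ r * (- (q * P)) ^ r)
    by (rewrite <- Cpow_mult_l; f_equal; field; auto).
  unfold Cdiv. rewrite !Cinv_mult. ring.
Qed.

(** The factor [D] stands for the value of the inner series up to its known
    denominator: it is one product in the non-degenerate case, and a sum of two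
    products in the degenerate case. *)
Lemma row_sum (r : nat) (S D : C) :
  qpoch (a * q ^ r) q r <> 0 ->
  watson_den q (A * q ^ r) (B * q ^ r) P * S
    = qpoch_inf (A * B * P * q * q ^ (2 * r)) q * D ->
  watson_den q A B P / qpoch_inf (A * B * P * q) q * (row_factor q A B P s r * S)
  = right_coef q A B P s r * D.
Proof.
  intros Ha HS.
  assert (Hq2 := Cmod_sq_lt1 q Hq).
  assert (EV := vwp_split a q 0 r).
  change (qpoch (a * q ^ (2 * r + 1)) q 0) with (RtoC 1) in EV.
  replace (0 + r + r)%nat with (2 * r)%nat in EV by lia.
  rewrite qpoch_even in EV.
  assert (ED : watson_den q A B P = qpoch (A * q * P) q r * qpoch (B * q * P) q r
    * qpoch (- (q * P)) q 0 * qpoch (A * B * q) (q ^ 2) r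
    * qpoch (a * q * q) (q ^ 2) r * watson_den q (A * q ^ r) (B * q ^ r) P).
  { unfold watson_den.
    rewrite (qpoch_inf_split (A * q * P) q r), (qpoch_inf_split (B * q * P) q r) by exact Hq.
    rewrite (qpoch_inf_split (A * B * q) (q ^ 2) r),
      (qpoch_inf_split (A * B * q ^ 2 * P ^ 2) (q ^ 2) r) by exact Hq2.
    rewrite Cpow_sq.
    replace (A * q ^ r * q * P) with (A * q * P * q ^ r) by ring.
    replace (B * q ^ r * q * P) with (B * q * P * q ^ r) by ring.
    replace (A * q ^ r * (B * q ^ r) * q ^ 2 * P ^ 2)
      with (A * B * q ^ 2 * P ^ 2 * (q ^ r * q ^ r)) by ring.
    replace (A * q ^ r * (B * q ^ r) * q) with (A * B * q * (q ^ r * q ^ r)) by ring.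
    replace (a * q * q) with (A * B * q ^ 2 * P ^ 2) by (unfold a; ring).
    simpl (qpoch _ _ 0). ring. }
  rewrite ED, (qpoch_inf_split (A * B * P * q) q (2 * r)) by exact Hq.
  assert (HK := qpoch_inf_neq0 _ _ Hq (nonvanishing_shift _ _ (2 * r) (g_k _ _ _ _ _ G))).
  assert (HK2 := qpoch_nonvanishing _ _ (2 * r) (g_k _ _ _ _ _ G)).
  assert (H1 := qpoch_nonvanishing _ _ r (g_AP _ _ _ _ _ G)).
  assert (H2 := qpoch_nonvanishing _ _ r (g_BP _ _ _ _ _ G)).
  assert (H3 := qpoch_nonvanishing _ _ r (g_AB _ _ _ _ _ G)).
  assert (H4 := qpoch_nonvanishing _ _ r (g_aP _ _ _ _ _ G)).
  assert (H5 := qpoch_nonvanishing _ _ r (nonvanishing_base q Hq)).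
  assert (H6 := generic_1s). assert (H7 := generic_s).
  unfold row_factor, right_coef. fold a.
  change (qpoch (- (q * P)) q 0) with (RtoC 1).
  set (KI := qpoch_inf (A * B * P * q * q ^ (2 * r)) q) in *.
  set (W := watson_den q (A * q ^ r) (B * q ^ r) P) in *.
  transitivity ((qpoch (a * q) (q ^ 2) r * qpoch (a * q * q) (q ^ 2) r)
    * (W * S) * ((- q) ^ r * qpoch (/ P) q r * qpoch (A * B * P ^ 3 * q) (q ^ 2) r
  * qpoch (a / s) q r * qpoch (- (a * q / s)) q r
  * (1 + s * q ^ r) * qpoch A q r * qpoch B q r)
  / ((1 + s) * qpoch q q r * qpoch (A * B * P ^ 3 * q) q r
     * qpoch (a * q ^ r) q r * (qpoch (A * B * P * q) q (2 * r) * KI))).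
  - clear EV HS ED.
    set (u1 := qpoch (a / s) q r). set (u2 := qpoch (- (a * q / s)) q r).
    set (u3 := qpoch (/ P) q r).
    clearbody u1 u2 u3.
    field. repeat split; neq0.
  - rewrite <- EV, HS.
    set (u1 := qpoch (a / s) q r). set (u2 := qpoch (- (a * q / s)) q r).
    set (u3 := qpoch (/ P) q r).
    clearbody u1 u2 u3. clear EV HS ED.
    field. repeat split; neq0.
Qed.

Lemma row_sum_full (r : nat) (S : C) :
  qpoch (a * q ^ r) q r <> 0 ->
  watson_den q (A * q ^ r) (B * q ^ r) P * S = watson_num q (A * q ^ r) (B * q ^ r) P ->
  watson_den q A B P / qpoch_inf (A * B * P * q) q * (row_factor q A B P s r * S)
  = right_term q A B P s r.
Proof.
  intros Ha HS. unfold right_term. apply row_sum. exact Ha.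
  rewrite HS. unfold watson_num.
  replace (A * q ^ r * (B * q ^ r) * P * q) with (A * B * P * q * q ^ (2 * r))
    by (rewrite Cpow_double; ring).
  replace (A * q ^ r * q) with (A * q ^ Datatypes.S r) by (rewrite Cpow_S; ring).
  replace (B * q ^ r * q) with (B * q ^ Datatypes.S r) by (rewrite Cpow_S; ring).
  replace (A * q ^ r * q ^ 2 * P ^ 2) with (A * q ^ Datatypes.S (Datatypes.S r) * P ^ 2)
    by (rewrite (Cpow_S q (Datatypes.S r)), (Cpow_S q r); ring).
  replace (B * q ^ r * q ^ 2 * P ^ 2) with (B * q ^ Datatypes.S (Datatypes.S r) * P ^ 2)
    by (rewrite (Cpow_S q (Datatypes.S r)), (Cpow_S q r); ring).
  ring.
Qed.

End DoubleSum.

(** * The non-degenerate case *)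

Section NonDegenerate.

Variables q A B P s : C.
Hypothesis G : generic q A B P s.
Hypothesis Hodd : nonvanishing (A * B * P ^ 2 * q) (q ^ 2).

Let a := A * B * P ^ 2.
Let Hq0 := g_q _ _ _ _ _ G.
Let Hq := g_q1 _ _ _ _ _ G.
Let HP := g_P _ _ _ _ _ G.

Lemma nonvanishing_even_odd (x : C) :
  nonvanishing x (q ^ 2) -> nonvanishing (x * q) (q ^ 2) -> nonvanishing x q.
Proof.
  intros H0 H1 j. destruct (Nat.Even_or_Odd j) as [[i ->]|[i ->]].
  - rewrite Cpow_mult_r. apply H0.
  - rewrite Cpow_add_r, Cpow_mult_r.
    replace (x * ((q ^ 2) ^ i * q ^ 1)) with (x * q * (q ^ 2) ^ i) by ring. apply H1.
Qed.

Lemma nondegenerate_a : nonvanishing a q.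
Proof. apply nonvanishing_even_odd. exact (g_a _ _ _ _ _ G). exact Hodd. Qed.

(** The growth [|1/P|^r] of these coefficients is compensated by the decay
    [|q P|^(m+r)] of [delta], which leaves [|q P|^m |q|^r]. *)
Lemma beta_bound :
  exists K, (0 <= K)%R /\ forall m r,
    (Cmod (beta_term q a s m r) <= K * Cmod (/ P) ^ r)%R.
Proof.
  assert (Hq2 := Cmod_sq_lt1 q Hq).
  destruct (qpoch_lower0 _ _ Hq (nonvanishing_base q Hq)) as [lq [Hlq Hlq']].
  destruct (qpoch_lower0 _ _ Hq (g_aP _ _ _ _ _ G)) as [lc [Hlc Hlc']].
  destruct (qpoch_lower _ _ Hq nondegenerate_a) as [la [Hla Hla']].
  assert (Hs1 : (0 < Cmod (1 + s))%R) by (apply Cmod_gt_0; exact (generic_1s _ _ _ _ _ G)).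
  set (b := poch_bound).
  assert (Hb : forall x p, (0 <= b x p)%R) by (intros; left; apply poch_bound_pos).
  assert (Hl : (0 < Cmod (1 + s) * lq * lq * lc * la * la)%R)
    by (repeat apply Rmult_lt_0_compat; assumption).
  exists ((1 + Cmod (s ^ 2)%C) * b (s ^ 2 * q)%C q * b (s ^ 2 / a)%C q * b (s ^ 2 / a)%C q
    * b (a ^ 2 / s ^ 2 * q)%C (q ^ 2)%C * b (a / s)%C q * b (- (a * q / s))%C q
    * (1 + Cmod s) / (Cmod (1 + s)%C * lq * lq * lc * la * la))%R.
  split.
  - apply Rdiv_le_0_compat; [|exact Hl].
    assert (H1 := Cmod_ge_0 (s ^ 2)). assert (H2 := Cmod_ge_0 s).
    repeat apply Rmult_le_pos; try apply Hb; lra.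
  - intros m r. unfold beta_term.
    match goal with |- (Cmod (?v * ?e1 * ?e2 * ?e * ?c * ?u1 * ?u2 * ?f / ?d) <= _)%R =>
      replace (v * e1 * e2 * e * c * u1 * u2 * f / d)
        with ((v * e1 * e2 * c * u1 * u2 * f / d) * e) by (unfold Cdiv; ring) end.
    apply Cmod_mult_le.
    2:{ unfold a. rewrite (generic_E _ _ _ _ _ G), Cmod_pow. lra. }
    apply Cmod_div_le. 2: exact Hl.
    + repeat apply Cmod_mult_le; try (now apply qpoch_upper).
      * now apply vwp_upper.
      * eapply Rle_trans. apply Cmod_triangle. rewrite Cmod_1.
        apply Rplus_le_compat_l. now apply Cmod_shift_le.
    + repeat apply Cmod_mult_ge; try (left; assumption);
        try (left; repeat apply Rmult_lt_0_compat; assumption); try apply Rle_refl; auto.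
      unfold a. rewrite (generic_c _ _ _ _ _ G). apply Hlc'.
Qed.

Lemma delta_bound :
  exists K, (0 <= K)%R /\ forall n,
    (Cmod (delta q A B P n) <= K * Cmod (q * P) ^ n)%R.
Proof.
  assert (Hq2 := Cmod_sq_lt1 q Hq).
  destruct (qpoch_lower0 _ _ Hq (g_BP _ _ _ _ _ G)) as [l1 [Hl1 Hl1']].
  destruct (qpoch_lower0 _ _ Hq (g_AP _ _ _ _ _ G)) as [l2 [Hl2 Hl2']].
  destruct (qpoch_lower0 _ _ Hq2 (g_AB _ _ _ _ _ G)) as [l3 [Hl3 Hl3']].
  set (b := poch_bound).
  assert (Hb : forall x p, (0 <= b x p)%R) by (intros; left; apply poch_bound_pos).
  assert (Hl : (0 < l1 * l2 * l3)%R) by (repeat apply Rmult_lt_0_compat; assumption).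
  exists (b A q * b B q * b (A * B * P ^ 2 * q)%C (q ^ 2)%C / (l1 * l2 * l3))%R. split.
  - apply Rdiv_le_0_compat; [|exact Hl]. repeat apply Rmult_le_pos; apply Hb.
  - intros n. unfold delta.
    match goal with |- (Cmod (?x * ?y * ?z * ?e / ?d) <= _)%R =>
      replace (x * y * z * e / d) with (x * y * z / d * e) by (unfold Cdiv; ring) end.
    apply Cmod_mult_le.
    2:{ rewrite Cmod_pow, Cmod_opp. lra. }
    apply Cmod_div_le. 2: exact Hl.
    + repeat apply Cmod_mult_le; now apply qpoch_upper.
    + repeat apply Cmod_mult_ge; auto; try (left; assumption).
      left. now apply Rmult_lt_0_compat.
Qed.

Lemma entry_bound :
  watson_convergent q A B P ->
  exists K w, (0 <= K)%R /\ (0 <= w < 1)%R /\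
    forall m r, (Cmod (entry q A B P s m r) <= K * w ^ (m + r))%R.
Proof.
  intros Hc.
  destruct beta_bound as [K1 [HK1 H1]]. destruct delta_bound as [K2 [HK2 H2]].
  assert (HE0 := Cmod_ge_0 (/ P)). assert (Hz0 := Cmod_ge_0 (q * P)).
  assert (HqE : (Cmod (/ P) * Cmod (q * P) = Cmod q)%R).
  { rewrite <- Cmod_mult. f_equal. field. auto. }
  assert (Hq0' := Cmod_ge_0 q).
  set (E := Cmod (/ P)) in *. set (z := Cmod (q * P)) in *.
  assert (H : forall m r, (Cmod (entry q A B P s m r)
    <= (K1 * K2) * (E ^ r * z ^ (m + r)))%R).
  { intros m r. unfold entry. fold a.
    replace (K1 * K2 * (E ^ r * z ^ (m + r)))%R
      with ((K1 * E ^ r) * (K2 * z ^ (m + r)))%R by ring.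
    apply Cmod_mult_le. apply H1. apply H2. }
  assert (HKK := Rmult_le_pos _ _ HK1 HK2).
  destruct Hc as [Hc|Ht].
  - exists (K1 * K2)%R, (Rmax z (Cmod q)).
    split. exact HKK.
    split. { split. eapply Rle_trans; [exact Hz0|apply Rmax_l]. now apply Rmax_lub_lt. }
    intros m r. eapply Rle_trans. apply H. apply Rmult_le_compat_l. exact HKK.
    replace (E ^ r * z ^ (m + r))%R with (z ^ m * (Cmod q) ^ r)%R.
    + rewrite pow_add. apply Rmult_le_compat; try (apply pow_le; assumption).
      * apply pow_incr. split. exact Hz0. apply Rmax_l.
      * apply pow_incr. split. exact Hq0'. apply Rmax_r.
    + rewrite <- HqE, Rpow_mult_distr, pow_add. ring.
  - (* a terminating series: finitely many anti-diagonals, any ratio will do *)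
    destruct (terminating_zero q A B Ht) as [j Hj].
    set (M := ((1 + E) * (1 + z))%R).
    assert (HM : (1 <= M)%R) by (unfold M; nra).
    exists (K1 * K2 * (M ^ j * 2 ^ j))%R, (1 / 2)%R.
    split. { repeat apply Rmult_le_pos; auto; apply pow_le; lra. }
    split. lra.
    intros m r. destruct (Nat.le_gt_cases (m + r) j) as [Hn|Hn].
    + eapply Rle_trans. apply H. rewrite (Rmult_assoc (K1 * K2) (M ^ j * 2 ^ j)).
      apply Rmult_le_compat_l. exact HKK.
      apply Rle_trans with (M ^ j * 1)%R.
      * rewrite Rmult_1_r.
        apply Rle_trans with ((1 + E) ^ j * (1 + z) ^ j)%R;
          [|unfold M; rewrite Rpow_mult_distr; lra].
        apply Rmult_le_compat; try (apply pow_le; assumption).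
        -- apply Rle_trans with ((1 + E) ^ r)%R. apply pow_incr; lra.
           apply Rle_pow. lra. lia.
        -- apply Rle_trans with ((1 + z) ^ (m + r))%R. apply pow_incr; lra.
           apply Rle_pow. lra. lia.
      * rewrite (Rmult_assoc (M ^ j)). apply Rmult_le_compat_l. apply pow_le; lra.
        replace (2 ^ j * (1 / 2) ^ (m + r))%R with (2 ^ (j - (m + r)))%R.
        apply pow_R1_Rle. lra.
        replace j with ((j - (m + r)) + (m + r))%nat at 2 by lia.
        rewrite pow_add, Rmult_assoc, <- Rpow_mult_distr.
        replace (2 * (1 / 2))%R with 1%R by field. rewrite pow1. ring.
    + unfold entry, delta. rewrite Hj by lia.
      replace (beta_term q (A * B * P ^ 2) s m r * (0 * qpoch (A * B * P ^ 2 * q) (q ^ 2) (m + r)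
        * (- (q * P)) ^ (m + r) / (qpoch (B * q * P) q (m + r) * qpoch (A * q * P) q (m + r)
         * qpoch (A * B * q) (q ^ 2) (m + r)))) with (RtoC 0) by (unfold Cdiv; ring).
      rewrite Cmod_0. repeat apply Rmult_le_pos; auto; apply pow_le; lra.
Qed.

(** If [A] or [B] equals [q^(-j)] with [j < r], the whole row and the
    corresponding term on the right vanish. Otherwise the shifted parameters
    inherit the convergence condition. *)
Lemma row_exists (r : nat) :
  watson_convergent q A B P ->
  exists R, sums (fun m => entry q A B P s m r) R /\
    watson_den q A B P / qpoch_inf (A * B * P * q) q * R = right_term q A B P s r.
Proof.
  intros Hc.
  assert (Ha := nondegenerate_a).
  assert (Hent : forall m, entry q A B P s m r = row_factor q A B P s r
    * watson_term q (A * q ^ r) (B * q ^ r) P m).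
  { intros m. apply entry_factor. exact G.
    apply qpoch_nonvanishing. now apply nonvanishing_shift. }
  destruct (classic (qpoch A q r * qpoch B q r = 0)) as [Hz|Hz].
  - exists 0. split.
    + apply (tends_ext (fun _ => 0)); [|apply tends_const].
      intros n. symmetry. apply csum_zero. intros m _. rewrite Hent.
      assert (Hk : row_factor q A B P s r = 0).
      { unfold row_factor.
        match goal with |- ?x * ?y * ?z / ?d = _ =>
          match x with ?u * qpoch A q r =>
            replace (x * y * z / d) with (u * (qpoch A q r * y) * z / d)
            by (unfold Cdiv; ring) end end.
        rewrite Hz. unfold Cdiv. ring. }
      rewrite Hk. ring.
    + unfold right_term, right_coef.
      match goal with |- _ = ?x * ?y / ?d * ?z =>
        match x with ?u * qpoch A q r =>
          replace (x * y / d * z) with (u * (qpoch A q r * y) / d * z)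
          by (unfold Cdiv; ring) end end.
      rewrite Hz. unfold Cdiv. ring.
  - assert (Hr : watson_regular q (A * q ^ r) (B * q ^ r) P).
    { repeat split.
      - replace (B * q ^ r * q * P) with (B * q * P * q ^ r) by ring.
        apply nonvanishing_shift. exact (g_BP _ _ _ _ _ G).
      - replace (A * q ^ r * q * P) with (A * q * P * q ^ r) by ring.
        apply nonvanishing_shift. exact (g_AP _ _ _ _ _ G).
      - replace (A * q ^ r * (B * q ^ r) * q) with (A * B * q * (q ^ 2) ^ r)
          by (rewrite Cpow_sq; ring).
        apply nonvanishing_shift. exact (g_AB _ _ _ _ _ G).
      - replace (A * q ^ r * (B * q ^ r) * q * P ^ 2 * q) with (a * q ^ (2 + 2 * r))
          by (unfold a; rewrite Cpow_add_r, Cpow_double; ring).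
        now apply nonvanishing_shift. }
    assert (Hc' : watson_convergent q (A * q ^ r) (B * q ^ r) P).
    { destruct Hc as [Hc|[j Hj]]. now left. right. exists (j - r)%nat.
      assert (Hrj : (r <= j)%nat).
      { apply Nat.nlt_ge. intros Hlt. apply Hz.
        destruct Hj as [Hj|Hj]; rewrite (qpoch_zero _ _ r j Hj Hlt); ring. }
      replace (A * q ^ r * q ^ (j - r)) with (A * q ^ j).
      replace (B * q ^ r * q ^ (j - r)) with (B * q ^ j). exact Hj.
      all: rewrite <- Cmult_assoc, <- Cpow_add_r; do 2 f_equal; lia. }
    destruct (watson_summable _ _ _ _ Hq HP Hr Hc') as [S HS].
    exists (row_factor q A B P s r * S). split.
    + apply (tends_ext (fun n => row_factor q A B P s r
        * csum (watson_term q (A * q ^ r) (B * q ^ r) P) n)).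
      * intros n. rewrite <- csum_scal. apply csum_ext. intros m _. now rewrite Hent.
      * now apply tends_scal.
    + apply row_sum_full. exact G.
      * apply qpoch_nonvanishing. now apply nonvanishing_shift.
      * now apply watson_sum.
Qed.

Lemma nondegenerate_limit :
  watson_convergent q A B P ->
  tends (fun N => csum (right_term q A B P s) N
    - watson_den q A B P / qpoch_inf (A * B * P * q) q * csum (left_term q A B P s) N) 0.
Proof.
  intros Hc.
  destruct (entry_bound Hc) as [K [w [HK [Hw Hb]]]].
  set (row := fun r => CSeries (fun m => entry q A B P s m r)).
  assert (Hrow : forall r, sums (fun m => entry q A B P s m r) (row r) /\
    watson_den q A B P / qpoch_inf (A * B * P * q) q * row r = right_term q A B P s r).
  { intros r. destruct (row_exists r Hc) as [R [HR1 HR2]].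
    unfold row. rewrite (sums_CSeries _ _ HR1). auto. }
  assert (HD := diagonals_vs_rows _ row K w Hw HK Hb (fun r => proj1 (Hrow r))).
  set (pref := watson_den q A B P / qpoch_inf (A * B * P * q) q) in *.
  assert (HD' := tends_scal pref _ _ HD).
  replace (pref * 0) with (RtoC 0) in HD' by ring.
  apply tends_ext with (2 := HD'). intros N. cbv beta.
  rewrite (csum_ext (fun n => csum (fun r => entry q A B P s (n - r) r) (S n))
    (left_term q A B P s)).
  - rewrite (csum_ext (right_term q A B P s) (fun r => pref * row r)).
    + rewrite csum_scal. ring.
    + intros r _. symmetry. apply Hrow.
  - intros n _. apply diagonal_sum. exact G.
    apply qpoch_nonvanishing. apply nonvanishing_shift1. exact nondegenerate_a.
Qed.

End NonDegenerate.

(** * The degenerate case *)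

(** The power [q^(n(n-1)/2)]. *)
Fixpoint tri (q : C) (n : nat) : C :=
  match n with
  | O => 1
  | S m => tri q m * q ^ m
  end.

Lemma tri_sq (q : C) (n : nat) : tri q n ^ 2 * q ^ n = q ^ (n * n).
Proof.
  induction n as [|n IH]. simpl. ring.
  replace (S n * S n)%nat with (n * n + n + n + 1)%nat by lia.
  rewrite !Cpow_add_r, <- IH. simpl. ring.
Qed.

Lemma tri_double (q : C) (n : nat) : tri q (2 * n) * q ^ n = q ^ (2 * (n * n)).
Proof.
  induction n as [|n IH]. simpl. ring.
  replace (2 * S n)%nat with (S (S (2 * n))) by lia.
  replace (2 * (S n * S n))%nat with (2 * (n * n) + (2 * n + 2 * n) + 2)%nat by lia.
  rewrite !Cpow_add_r, <- IH. cbn [tri].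
  rewrite (Cpow_S q (2 * n)), (Cpow_S q n), Cpow_double. ring.
Qed.

(** The factors of the second factorial are, in reverse order, those of the
    first up to monomials. *)
Lemma qpoch_reverse (x y q : C) (d : nat) :
  x * y * q ^ d = q -> q <> 0 ->
  qpoch x q d = (- x) ^ d * tri q d * qpoch y q d.
Proof.
  intros H Hq. revert y H. induction d as [|d IH]; intros y H. simpl. ring.
  rewrite Cpow_S in H.
  assert (H1 : x * y * q ^ d = 1).
  { apply (Cmult_eq_l q _ _ Hq). transitivity (x * y * (q * q ^ d)). ring.
    rewrite H. ring. }
  rewrite qpoch_S, (IH (y * q)), qpoch_S_l.
  - cbn [tri]. rewrite Cpow_S.
    transitivity ((- x) ^ d * tri q d * qpoch (y * q) q d
      * (x * y * q ^ d - x * q ^ d)). now rewrite H1. ring.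
  - transitivity (x * y * q ^ d * q). ring. rewrite H1. ring.
Qed.

Lemma csum_rev (u : nat -> C) (n : nat) :
  csum u n = csum (fun i => u (n - S i)%nat) n.
Proof.
  induction n as [|n IH]. reflexivity.
  rewrite csum_S, csum_S_l, IH. replace (S n - 1)%nat with n by lia.
  rewrite Cplus_comm. f_equal. 
Qed.

Lemma csum_fold (u : nat -> C) (N : nat) :
  csum u (2 * S N) = csum (fun r => u r + u (2 * N + 1 - r)%nat) (S N).
Proof.
  replace (2 * S N)%nat with (S N + S N)%nat by lia.
  rewrite csum_add, csum_plus. f_equal.
  rewrite csum_rev. apply csum_ext. intros i Hi. f_equal. lia.
Qed.

Lemma vwp_add (l q : C) (r d : nat) :
  1 - l * (q ^ r * q ^ r) <> 0 -> 
  (forall i, (i < d)%nat -> 1 - l * (q ^ (r + i) * q ^ (r + i)) <> 0) ->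
  vwp l q (r + d) * (1 - l * (q ^ r * q ^ r))
  = vwp l q r * qpoch (l * q ^ r) q d * (1 - l * (q ^ (r + d) * q ^ (r + d))).
Proof.
  intros Hr. induction d as [|d IH]; intros H.
  - rewrite Nat.add_0_r. simpl. ring.
  - rewrite Nat.add_succ_r.
    assert (Hd := H d (Nat.lt_succ_diag_r d)).
    assert (HV := vwp_S l q (r + d)).
    assert (HI := IH ltac:(intros; apply H; lia)).
    apply (Cmult_eq_l _ _ _ Hd).
    transitivity ((vwp l q (S (r + d)) * (1 - l * (q ^ (r + d) * q ^ (r + d))))
      * (1 - l * (q ^ r * q ^ r))). ring.
    rewrite HV.
    transitivity ((vwp l q (r + d) * (1 - l * (q ^ r * q ^ r))) * (1 - l * q ^ (r + d))
      * (1 - l * (q * q ^ (r + d) * (q * q ^ (r + d))))). ring.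
    rewrite HI, qpoch_S, (Cpow_S q (r + d)).
    replace (l * q ^ r * q ^ d) with (l * q ^ (r + d)) by (rewrite Cpow_add_r; ring).
    ring.
Qed.

(** The monomials produced by the reversals in [right_term_reverse] collapse,
    since [a x^2 q^d = 1] for [x = q^r]. *)
Lemma reversal_powers (q a P x A' B' : C) (n d : nat) :
  q <> 0 -> P <> 0 -> d = (2 * n + 1)%nat ->
  a * (x * x) * q ^ d = 1 -> A' * B' * P ^ 2 = a * (x * x) ->
  (- q) ^ d * ((- (a * x)) ^ d * tri q d) * ((- (/ P * x)) ^ d * tri q d)
  * ((- (a * P * (x * x))) ^ (2 * d) * tri q (2 * d)) * - (q ^ d * q ^ d)
  * (((- (A' * q)) ^ n * tri (q ^ 2) n) * ((- (B' * q)) ^ n * tri (q ^ 2) n))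
  = q * q ^ n * P.
Proof.
  intros Hq HP Hd Hu HAB. set (u := a * (x * x)) in *.
  assert (Hqn : forall m, q ^ m <> 0) by (intros; now apply Cpow_nz).
  assert (E1 : (- q) ^ d * (- (a * x)) ^ d * (- (/ P * x)) ^ d
    * (- (a * P * (x * x))) ^ (2 * d) = - (q ^ d * (u ^ d * u ^ d * u ^ d) * P ^ d)).
  { rewrite Cpow_double, <- !Cpow_mult_l.
    replace (- q * - (a * x) * - (/ P * x) * (- (a * P * (x * x)) * - (a * P * (x * x))))
      with (- (1) * (q * (u * u * u) * P)) by (unfold u; field; auto).
    rewrite Cpow_mult_l. replace ((- (1)) ^ d) with (- (1)). ring.
    rewrite Hd, Cpow_add_r, Cpow_mult_r. replace ((- (1)) ^ 2) with (RtoC 1) by ring.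
    rewrite Cpow_1_l. ring. }
  assert (E2 : (- (A' * q)) ^ n * (- (B' * q)) ^ n * (P ^ n * P ^ n) = u ^ n * (q ^ n * q ^ n)).
  { rewrite <- !Cpow_mult_l. f_equal. rewrite <- HAB. ring. }
  assert (E3 : u ^ d * q ^ (d * d) = 1).
  { rewrite Cpow_mult_r, <- Cpow_mult_l, Hu. apply Cpow_1_l. }
  assert (E4 : u ^ n * q ^ (d * n) = 1).
  { rewrite Cpow_mult_r, <- Cpow_mult_l, Hu. apply Cpow_1_l. }
  assert (E5 := tri_sq q d). assert (E6 := tri_double q d).
  assert (E7 := tri_sq (q ^ 2) n). rewrite !Cpow_sq in E7.
  assert (EP : P ^ d = P ^ n * P ^ n * P).
  { rewrite Hd, Cpow_add_r, Cpow_double. ring. }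
  set (M := P ^ n * P ^ n * (q ^ (d * d) * q ^ (d * d) * q ^ (d * d)) * q ^ (d * n)
    * q ^ d * q ^ d * (q ^ n * q ^ n)).
  assert (HPn : P ^ n <> 0) by now apply Cpow_nz.
  assert (HM : M <> 0) by (unfold M; repeat apply Cmult_neq_0; auto).
  apply (Cmult_eq_l M _ _ HM).
  match goal with |- M * (?a1 * (?b1 * ?t1) * (?c1 * ?t1) * (?e1 * ?t2) * - ?f
    * ((?g * ?T) * (?h * ?T))) = _ =>
    transitivity (- (a1 * b1 * c1 * e1)
      * (g * h * (P ^ n * P ^ n)) * (t1 ^ 2 * q ^ d) * (t2 * q ^ d)
      * (T ^ 2 * (q ^ n * q ^ n)) * f
      * (q ^ (d * d) * q ^ (d * d) * q ^ (d * d)) * q ^ (d * n)) end.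
  unfold M; ring.
  rewrite E1, E2, E5, E6, E7, EP.
  transitivity ((u ^ d * q ^ (d * d)) * (u ^ d * q ^ (d * d)) * (u ^ d * q ^ (d * d))
    * (u ^ n * q ^ (d * n)) * (P ^ n * P ^ n * P)
    * (q ^ d * (q ^ n * q ^ n) * q ^ (d * d) * q ^ (2 * (d * d))
      * (q ^ (n * n) * q ^ (n * n)) * (q ^ d * q ^ d))). ring.
  rewrite E3, E4. unfold M.
  transitivity (P ^ n * P ^ n * P * (q * q ^ n * (q ^ (d * d) * q ^ (d * d) * q ^ (d * d))
    * q ^ (d * n) * q ^ d * q ^ d * (q ^ n * q ^ n))); [|ring].
  transitivity (P ^ n * P ^ n * P * (q ^ d * (q ^ n * q ^ n) * q ^ (d * d)
    * q ^ (2 * (d * d)) * (q ^ (n * n) * q ^ (n * n)) * (q ^ d * q ^ d))). ring.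
  f_equal. change (q * q ^ n) with (q ^ S n). rewrite <- !Cpow_add_r. f_equal.
  subst d. ring.
Qed.

(** Here [a q^(2N+1) = 1]. The 6phi5 terminates because of the factor
    [(a q;q^2)_n]. In Watson's series this factor is divided by a factorial
    with the same zero, so that the rows are truncations of the latter rather than complete
    series. *)
Section Degenerate.

Variables q A B P s : C.
Variable N : nat.
Hypothesis G : generic q A B P s.
Hypothesis Hdeg : A * B * P ^ 2 * q * q ^ (2 * N) = 1.

Let a := A * B * P ^ 2.
Let Hq0 := g_q _ _ _ _ _ G.
Let Hq := g_q1 _ _ _ _ _ G.
Let HP := g_P _ _ _ _ _ G.

(** The second product in [watson_truncated_sum] belongs to the term of index
    [2 N + 1 - r] of the right-hand side: since [a q^(2N+1) = 1], reversing
    factorials reflects the very-well-poised series about its middle. *)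
Lemma right_term_reverse (r n : nat) :
  (r + n = N)%nat ->
  right_coef q A B P s r
  * (q * (q ^ n * P) * qpoch (A * q ^ S (S r) * P ^ 2) (q ^ 2) n
     * qpoch (B * q ^ S (S r) * P ^ 2) (q ^ 2) n
     * (qpoch_inf (A * q ^ r) (q ^ 2) * qpoch_inf (B * q ^ r) (q ^ 2)
        * qpoch_inf (A * q ^ r * q ^ (2 * n + 3) * P ^ 2) (q ^ 2)
        * qpoch_inf (B * q ^ r * q ^ (2 * n + 3) * P ^ 2) (q ^ 2)))
  = right_term q A B P s (2 * N + 1 - r).
Proof.
  intros Hrn. assert (Hq2 := Cmod_sq_lt1 q Hq).
  set (d := (2 * n + 1)%nat).
  replace (2 * N + 1 - r)%nat with (r + d)%nat by (unfold d; lia).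
  assert (Hu : a * (q ^ r * q ^ r) * q ^ d = 1).
  { rewrite <- Hdeg. fold a. rewrite <- Hrn. unfold d.
    replace (2 * (r + n))%nat with (r + r + 2 * n)%nat by lia.
    rewrite !Cpow_add_r. ring. }
  assert (Hx := Cpow_nz q r Hq0). assert (Hd0 := Cpow_nz q d Hq0).
  assert (Hs := generic_s _ _ _ _ _ G).
  assert (Hs1 := generic_1s _ _ _ _ _ G).
  assert (Hsr := generic_1sq _ _ _ _ _ G r).
  assert (HsR := generic_1sq _ _ _ _ _ G (r + d)).
  assert (Haxx : a * (q ^ r * q ^ r) = / q ^ d).
  { replace (/ q ^ d) with (a * (q ^ r * q ^ r) * q ^ d / q ^ d)
      by (rewrite Hu; unfold Cdiv; ring). field. auto. }
  assert (Hv : forall i, 1 - a * (q ^ i * q ^ i) <> 0).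
  { intros i. rewrite <- Cpow_sq. apply (g_a _ _ _ _ _ G). }
  assert (EV := vwp_add a q r d (Hv r) (fun i _ => Hv (r + i)%nat)).
  assert (R1 := qpoch_reverse (a * q ^ r) (q * q ^ r) q d).
  specialize (R1 ltac:(transitivity (q * (a * (q ^ r * q ^ r) * q ^ d));
    [ring | rewrite Hu; ring]) Hq0).
  assert (R2 := qpoch_reverse (/ P * q ^ r) (A * B * P ^ 3 * q * q ^ r) q d).
  specialize (R2 ltac:(transitivity (q * (a * (q ^ r * q ^ r) * q ^ d));
    [unfold a; field; auto | rewrite Hu; ring]) Hq0).
  assert (R3 := qpoch_reverse (a * P * (q ^ r * q ^ r)) (A * B * P * q * q ^ (2 * r)) q (2 * d)).
  specialize (R3 ltac:(rewrite !Cpow_double;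
    transitivity (q * (a * (q ^ r * q ^ r) * q ^ d) * (a * (q ^ r * q ^ r) * q ^ d));
    [unfold a; ring | rewrite Hu; ring]) Hq0).
  assert (Hq20 : q ^ 2 <> 0) by now apply Cpow_nz.
  assert (R4 := qpoch_reverse (A * q ^ r * q) (B * q ^ S (S r) * P ^ 2) (q ^ 2) n).
  specialize (R4 ltac:(rewrite Cpow_sq, (Cpow_S q (S r)), (Cpow_S q r);
    transitivity (q * q * (a * (q ^ r * q ^ r) * q ^ d));
    [unfold a, d; rewrite Cpow_add_r, Cpow_double; ring | rewrite Hu; ring]) Hq20).
  assert (R5 := qpoch_reverse (B * q ^ r * q) (A * q ^ S (S r) * P ^ 2) (q ^ 2) n).
  specialize (R5 ltac:(rewrite Cpow_sq, (Cpow_S q (S r)), (Cpow_S q r);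
    transitivity (q * q * (a * (q ^ r * q ^ r) * q ^ d));
    [unfold a, d; rewrite Cpow_add_r, Cpow_double; ring | rewrite Hu; ring]) Hq20).
  assert (HPC := reversal_powers q a P (q ^ r) (A * q ^ r) (B * q ^ r) n d Hq0 HP
    eq_refl Hu ltac:(unfold a; ring)).
  (* [(a / s)^2 = a P], hence the even factors split into two factorials *)
  assert (E3 : qpoch (a * P * (q ^ r * q ^ r)) q (2 * d)
    = qpoch (a / s * q ^ r) q d * qpoch (- (a / s * q ^ r)) q d
      * qpoch (A * B * P ^ 3 * q * (q ^ r * q ^ r)) (q ^ 2) d).
  { rewrite qpoch_even, qpoch_sq. f_equal. f_equal.
    transitivity (a ^ 2 / s ^ 2 * (q ^ r * q ^ r)); [|field; auto].
    rewrite (g_s _ _ _ _ _ G). unfold a. field.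
    repeat split; [exact HP | exact (g_B _ _ _ _ _ G) | exact (g_A _ _ _ _ _ G)].
    f_equal. unfold a. ring. }
  assert (E4 : qpoch (- (a * q / s) * q ^ r) q d * (1 + a / s * q ^ r)
    = qpoch (- (a / s * q ^ r)) q d * (1 + a / s * q ^ (r + d))).
  { transitivity (qpoch (- (a / s * q ^ r)) q (S d)).
    - rewrite qpoch_S_l. rewrite Cmult_comm. f_equal. ring. f_equal. unfold Cdiv. ring.
    - rewrite qpoch_S, Cpow_add_r. f_equal. ring. }
  assert (E5 : 1 + a / s * q ^ r = (1 + s * q ^ (r + d)) / (s * q ^ (r + d))).
  { rewrite Cpow_add_r. transitivity (1 + a * (q ^ r * q ^ r) / (s * q ^ r)).
    field; auto. rewrite Haxx. field. auto. }
  assert (E6 : 1 + a / s * q ^ (r + d) = (1 + s * q ^ r) / (s * q ^ r)).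
  { rewrite Cpow_add_r.
    transitivity (1 + a * (q ^ r * q ^ r) * q ^ d / (s * q ^ r)).
    field; auto. rewrite Hu. field. auto. }
  assert (E7 : 1 - a * (q ^ (r + d) * q ^ (r + d))
    = - q ^ d * (1 - a * (q ^ r * q ^ r))).
  { rewrite Cpow_add_r. transitivity (1 - a * (q ^ r * q ^ r) * q ^ d * q ^ d). ring.
    rewrite Hu.  rewrite Haxx. field. auto. }
  assert (EI : forall X, qpoch X q (r + d) * qpoch_inf (X * q ^ S (r + d)) (q ^ 2)
    = qpoch X q r * (qpoch_inf (X * q ^ r) (q ^ 2) * qpoch (X * q ^ r * q) (q ^ 2) n)).
  { intros X. rewrite qpoch_add, <- Cmult_assoc. f_equal.
    unfold d. rewrite Nat.add_1_r, qpoch_S, qpoch_even.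
    rewrite (qpoch_inf_split (X * q ^ r) (q ^ 2) (S n)) by exact Hq2.
    rewrite qpoch_S, Cpow_sq, Cpow_double, (Cpow_S (q ^ 2) n), Cpow_sq.
    replace (X * q ^ S (r + S (2 * n))) with (X * q ^ r * (q ^ 2 * (q ^ n * q ^ n))).
    ring. rewrite (Cpow_S q (r + S (2 * n))), Cpow_add_r, (Cpow_S q (2 * n)), Cpow_double.
    ring. }
  rewrite R3 in E3.
  assert (EV' : vwp a q (r + d) = vwp a q r * qpoch (a * q ^ r) q d * - q ^ d).
  { apply (Cmult_eq_l (1 - a * (q ^ r * q ^ r))). apply Hv.
    rewrite E7 in EV. rewrite Cmult_comm, EV. ring. }
  assert (E8 : qpoch (a / s * q ^ r) q d * qpoch (- (a * q / s) * q ^ r) q d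
    * qpoch (A * B * P ^ 3 * q * (q ^ r * q ^ r)) (q ^ 2) d * (1 + s * q ^ (r + d))
    = q ^ d * (1 + s * q ^ r) * ((- (a * P * (q ^ r * q ^ r))) ^ (2 * d)
      * tri q (2 * d) * qpoch (A * B * P * q * q ^ (2 * r)) q (2 * d))).
  { rewrite E3. rewrite E5, E6 in E4.
    set (z := qpoch (- (a * q / s) * q ^ r) q d) in *.
    set (z' := qpoch (- (a / s * q ^ r)) q d) in *.
    assert (E9 : z * (1 + s * q ^ (r + d)) = q ^ d * (1 + s * q ^ r) * z').
    { transitivity (z * ((1 + s * q ^ (r + d)) / (s * q ^ (r + d))) * (s * q ^ (r + d))).
      - field. split. now apply Cpow_nz. exact Hs.
      - rewrite E4, (Cpow_add_r q r d). field. auto. }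
    match goal with |- ?u * z * ?w * ?f = _ =>
      transitivity (u * w * (z * f)); [ring | rewrite E9; ring] end. }
  unfold right_term, right_coef. fold a.
  rewrite EV', (Cpow_add_r (- q)), (qpoch_add (/ P)), (qpoch_add (A * B * P ^ 3 * q)),
    (qpoch_add (a / s)), (qpoch_add (- (a * q / s))), (qpoch_add q), (qpoch_add (A * B * P ^ 3 * q)).
  replace (2 * (r + d))%nat with (2 * r + 2 * d)%nat by lia.
  rewrite (qpoch_add (A * B * P * q)), Cpow_sq.
  assert (EA := EI A). assert (EB := EI B). rewrite R4 in EA. rewrite R5 in EB.
  rewrite R1, R2.
  replace (A * q ^ r * q ^ (2 * n + 3) * P ^ 2) with (A * q ^ S (S (r + d)) * P ^ 2).
  2:{ replace (S (S (r + d))) with (r + (2 * n + 3))%nat by (unfold d; lia).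
      rewrite Cpow_add_r. ring. }
  replace (B * q ^ r * q ^ (2 * n + 3) * P ^ 2) with (B * q ^ S (S (r + d)) * P ^ 2).
  2:{ replace (S (S (r + d))) with (r + (2 * n + 3))%nat by (unfold d; lia).
      rewrite Cpow_add_r. ring. }
  assert (HQd : qpoch (q * q ^ r) q d <> 0).
  { apply qpoch_nonvanishing. apply nonvanishing_shift. now apply nonvanishing_base. }
  assert (HCd : qpoch (A * B * P ^ 3 * q * q ^ r) q d <> 0).
  { apply qpoch_nonvanishing. apply nonvanishing_shift. exact (g_aP _ _ _ _ _ G). }
  assert (HKd : qpoch (A * B * P * q * q ^ (2 * r)) q (2 * d) <> 0).
  { apply qpoch_nonvanishing. apply nonvanishing_shift. exact (g_k _ _ _ _ _ G). }
  assert (HQr := qpoch_nonvanishing q q r (nonvanishing_base q Hq)).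
  assert (HCr := qpoch_nonvanishing _ _ r (g_aP _ _ _ _ _ G)).
  assert (HKr := qpoch_nonvanishing _ _ (2 * r) (g_k _ _ _ _ _ G)).
  clear R1 R2 R3 R4 R5 E3 E4 E5 E6 E7 EI EV EV' Hv.
  set (IA := qpoch_inf (A * q ^ S (r + d)) (q ^ 2)) in *.
  set (IB := qpoch_inf (B * q ^ S (r + d)) (q ^ 2)) in *.
  set (t1 := (- (a * q ^ r)) ^ d * tri q d) in *.
  set (t2 := (- (/ P * q ^ r)) ^ d * tri q d) in *.
  set (t3 := (- (a * P * (q ^ r * q ^ r))) ^ (2 * d) * tri q (2 * d)) in *.
  set (t4 := (- (A * q ^ r * q)) ^ n * tri (q ^ 2) n) in *.
  set (t5 := (- (B * q ^ r * q)) ^ n * tri (q ^ 2) n) in *.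
  set (c2d := qpoch (A * B * P ^ 3 * q * (q ^ r * q ^ r)) (q ^ 2) d) in *.
  set (ud := qpoch (a / s * q ^ r) q d) in *.
  set (vd := qpoch (- (a * q / s) * q ^ r) q d) in *.
  set (Qd := qpoch (q * q ^ r) q d) in *.
  set (Cd := qpoch (A * B * P ^ 3 * q * q ^ r) q d) in *.
  set (Kd := qpoch (A * B * P * q * q ^ (2 * r)) q (2 * d)) in *.
  set (u := qpoch (a / s) q r). set (v := qpoch (- (a * q / s)) q r).
  set (e := qpoch (/ P) q r). set (c2 := qpoch (A * B * P ^ 3 * q) (q ^ 2) r).
  set (D := (1 + s) * qpoch q q r * qpoch (A * B * P ^ 3 * q) q r
    * qpoch (A * B * P * q) q (2 * r)).
  assert (HD : D <> 0) by (unfold D; repeat apply Cmult_neq_0; assumption).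
  transitivity ((- q) ^ r * (- q) ^ d * (vwp a q r * (t1 * Qd) * - q ^ d)
    * (e * (t2 * Cd)) * c2 * u * v * (ud * vd * c2d * (1 + s * q ^ (r + d)))
    / (D * Qd * Cd * Kd)
    * ((qpoch A q (r + d) * IA) * (qpoch B q (r + d) * IB)
       * qpoch_inf (A * q ^ S (S (r + d)) * P ^ 2) (q ^ 2)
       * qpoch_inf (B * q ^ S (S (r + d)) * P ^ 2) (q ^ 2))).
  - rewrite E8, EA, EB.
    replace (q * (q ^ n * P)) with (q * q ^ n * P) by ring. rewrite <- HPC.
    clearbody IA IB t1 t2 t3 t4 t5 c2d ud vd Qd Cd Kd u v e c2 D.
    field. auto.
  - unfold D.
    clearbody IA IB t1 t2 t3 t4 t5 c2d ud vd Qd Cd Kd u v e c2.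
    field. repeat split; assumption.
Qed.

(** Each of the [N + 1] rows yields a pair of the [2 N + 2] terms on the right. *)
Lemma degenerate_row (r n : nat) :
  (r + n = N)%nat ->
  watson_den q A B P / qpoch_inf (A * B * P * q) q
    * csum (fun m => entry q A B P s m r) (S n)
  = right_term q A B P s r + right_term q A B P s (2 * N + 1 - r).
Proof.
  intros Hrn.
  assert (Hsmall : forall m, (m <= 2 * n)%nat -> qpoch (a * q ^ (2 * r + 1)) q m <> 0).
  { intros m Hm. apply (qpoch_below_zero q _ (2 * n)); auto.
    rewrite <- Hdeg. fold a. rewrite <- Hrn.
    replace (2 * (r + n))%nat with (2 * r + 2 * n)%nat by lia.
    rewrite !Cpow_add_r. ring. }
  assert (Har : qpoch (a * q ^ r) q r <> 0).
  { apply (qpoch_below_zero q _ (r + 2 * n + 1)); auto; [|lia].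
    rewrite <- Hdeg. fold a. rewrite <- Hrn.
    replace (2 * (r + n))%nat with (r + r + 2 * n)%nat by lia.
    rewrite !Cpow_add_r. ring. }
  rewrite (csum_ext _ (fun m => row_factor q A B P s r
    * watson_term q (A * q ^ r) (B * q ^ r) P m)).
  2:{ intros m Hm. apply entry_factor. exact G. apply Hsmall. lia. }
  rewrite csum_scal.
  assert (HW := watson_truncated_sum q (A * q ^ r) (B * q ^ r) P n Hq0 Hq HP).
  specialize (HW ltac:(rewrite <- Hdeg; rewrite <- Hrn;
    replace (2 * (r + n))%nat with (r + r + 2 * n)%nat by lia;
    rewrite !Cpow_add_r; ring)).
  specialize (HW ltac:(replace (B * q ^ r * q * P) with (B * q * P * q ^ r) by ring;
    apply nonvanishing_shift; exact (g_BP _ _ _ _ _ G))).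
  specialize (HW ltac:(replace (A * q ^ r * q * P) with (A * q * P * q ^ r) by ring;
    apply nonvanishing_shift; exact (g_AP _ _ _ _ _ G))).
  specialize (HW ltac:(replace (A * q ^ r * (B * q ^ r) * q) with (A * B * q * (q ^ 2) ^ r)
    by (rewrite Cpow_sq; ring);
    apply nonvanishing_shift; exact (g_AB _ _ _ _ _ G)) (g_qP _ _ _ _ _ G)).
  unfold watson_num in HW.
  replace (A * q ^ r * (B * q ^ r) * P * q) with (A * B * P * q * q ^ (2 * r)) in HW
    by (rewrite Cpow_double; ring).
  replace (A * q ^ r * q) with (A * q ^ S r) in HW by (rewrite Cpow_S; ring).
  replace (B * q ^ r * q) with (B * q ^ S r) in HW by (rewrite Cpow_S; ring).
  replace (A * q ^ r * q ^ 2 * P ^ 2) with (A * q ^ S (S r) * P ^ 2) in HW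
    by (rewrite (Cpow_S q (S r)), (Cpow_S q r); ring).
  replace (B * q ^ r * q ^ 2 * P ^ 2) with (B * q ^ S (S r) * P ^ 2) in HW
    by (rewrite (Cpow_S q (S r)), (Cpow_S q r); ring).
  rewrite <- (right_term_reverse r n Hrn). unfold right_term at 1.
  rewrite <- Cmult_plus_distr_l.
  apply row_sum; auto. rewrite HW. ring.
Qed.

Lemma degenerate_sum :
  csum (right_term q A B P s) (2 * S N)
  = watson_den q A B P / qpoch_inf (A * B * P * q) q * csum (left_term q A B P s) (S N).
Proof.
  rewrite csum_fold.
  rewrite (csum_ext (left_term q A B P s)
    (fun n => csum (fun r => entry q A B P s (n - r) r) (S n))).
  - rewrite csum_triangle, <- csum_scal. apply csum_ext. intros r Hr.
    replace (S N - r)%nat with (S (N - r)) by lia.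
    rewrite degenerate_row by lia. reflexivity.
  - intros n Hn. symmetry. apply diagonal_sum. exact G.
    apply (qpoch_below_zero q _ (2 * N)); auto. lia.
Qed.

Lemma degenerate_right_zero (r : nat) :
  (2 * S N <= r)%nat -> right_term q A B P s r = 0.
Proof.
  intros Hr. unfold right_term, right_coef. fold a.
  replace (vwp a q r) with (RtoC 0). unfold Cdiv. ring.
  destruct r as [|r]. lia. unfold vwp.
  rewrite (qpoch_zero _ _ r (2 * N)). ring.
  unfold a. rewrite Hdeg. ring. lia.
Qed.

Lemma degenerate_left_zero (n : nat) :
  (S N <= n)%nat -> left_term q A B P s n = 0.
Proof.
  intros Hn. unfold left_term, delta.
  rewrite (qpoch_zero (A * B * P ^ 2 * q) _ n N). unfold Cdiv. ring.
  rewrite <- Cpow_mult_r, Hdeg. ring. lia.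
Qed.

Lemma degenerate_limit :
  tends (fun M => csum (right_term q A B P s) M
    - watson_den q A B P / qpoch_inf (A * B * P * q) q * csum (left_term q A B P s) M) 0.
Proof.
  assert (H1 := sums_finite _ _ degenerate_right_zero).
  assert (H2 := sums_finite _ _ degenerate_left_zero).
  assert (H3 := tends_minus _ _ _ _ H1 (tends_scal
    (watson_den q A B P / qpoch_inf (A * B * P * q) q) _ _ H2)).
  rewrite degenerate_sum in H3.
  match type of H3 with tends _ ?l => replace l with (RtoC 0) in H3 by ring end.
  exact H3.
Qed.

End Degenerate.

(** * The two halves of the right-hand side *)

Lemma vwp_poch (l q : C) (r : nat) :
  vwp l q r * (1 - l) = qpoch l q r * (1 - l * (q ^ r * q ^ r)).
Proof.
  destruct r as [|i]. simpl. ring. unfold vwp. rewrite qpoch_S_l. ring.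
Qed.

Lemma qpoch_vwp_ratio (a sa p : C) (m : nat) :
  sa ^ 2 = a ->
  qpoch (p * sa) p m * qpoch (- (p * sa)) p m * (1 - a)
  = qpoch sa p m * qpoch (- sa) p m * (1 - a * (p ^ m * p ^ m)).
Proof.
  intros H. rewrite !qpoch_sq.
  replace ((p * sa) ^ 2) with (a * p ^ 2) by (rewrite <- H; ring). rewrite H.
  rewrite Cmult_comm, <- qpoch_S_l, qpoch_S, Cpow_sq. reflexivity.
Qed.

Lemma vwp_even (a sa q : C) (m : nat) :
  sa ^ 2 = a -> 1 - a <> 0 ->
  vwp a q (2 * m) * (qpoch sa (q ^ 2) m * qpoch (- sa) (q ^ 2) m)
  = qpoch a (q ^ 2) m * qpoch (a * q) (q ^ 2) m
    * (qpoch (q ^ 2 * sa) (q ^ 2) m * qpoch (- (q ^ 2 * sa)) (q ^ 2) m).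
Proof.
  intros H Ha. apply (Cmult_eq_l _ _ _ Ha).
  assert (H1 := vwp_poch a q (2 * m)). assert (H2 := qpoch_vwp_ratio a sa (q ^ 2) m H).
  rewrite <- Cpow_mult_r in H2. rewrite qpoch_even in H1.
  transitivity (vwp a q (2 * m) * (1 - a) * (qpoch sa (q ^ 2) m * qpoch (- sa) (q ^ 2) m)).
  ring. rewrite H1.
  transitivity (qpoch a (q ^ 2) m * qpoch (a * q) (q ^ 2) m
    * (qpoch sa (q ^ 2) m * qpoch (- sa) (q ^ 2) m * (1 - a * (q ^ (2 * m) * q ^ (2 * m))))).
  ring. rewrite <- H2. ring.
Qed.

(** This is how the parameters that occur with both signs recombine, for
    example those with [sqrt (q/k)] and [sqrt (q^3/k)]: the pair of [u] and [-u]
    gives the even factors, the pair of [v] and [-v] the odd ones. *)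
Lemma qpoch_four (x u v q : C) (m : nat) :
  u ^ 2 = x -> v ^ 2 = x * q ^ 2 ->
  qpoch x (q ^ 2) (2 * m) = qpoch u (q ^ 2) m * qpoch (- u) (q ^ 2) m
    * (qpoch v (q ^ 2) m * qpoch (- v) (q ^ 2) m).
Proof. intros Hu Hv. rewrite qpoch_even, !qpoch_sq, Hu, Hv. reflexivity. Qed.

Lemma right_term_even (q a b k sk r1 r3 sa : C) (m : nat) :
  q <> 0 -> a <> 0 -> b <> 0 -> k <> 0 -> (Cmod q < 1)%R ->
  sk ^ 2 = k -> r1 ^ 2 = q / k -> r3 ^ 2 = q ^ 3 / k -> sa ^ 2 = a ->
  generic q (k ^ 2 / (a * b)) b (a / k) sk ->
  W_admissible a sa (W1_params q a b k sk r1 r3) (q ^ 2) (q ^ 2) ->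
  qpochs_inf [k ^ 2 * q / (a * b); b * q; a ^ 2 * b * q ^ 2 / k ^ 2;
                q ^ 2 * a / b] (q ^ 2)
    * phi_term (W_upper a sa (W1_params q a b k sk r1 r3) (q ^ 2))
        (W_lower a sa (W1_params q a b k sk r1 r3) (q ^ 2)) (q ^ 2) (q ^ 2) m
  = right_term q (k ^ 2 / (a * b)) b (a / k) sk (2 * m).
Proof.
  intros Hq Ha Hb Hk Hq1 Hsk Hr1 Hr3 Hsa G [Hnz _].
  assert (Hq2 := Cmod_sq_lt1 q Hq1).
  assert (Hs : sk <> 0) by (intros H; apply Hk; rewrite <- Hsk, H; ring).
  assert (Hs1 := generic_1s _ _ _ _ _ G). assert (Hsr := generic_1sq _ _ _ _ _ G (2 * m)).
  assert (Ha1 : 1 - a <> 0).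
  { assert (H := generic_1a _ _ _ _ _ G).
    replace (k ^ 2 / (a * b) * b * (a / k) ^ 2) with a in H by (field; auto). exact H. }
  assert (Hr10 : r1 <> 0).
  { intros H. apply Hq. replace q with (r1 ^ 2 * k) by (rewrite Hr1; field; auto).
    rewrite H. ring. }
  assert (Hr30 : r3 <> 0).
  { intros H. apply (Cpow_nz q 3 Hq).
    replace (q ^ 3) with (r3 ^ 2 * k) by (rewrite Hr3; field; auto).
    rewrite H. ring. }
  unfold phi_term, qpochs, qpochs_inf, W_upper, W_lower, W1_params in *.
  cbn [map Cprod fold_right] in *.
  unfold no_zero_factor in Hnz. cbn [In] in Hnz.
  assert (HL : forall x, (q ^ 2 = x \/ sa = x \/ - sa = x
    \/ In x (map (fun c => a * q ^ 2 / c) (W1_params q a b k sk r1 r3))) ->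
    qpoch x (q ^ 2) m <> 0).
  { intros x Hx. apply qpoch_nonvanishing. intros j. apply Hnz. exact Hx. }
  cbn [map W1_params In] in HL.
  unfold right_term, right_coef.
  replace (k ^ 2 / (a * b) * b * (a / k) ^ 2) with a by (field; auto).
  replace (k ^ 2 / (a * b) * b * (a / k) ^ 3 * q) with (a ^ 2 * q / k) by (field; auto).
  replace (k ^ 2 / (a * b) * b * (a / k) * q) with (k * q) by (field; auto).
  replace (/ (a / k)) with (k / a) by (field; auto).
  replace (a * q ^ 2 / (k ^ 2 / (a * b))) with (a ^ 2 * b * q ^ 2 / k ^ 2) in * by (field; auto).
  replace (a * q ^ 2 / b) with (q ^ 2 * a / b) in * by (unfold Cdiv; ring).
  replace (a * q ^ 2 / (a * q)) with q in * by (field; auto).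
  replace (a * q ^ 2 / (k * q / a)) with (a ^ 2 * q / k) in * by (field; auto).
  replace (a * q ^ 2 / (k / a)) with (a ^ 2 * q / k * q) in * by (field; auto).
  replace (a * q ^ 2 / (a * r1)) with (q ^ 2 / r1) in * by (field; auto).
  replace (a * q ^ 2 / - (a * r1)) with (- (q ^ 2 / r1)) in * by (field; auto).
  replace (a * q ^ 2 / (a * r3)) with (q ^ 2 / r3) in * by (field; auto).
  replace (a * q ^ 2 / - (a * r3)) with (- (q ^ 2 / r3)) in * by (field; auto).
  replace (a * q ^ 2 / (a / sk)) with (sk * q * q) in * by (field; auto).
  replace (a * q ^ 2 / (a * q / sk)) with (sk * q) in * by (field; auto).
  replace (a * q ^ 2 / - (a * q / sk)) with (- sk * q) in * by (field; auto).
  replace (a * q ^ 2 / - (a * q ^ 2 / sk)) with (- sk) in * by (field; auto).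
  assert (EV := vwp_even a sa q m Hsa Ha1).
  assert (EU := qpoch_four (a ^ 2 * q / k) (a * r1) (a * r3) q m
    ltac:(replace ((a * r1) ^ 2) with (a ^ 2 * r1 ^ 2) by ring; rewrite Hr1; field; auto)
    ltac:(replace ((a * r3) ^ 2) with (a ^ 2 * r3 ^ 2) by ring; rewrite Hr3; field; auto)).
  assert (EK0 := qpoch_four (k * q) (q ^ 2 / r3) (q ^ 2 / r1) q m
    ltac:(transitivity (q ^ 4 / r3 ^ 2); [field; auto | rewrite Hr3; field; auto])
    ltac:(transitivity (q ^ 4 / r1 ^ 2); [field; auto | rewrite Hr1; field; auto])).
  assert (EK : qpoch (k * q) q (2 * (2 * m)) * (1 + sk) = (1 + sk * q ^ (2 * m))
    * (qpoch (k * q) (q ^ 2) (2 * m) * (qpoch (sk * q) (q ^ 2) m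
       * qpoch (sk * q * q) (q ^ 2) m * (qpoch (- sk) (q ^ 2) m
       * qpoch (- sk * q) (q ^ 2) m)))).
  { rewrite (qpoch_even (k * q)). replace (k * q * q) with ((sk * q) ^ 2)
      by (rewrite <- Hsk; ring).
    rewrite <- (qpoch_sq (sk * q)), <- (qpoch_even (sk * q)), <- (qpoch_even (- sk)).
    transitivity (qpoch (k * q) (q ^ 2) (2 * m) * qpoch (sk * q) q (2 * m)
      * ((1 - - sk) * qpoch (- sk * q) q (2 * m))).
    replace (- (sk * q)) with (- sk * q) by ring. ring.
    rewrite <- qpoch_S_l, qpoch_S. ring. }
  rewrite EK0 in EK.
  rewrite EU, (qpoch_even (k / a)), (qpoch_even (a / sk)), (qpoch_even (- (a * q / sk))),
    (qpoch_even (k ^ 2 / (a * b))), (qpoch_even b), (qpoch_even q), (qpoch_even (a ^ 2 * q / k)).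
  replace (k / a * q) with (k * q / a) by (unfold Cdiv; ring).
  replace (a / sk * q) with (a * q / sk) by (unfold Cdiv; ring).
  replace (- (a * q / sk) * q) with (- (a * q ^ 2 / sk)) by (unfold Cdiv; ring).
  replace (k ^ 2 / (a * b) * q) with (k ^ 2 * q / (a * b)) by (unfold Cdiv; ring).
  replace (q * q) with (q ^ 2) by ring.
  rewrite (qpoch_inf_split (k ^ 2 * q / (a * b)) (q ^ 2) m),
    (qpoch_inf_split (b * q) (q ^ 2) m), (qpoch_inf_split (a ^ 2 * b * q ^ 2 / k ^ 2) (q ^ 2) m),
    (qpoch_inf_split (q ^ 2 * a / b) (q ^ 2) m) by exact Hq2.
  rewrite <- !Cpow_mult_r, !(Cpow_S q (S (2 * m))), !(Cpow_S q (2 * m)).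
  replace (k ^ 2 * q / (a * b) * q ^ (2 * m)) with (k ^ 2 / (a * b) * (q * q ^ (2 * m)))
    by (unfold Cdiv; ring).
  replace (b * q * q ^ (2 * m)) with (b * (q * q ^ (2 * m))) by ring.
  replace (b * (q * (q * q ^ (2 * m))) * (a / k) ^ 2)
    with (a ^ 2 * b * q ^ 2 / k ^ 2 * q ^ (2 * m)) by (field; auto).
  replace (k ^ 2 / (a * b) * (q * (q * q ^ (2 * m))) * (a / k) ^ 2)
    with (q ^ 2 * a / b * q ^ (2 * m)) by (field; auto).
  replace ((- q) ^ (2 * m)) with (q ^ (2 * m))
    by (rewrite !Cpow_mult_r; f_equal; ring).
  assert (H2 : qpoch sa (q ^ 2) m <> 0) by (apply HL; tauto).
  assert (H3 : qpoch (- sa) (q ^ 2) m <> 0) by (apply HL; tauto).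
  clear Hnz EU EK0.
  assert (EV' := Cdiv_of_mult _ _ _ (Cmult_neq_0 _ _ H2 H3) EV).
  assert (EK' := Cdiv_of_mult _ _ _ Hs1 EK).
  rewrite EV', EK'. clear EV EK EV' EK'.
  field. repeat split; first [assumption | apply HL; tauto].
Qed.

Lemma right_term_odd (q a b k sk r3 r5 saq2 : C) (m : nat) :
  q <> 0 -> a <> 0 -> b <> 0 -> k <> 0 -> (Cmod q < 1)%R ->
  sk ^ 2 = k -> r3 ^ 2 = q ^ 3 / k -> r5 ^ 2 = q ^ 5 / k -> saq2 ^ 2 = a * q ^ 2 ->
  generic q (k ^ 2 / (a * b)) b (a / k) sk ->
  (1 - q) * (1 - k * q) * (1 - sk * q) * (1 + sk) <> 0 ->
  W_admissible (a * q ^ 2) saq2 (W2_params q a b k sk r3 r5) (q ^ 2) (q ^ 2) ->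
  - (q * ((1 - a * q ^ 2) * (1 - k / a) * (1 - a / sk) * (1 + a * q / sk)
           / ((1 - q) * (1 - k * q) * (1 - sk * q) * (1 + sk))))
    * qpochs_inf [k ^ 2 / (a * b); b; a ^ 2 * b * q ^ 3 / k ^ 2; q ^ 3 * a / b] (q ^ 2)
    * phi_term (W_upper (a * q ^ 2) saq2 (W2_params q a b k sk r3 r5) (q ^ 2))
        (W_lower (a * q ^ 2) saq2 (W2_params q a b k sk r3 r5) (q ^ 2)) (q ^ 2) (q ^ 2) m
  = right_term q (k ^ 2 / (a * b)) b (a / k) sk (S (2 * m)).
Proof.
  intros Hq Ha Hb Hk Hq1 Hsk Hr3 Hr5 Hsa G Hden [Hnz _].
  assert (Hq2 := Cmod_sq_lt1 q Hq1).
  assert (Hs : sk <> 0) by (intros H; apply Hk; rewrite <- Hsk, H; ring).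
  assert (Hs1 := generic_1s _ _ _ _ _ G).
  assert (Hsr := generic_1sq _ _ _ _ _ G (S (2 * m))).
  assert (N1 := Cmult_neq0_l _ _ (Cmult_neq0_l _ _ (Cmult_neq0_l _ _ Hden))).
  assert (N2 := Cmult_neq0_r _ _ (Cmult_neq0_l _ _ (Cmult_neq0_l _ _ Hden))).
  assert (N3 := Cmult_neq0_r _ _ (Cmult_neq0_l _ _ Hden)).
  assert (N4 : 1 - a ^ 2 * q / k <> 0).
  { assert (H := g_aP _ _ _ _ _ G 0%nat).
    replace (k ^ 2 / (a * b) * b * (a / k) ^ 3 * q * q ^ 0) with (a ^ 2 * q / k) in H
      by (field; auto). exact H. }
  assert (Hr30 : r3 <> 0).
  { intros H. apply (Cpow_nz q 3 Hq).
    replace (q ^ 3) with (r3 ^ 2 * k) by (rewrite Hr3; field; auto).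
    rewrite H. ring. }
  assert (Hr50 : r5 <> 0).
  { intros H. apply (Cpow_nz q 5 Hq).
    replace (q ^ 5) with (r5 ^ 2 * k) by (rewrite Hr5; field; auto).
    rewrite H. ring. }
  unfold phi_term, qpochs, qpochs_inf, W_upper, W_lower, W2_params in *.
  cbn [map Cprod fold_right] in *.
  unfold no_zero_factor in Hnz. cbn [In] in Hnz.
  assert (HL : forall x, (q ^ 2 = x \/ saq2 = x \/ - saq2 = x
    \/ In x (map (fun c => a * q ^ 2 * q ^ 2 / c) (W2_params q a b k sk r3 r5))) ->
    qpoch x (q ^ 2) m <> 0).
  { intros x Hx. apply qpoch_nonvanishing. intros j. apply Hnz. exact Hx. }
  cbn [map W2_params In] in HL.
  unfold right_term, right_coef.
  replace (k ^ 2 / (a * b) * b * (a / k) ^ 2) with a by (field; auto).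
  replace (k ^ 2 / (a * b) * b * (a / k) ^ 3 * q) with (a ^ 2 * q / k) by (field; auto).
  replace (k ^ 2 / (a * b) * b * (a / k) * q) with (k * q) by (field; auto).
  replace (/ (a / k)) with (k / a) by (field; auto).
  replace (a * q ^ 2 * q ^ 2 / (k ^ 2 * q / (a * b))) with (a ^ 2 * b * q ^ 3 / k ^ 2) in *
    by (field; auto).
  replace (a * q ^ 2 * q ^ 2 / (b * q)) with (q ^ 3 * a / b) in * by (field; auto).
  replace (a * q ^ 2 * q ^ 2 / (a * q)) with (q * q * q) in * by (field; auto).
  replace (a * q ^ 2 * q ^ 2 / (k * q / a)) with (a ^ 2 * q / k * q * q) in * by (field; auto).
  replace (a * q ^ 2 * q ^ 2 / (k * q ^ 2 / a)) with (a ^ 2 * q / k * q) in * by (field; auto).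
  replace (a * q ^ 2 * q ^ 2 / (a * r3)) with (q ^ 4 / r3) in * by (field; auto).
  replace (a * q ^ 2 * q ^ 2 / - (a * r3)) with (- (q ^ 4 / r3)) in * by (field; auto).
  replace (a * q ^ 2 * q ^ 2 / (a * r5)) with (q ^ 4 / r5) in * by (field; auto).
  replace (a * q ^ 2 * q ^ 2 / - (a * r5)) with (- (q ^ 4 / r5)) in * by (field; auto).
  replace (a * q ^ 2 * q ^ 2 / (a * q / sk)) with (sk * q * q * q) in * by (field; auto).
  replace (a * q ^ 2 * q ^ 2 / (a * q ^ 2 / sk)) with (sk * q * q) in * by (field; auto).
  replace (a * q ^ 2 * q ^ 2 / - (a * q ^ 2 / sk)) with (- (sk * q) * q) in * by (field; auto).
  replace (a * q ^ 2 * q ^ 2 / - (a * q ^ 3 / sk)) with (- (sk * q)) in * by (field; auto).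
  assert (EV : vwp a q (S (2 * m)) * (qpoch saq2 (q ^ 2) m * qpoch (- saq2) (q ^ 2) m)
    = (1 - a * q ^ 2) * (qpoch (a * q) (q ^ 2) m * qpoch (a * q * q) (q ^ 2) m)
      * (qpoch (q ^ 2 * saq2) (q ^ 2) m * qpoch (- (q ^ 2 * saq2)) (q ^ 2) m)).
  { assert (H := qpoch_vwp_ratio (a * q ^ 2) saq2 (q ^ 2) m Hsa).
    rewrite <- Cpow_mult_r in H. unfold vwp. rewrite qpoch_even, (Cpow_S q (2 * m)).
    transitivity (qpoch (a * q) (q ^ 2) m * qpoch (a * q * q) (q ^ 2) m
      * (qpoch saq2 (q ^ 2) m * qpoch (- saq2) (q ^ 2) m
         * (1 - a * q ^ 2 * (q ^ (2 * m) * q ^ (2 * m))))). ring.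
    rewrite <- H. ring. }
  assert (EU := qpoch_four (a ^ 2 * q / k * q ^ 2) (a * r3) (a * r5) q m
    ltac:(replace ((a * r3) ^ 2) with (a ^ 2 * r3 ^ 2) by ring; rewrite Hr3; field; auto)
    ltac:(replace ((a * r5) ^ 2) with (a ^ 2 * r5 ^ 2) by ring; rewrite Hr5; field; auto)).
  assert (EK0 := qpoch_four (k * q * q ^ 2) (q ^ 4 / r5) (q ^ 4 / r3) q m
    ltac:(transitivity (q ^ 8 / r5 ^ 2); [field; auto | rewrite Hr5; field; auto])
    ltac:(transitivity (q ^ 8 / r3 ^ 2); [field; auto | rewrite Hr3; field; auto])).
  assert (EK : qpoch (k * q) q (2 * S (2 * m)) = (1 - k * q)
    * qpoch (k * q * q ^ 2) (q ^ 2) (2 * m)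
    * ((1 - sk * q) * (qpoch (sk * q * q) (q ^ 2) m * qpoch (sk * q * q * q) (q ^ 2) m))
    * (qpoch (- (sk * q)) (q ^ 2) m * qpoch (- (sk * q) * q) (q ^ 2) m
       * (1 + sk * q ^ S (2 * m)))).
  { rewrite (qpoch_even (k * q)). replace (k * q * q) with ((sk * q) ^ 2)
      by (rewrite <- Hsk; ring).
    rewrite <- (qpoch_sq (sk * q)), (qpoch_S_l (k * q)), (qpoch_S_l (sk * q)),
      (qpoch_S (- (sk * q))), !qpoch_even, (Cpow_S q (2 * m)). ring. }
  rewrite EK0 in EK.
  rewrite (qpoch_S_l (a ^ 2 * q / k) (q ^ 2)), EU, EK,
    (qpoch_S_l (k / a)), (qpoch_S_l (a / sk)), (qpoch_S_l (- (a * q / sk))),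
    (qpoch_S_l (k ^ 2 / (a * b))), (qpoch_S_l b), (qpoch_S_l q), (qpoch_S_l (a ^ 2 * q / k)).
  rewrite (qpoch_even (k / a * q)), (qpoch_even (a / sk * q)), (qpoch_even (- (a * q / sk) * q)),
    (qpoch_even (k ^ 2 / (a * b) * q)), (qpoch_even (b * q)), (qpoch_even (q * q)),
    (qpoch_even (a ^ 2 * q / k * q)).
  replace (k / a * q * q) with (k * q ^ 2 / a) by (unfold Cdiv; ring).
  replace (k / a * q) with (k * q / a) by (unfold Cdiv; ring).
  replace (a / sk * q * q) with (a * q ^ 2 / sk) by (unfold Cdiv; ring).
  replace (a / sk * q) with (a * q / sk) by (unfold Cdiv; ring).
  replace (- (a * q / sk) * q * q) with (- (a * q ^ 3 / sk)) by (unfold Cdiv; ring).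
  replace (- (a * q / sk) * q) with (- (a * q ^ 2 / sk)) by (unfold Cdiv; ring).
  replace (k ^ 2 / (a * b) * q * q) with (k ^ 2 / (a * b) * q ^ 2) by ring.
  replace (k ^ 2 / (a * b) * q) with (k ^ 2 * q / (a * b)) by (unfold Cdiv; ring).
  replace (b * q * q) with (b * q ^ 2) by ring.
  replace (a * q * q) with (a * q ^ 2) in EV by ring.
  rewrite (qpoch_inf_split (k ^ 2 / (a * b)) (q ^ 2) (S m)),
    (qpoch_inf_split b (q ^ 2) (S m)), (qpoch_inf_split (a ^ 2 * b * q ^ 3 / k ^ 2) (q ^ 2) m),
    (qpoch_inf_split (q ^ 3 * a / b) (q ^ 2) m) by exact Hq2.
  rewrite (qpoch_S_l (k ^ 2 / (a * b)) (q ^ 2)), (qpoch_S_l b (q ^ 2)), (Cpow_S (q ^ 2) m).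
  rewrite <- !Cpow_mult_r, !(Cpow_S q (S (S (2 * m)))), !(Cpow_S q (S (2 * m))),
    !(Cpow_S q (2 * m)) in *.
  replace (k ^ 2 / (a * b) * (q ^ 2 * q ^ (2 * m)))
    with (k ^ 2 / (a * b) * (q * (q * q ^ (2 * m)))) by ring.
  replace (b * (q ^ 2 * q ^ (2 * m))) with (b * (q * (q * q ^ (2 * m)))) by ring.
  replace (b * (q * (q * (q * q ^ (2 * m)))) * (a / k) ^ 2)
    with (a ^ 2 * b * q ^ 3 / k ^ 2 * q ^ (2 * m)) by (field; auto).
  replace (k ^ 2 / (a * b) * (q * (q * (q * q ^ (2 * m)))) * (a / k) ^ 2)
    with (q ^ 3 * a / b * q ^ (2 * m)) by (field; auto).
  rewrite (Cpow_S (- q)).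
  replace ((- q) ^ (2 * m)) with (q ^ (2 * m))
    by (rewrite !Cpow_mult_r; f_equal; ring).
  replace (q * q) with (q ^ 2) by ring.
  replace (q * q * q) with (q ^ 2 * q) in HL by ring.
  assert (H2 : qpoch saq2 (q ^ 2) m <> 0) by (apply HL; tauto).
  assert (H3 : qpoch (- saq2) (q ^ 2) m <> 0) by (apply HL; tauto).
  clear Hnz EU EK EK0.
  assert (EV' := Cdiv_of_mult _ _ _ (Cmult_neq_0 _ _ H2 H3) EV).
  rewrite EV'. clear EV EV'.
  assert (N5 : k - a ^ 2 * q <> 0).
  { replace (k - a ^ 2 * q) with (k * (1 - a ^ 2 * q / k)) by (field; auto).
    now apply Cmult_neq_0. }
  field. repeat split; first [assumption | apply HL; tauto].
Qed.

(** * The three series of the theorem *)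
Lemma Cmod_div_ge (x y : C) (lo hi : R) :
  (0 <= lo)%R -> (0 < hi)%R -> (lo <= Cmod x)%R -> y <> 0 -> (Cmod y <= hi)%R ->
  (lo / hi <= Cmod (x / y))%R.
Proof.
  intros Hlo Hhi Hx Hy Hyh. apply Cmod_gt_0 in Hy as Hy'.
  unfold Cdiv. rewrite Cmod_mult, Cmod_inv by exact Hy.
  unfold Rdiv. apply Rmult_le_compat; auto.
  left. now apply Rinv_0_lt_compat. now apply Rinv_le_contravar.
Qed.

(** If no factor of the numerators vanishes then the terms are of the exact
    order [(q P)^n], so that convergence forces [|q P| < 1]. *)
Lemma left_term_convergent (q A B P s : C) :
  generic q A B P s -> nonvanishing (A * B * P ^ 2 * q) (q ^ 2) ->
  abs_convergent (left_term q A B P s) -> watson_convergent q A B P.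
Proof.
  intros G Hodd Habs.
  assert (Hq0 := g_q _ _ _ _ _ G). assert (Hq := g_q1 _ _ _ _ _ G).
  assert (HP := g_P _ _ _ _ _ G). assert (Hq2 := Cmod_sq_lt1 q Hq).
  destruct (classic (terminating q A B)) as [Ht|Ht]. now right. left.
  assert (HA : nonvanishing A q) by (intros j H; apply Ht; exists j; now left).
  assert (HB : nonvanishing B q) by (intros j H; apply Ht; exists j; now right).
  destruct (classic (nonvanishing ((/ P) ^ 2) q)) as [HE|HE].
  - apply Rnot_le_lt. intros Hz.
    destruct (qpoch_lower0 _ _ Hq HA) as [l1 [Hl1 H1]].
    destruct (qpoch_lower0 _ _ Hq HB) as [l2 [Hl2 H2]].
    destruct (qpoch_lower0 _ _ Hq HE) as [l3 [Hl3 H3]].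
    destruct (qpoch_lower0 _ _ Hq2 Hodd) as [l4 [Hl4 H4]].
    destruct (qpoch_lower _ _ Hq (g_ms _ _ _ _ _ G)) as [l5 [Hl5 H5]].
    assert (Hs1 := generic_1s _ _ _ _ _ G). assert (Hs1' := proj1 (Cmod_gt_0 _) Hs1).
    set (h1 := poch_bound q q). set (h2 := poch_bound (B * q * P) q).
    set (h3 := poch_bound (A * q * P) q). set (h4 := poch_bound (A * B * q) (q ^ 2)).
    assert (P1 : (0 < h1)%R) by apply poch_bound_pos.
    assert (P2 : (0 < h2)%R) by apply poch_bound_pos.
    assert (P3 : (0 < h3)%R) by apply poch_bound_pos.
    assert (P4 : (0 < h4)%R) by apply poch_bound_pos.
    set (c := (l3 * l5 / (h1 * Cmod (1 + s)) * (l1 * l2 * l4 * 1 / (h2 * h3 * h4)))%R).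
    assert (Hc : (0 < c)%R).
    { unfold c. repeat apply Rmult_lt_0_compat; try lra; try assumption;
      apply Rinv_0_lt_compat; repeat apply Rmult_lt_0_compat; assumption. }
    assert (Hlow : forall n, (c <= Cmod (left_term q A B P s n))%R).
    { intros n. unfold left_term, delta, c.
      assert (Hb := nonvanishing_base q Hq).
      apply Cmod_mult_ge.
      - left. repeat apply Rmult_lt_0_compat; try assumption;
        apply Rinv_0_lt_compat; repeat apply Rmult_lt_0_compat; assumption.
      - left. repeat apply Rmult_lt_0_compat; try lra; try assumption;
        apply Rinv_0_lt_compat; repeat apply Rmult_lt_0_compat; assumption.
      - apply Cmod_div_ge.
        + left. now apply Rmult_lt_0_compat.
        + now apply Rmult_lt_0_compat.
        + apply Cmod_mult_ge; try (left; assumption). apply H3.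
          specialize (H5 n 1%nat). simpl in H5.
          replace (1 + s * q ^ n) with (1 * (1 - - s * q ^ n * 1)) by ring. exact H5.
        + apply Cmult_neq_0. now apply qpoch_nonvanishing. exact Hs1.
        + apply Cmod_mult_le. now apply qpoch_upper. lra.
      - apply Cmod_div_ge.
        + left. repeat apply Rmult_lt_0_compat; lra.
        + repeat apply Rmult_lt_0_compat; assumption.
        + repeat apply Cmod_mult_ge; try (left; repeat apply Rmult_lt_0_compat; assumption);
          try lra; auto.
          rewrite Cmod_pow, Cmod_opp. now apply pow_R1_Rle.
        + repeat apply Cmult_neq_0; apply qpoch_nonvanishing.
          exact (g_BP _ _ _ _ _ G). exact (g_AP _ _ _ _ _ G). exact (g_AB _ _ _ _ _ G).
        + repeat apply Cmod_mult_le; now apply qpoch_upper. }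
    assert (Hlim := ex_series_lim_0 _ Habs).
    apply is_lim_seq_spec in Hlim. destruct (Hlim (mkposreal _ Hc)) as [N HN].
    specialize (HN N (Nat.le_refl _)). simpl in HN.
    rewrite Rminus_0_r, Rabs_pos_eq in HN by apply Cmod_ge_0.
    specialize (Hlow N). lra.
  - (* a vanishing numerator factor makes P^2 a power of q *)
    assert (Hj : exists j, 1 - (/ P) ^ 2 * q ^ j = 0).
    { apply NNPP. intros H. apply HE. intros j H0. apply H. now exists j. }
    destruct Hj as [j Hj].
    assert (HP2 : P ^ 2 = q ^ j).
    { transitivity (P ^ 2 * (1 - (/ P) ^ 2 * q ^ j) + q ^ j).
      field. exact HP. rewrite Hj. ring. }
    assert (H1 := Cmod_pow_le1 q j Hq). rewrite <- HP2, Cmod_pow in H1.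
    assert (H2 := Cmod_ge_0 P). assert (H3 := Cmod_ge_0 q).
    rewrite Cmod_mult. simpl in H1. nra.
Qed.

Lemma phi_term_left (q a b k sk sqa sq_a : C) (n : nat) :
  q <> 0 -> a <> 0 -> b <> 0 -> k <> 0 ->
  sqa ^ 2 = q * a -> sq_a ^ 2 = q / a ->
  generic q (k ^ 2 / (a * b)) b (a / k) sk ->
  phi_term (phi65_upper q a b k sk sqa) (phi65_lower q a b k sk sq_a)
    q (- (q * a / k)) n
  = left_term q (k ^ 2 / (a * b)) b (a / k) sk n.
Proof.
  intros Hq Ha Hb Hk H1 H2 G.
  unfold phi_term, qpochs, phi65_upper, phi65_lower, left_term, delta.
  cbn [map Cprod fold_right].
  assert (N1 := qpoch_nonvanishing _ _ n (g_ms _ _ _ _ _ G)).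
  assert (Hs1 := generic_1s _ _ _ _ _ G).
  assert (E1 : qpoch (- (q * sk)) q n = qpoch (- sk) q n * (1 + sk * q ^ n) / (1 + sk)).
  { apply Cdiv_of_mult. exact Hs1.
    transitivity ((1 - - sk) * qpoch (- sk * q) q n).
    replace (- sk * q) with (- (q * sk)) by ring. ring.
    rewrite <- qpoch_S_l, qpoch_S. ring. }
  assert (E2 := qpoch_sq sqa q n). rewrite H1 in E2.
  assert (E3 := qpoch_sq (k * sq_a) q n).
  replace ((k * sq_a) ^ 2) with (k ^ 2 / (a * b) * b * q) in E3.
  2:{ replace ((k * sq_a) ^ 2) with (k ^ 2 * sq_a ^ 2) by ring. rewrite H2. field. auto. }
  replace (k ^ 2 / (a * b) * b * (a / k) ^ 2 * q) with (q * a) by (field; auto).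
  rewrite <- E2, <- E3, E1.
  replace (b * q * (a / k)) with (q * a * b / k) by (field; auto).
  replace (k ^ 2 / (a * b) * q * (a / k)) with (q * k / b) by (field; auto).
  replace ((/ (a / k)) ^ 2) with (k ^ 2 / a ^ 2) by (field; auto).
  replace (- (q * (a / k))) with (- (q * a / k)) by (unfold Cdiv; ring).
  assert (N2 := qpoch_nonvanishing _ _ n (nonvanishing_base q (g_q1 _ _ _ _ _ G))).
  set (d1 := qpoch (q * a * b / k) q n). set (d2 := qpoch (q * k / b) q n).
  set (d3 := qpoch (k * sq_a) q n). set (d4 := qpoch (- (k * sq_a)) q n).
  set (g1 := qpoch (k ^ 2 / (a * b)) q n). set (g2 := qpoch (k ^ 2 / a ^ 2) q n).
  set (z := (- (q * a / k)) ^ n). set (t := qpoch (- sk) q n) in *.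
  unfold Cdiv. rewrite !Cinv_mult.
  replace (/ RtoC 1) with (RtoC 1) by (field; apply C1_nz).
  match goal with |- _ = ?r => transitivity (t * / t * r) end.
  ring. rewrite Cinv_r by exact N1. ring.
Qed.

Lemma sums_halves (u v w : nat -> C) (L1 L2 : C) :
  (forall m, v m = u (2 * m)%nat) -> (forall m, w m = u (S (2 * m))) ->
  sums v L1 -> sums w L2 -> tends (fun n => csum u (2 * n)) (L1 + L2).
Proof.
  intros Hv Hw H1 H2.
  apply (tends_ext (fun n => csum v n + csum w n)); [|now apply tends_plus].
  induction n as [|n IH]. simpl; ring.
  replace (2 * S n)%nat with (S (S (2 * n))) by lia.
  rewrite !csum_S, <- IH, Hv, Hw. ring.
Qed.

Theorem corollary3 :
  forall q a b k : C,
  q <> 0 -> a <> 0 -> b <> 0 -> k <> 0 -> (Cmod q < 1)%R ->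
  forall sk sqa sq_a r1 r3 r5 sa saq2 : C,
  sk ^ 2 = k -> sqa ^ 2 = q * a -> sq_a ^ 2 = q / a ->
  r1 ^ 2 = q / k -> r3 ^ 2 = q ^ 3 / k -> r5 ^ 2 = q ^ 5 / k ->
  sa ^ 2 = a -> saq2 ^ 2 = a * q ^ 2 ->
  no_zero_factor [k * q; q * a / k] q ->
  (1 - q) * (1 - k * q) * (1 - sk * q) * (1 + sk) <> 0 ->
  phi_admissible (phi65_upper q a b k sk sqa) (phi65_lower q a b k sk sq_a)
    q (- (q * a / k)) ->
  W_admissible a sa (W1_params q a b k sk r1 r3) (q ^ 2) (q ^ 2) ->
  W_admissible (a * q ^ 2) saq2 (W2_params q a b k sk r3 r5) (q ^ 2) (q ^ 2) ->
  qpochs_inf [q * a * b / k; k * q / b] q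
    * qpochs_inf [q; k ^ 2 * q / a; q ^ 2 * a; q ^ 2 * a ^ 2 / k ^ 2] (q ^ 2)
    / qpochs_inf [k * q; q * a / k] q
    * phi (phi65_upper q a b k sk sqa) (phi65_lower q a b k sk sq_a)
        q (- (q * a / k))
  = qpochs_inf [k ^ 2 * q / (a * b); b * q; a ^ 2 * b * q ^ 2 / k ^ 2;
                q ^ 2 * a / b] (q ^ 2)
      * W a sa (W1_params q a b k sk r1 r3) (q ^ 2) (q ^ 2)
    - q * ((1 - a * q ^ 2) * (1 - k / a) * (1 - a / sk) * (1 + a * q / sk)
           / ((1 - q) * (1 - k * q) * (1 - sk * q) * (1 + sk)))
      * qpochs_inf [k ^ 2 / (a * b); b; a ^ 2 * b * q ^ 3 / k ^ 2;
                    q ^ 3 * a / b] (q ^ 2)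
      * W (a * q ^ 2) saq2 (W2_params q a b k sk r3 r5) (q ^ 2) (q ^ 2).
Proof.
  intros q a b k Hq Ha Hb Hk Hq1 sk sqa sq_a r1 r3 r5 sa saq2
    Hsk Hsqa Hsq_a Hr1 Hr3 Hr5 Hsa Hsaq2 Hkq Hden Hphi HW1 HW2.
  assert (HP0 : a / k <> 0).
  { intros H. apply Ha. replace a with (a / k * k) by (field; auto). rewrite H. ring. }
  assert (HA0 : k ^ 2 / (a * b) <> 0).
  { intros H. apply (Cpow_nz k 2 Hk).
    replace (k ^ 2) with (k ^ 2 / (a * b) * (a * b)) by (field; auto). rewrite H. ring. }
  assert (HnW1 := proj1 HW1). assert (HnW2 := proj1 HW2).
  unfold no_zero_factor in Hkq. cbn [In] in Hkq.
  assert (HnP1 : forall x, In x (q :: phi65_lower q a b k sk sq_a) -> nonvanishing x q)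
    by (intros x Hx j; now apply (proj1 Hphi)).
  assert (HnW : forall x, In x (q ^ 2 :: W_lower a sa (W1_params q a b k sk r1 r3) (q ^ 2)) ->
    nonvanishing x (q ^ 2)) by (intros x Hx j; now apply HnW1).
  assert (HnW' : forall x, In x (q ^ 2 :: W_lower (a * q ^ 2) saq2
    (W2_params q a b k sk r3 r5) (q ^ 2)) -> nonvanishing x (q ^ 2))
    by (intros x Hx j; now apply HnW2).
  unfold phi65_lower, W_lower, W1_params, W2_params in HnP1, HnW, HnW'.
  cbn [map In] in HnP1, HnW, HnW'.
  assert (Hsplit : forall x y p, x ^ 2 = y -> nonvanishing x p -> nonvanishing (- x) p ->
    nonvanishing y (p ^ 2)).
  { intros x y p Hxy Hx Hx' j. rewrite <- Hxy, Cpow_sq.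
    replace (1 - x ^ 2 * (p ^ j * p ^ j)) with ((1 - x * p ^ j) * (1 - - x * p ^ j)) by ring.
    now apply Cmult_neq_0. }
  assert (G : generic q (k ^ 2 / (a * b)) b (a / k) sk).
  { constructor; auto.
    - rewrite Hsk. field. auto.
    - replace (k ^ 2 / (a * b) * b * (a / k) ^ 2) with a by (field; auto).
      apply nonvanishing_even_odd.
      + apply (Hsplit sa); auto; apply HnW; tauto.
      + apply (Hsplit saq2); auto; apply HnW'; tauto.
    - replace (b * q * (a / k)) with (q * a * b / k) by (field; auto). apply HnP1. tauto.
    - replace (k ^ 2 / (a * b) * q * (a / k)) with (q * k / b) by (field; auto).
      apply HnP1. tauto.
    - replace (k ^ 2 / (a * b) * b * q) with ((k * sq_a) ^ 2).
      + apply (Hsplit (k * sq_a)); auto; apply HnP1; tauto.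
      + replace ((k * sq_a) ^ 2) with (k ^ 2 * sq_a ^ 2) by ring. rewrite Hsq_a. field. auto.
    - replace (k ^ 2 / (a * b) * b * (a / k) ^ 3 * q) with (a * q ^ 2 / (k * q / a))
        by (field; auto).
      apply nonvanishing_even_odd. apply HnW; tauto.
      replace (a * q ^ 2 / (k * q / a) * q) with (a * q ^ 2 / (k / a)) by (field; auto).
      apply HnW; tauto.
    - replace (k ^ 2 / (a * b) * b * (a / k) * q) with (k * q) by (field; auto).
      intros j. apply Hkq. tauto.
    - replace (q * (a / k)) with (q * a / k) by (unfold Cdiv; ring).
      intros j. apply Hkq. tauto. }
  set (A := k ^ 2 / (a * b)) in *. set (P := a / k) in *.
  assert (SL : sums (left_term q A b P sk)
    (phi (phi65_upper q a b k sk sqa) (phi65_lower q a b k sk sq_a) q (- (q * a / k)))).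
  { apply (tends_ext (csum (phi_term (phi65_upper q a b k sk sqa)
      (phi65_lower q a b k sk sq_a) q (- (q * a / k))))).
    - intros n. apply csum_ext. intros i _. unfold A, P. now apply phi_term_left.
    - apply sums_abs_convergent. exact (proj2 Hphi). }
  assert (S1 := tends_scal (qpochs_inf [k ^ 2 * q / (a * b); b * q;
    a ^ 2 * b * q ^ 2 / k ^ 2; q ^ 2 * a / b] (q ^ 2)) _ _
    (sums_abs_convergent _ (proj2 HW1))).
  assert (S2 := tends_scal (- (q * ((1 - a * q ^ 2) * (1 - k / a) * (1 - a / sk)
      * (1 + a * q / sk) / ((1 - q) * (1 - k * q) * (1 - sk * q) * (1 + sk))))
    * qpochs_inf [k ^ 2 / (a * b); b; a ^ 2 * b * q ^ 3 / k ^ 2; q ^ 3 * a / b] (q ^ 2))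
    _ _ (sums_abs_convergent _ (proj2 HW2))).
  assert (SR := sums_halves (right_term q A b P sk) _ _ _ _
    (fun m => right_term_even q a b k sk r1 r3 sa m Hq Ha Hb Hk Hq1 Hsk Hr1 Hr3 Hsa G HW1)
    (fun m => right_term_odd q a b k sk r3 r5 saq2 m Hq Ha Hb Hk Hq1 Hsk Hr3 Hr5 Hsaq2 G
       Hden HW2)
    (tends_ext _ _ _ (fun n => eq_sym (csum_scal _ _ n)) S1)
    (tends_ext _ _ _ (fun n => eq_sym (csum_scal _ _ n)) S2)).
  assert (HD : tends (fun N => csum (right_term q A b P sk) N
    - watson_den q A b P / qpoch_inf (A * b * P * q) q * csum (left_term q A b P sk) N) 0).
  { destruct (classic (nonvanishing (A * b * P ^ 2 * q) (q ^ 2))) as [Hodd|Hodd].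
    - apply nondegenerate_limit; auto. apply (left_term_convergent q A b P sk G Hodd).
      unfold abs_convergent in *. apply (ex_series_ext (fun n => Cmod (phi_term
        (phi65_upper q a b k sk sqa) (phi65_lower q a b k sk sq_a) q (- (q * a / k)) n))).
      + intros n. f_equal. unfold A, P. now apply phi_term_left.
      + exact (proj2 Hphi).
    - assert (HN : exists N, 1 - A * b * P ^ 2 * q * (q ^ 2) ^ N = 0).
      { apply NNPP. intros H. apply Hodd. intros j H0. apply H. now exists j. }
      destruct HN as [N HN]. apply (degenerate_limit _ _ _ _ _ N G).
      rewrite Cpow_mult_r.
      transitivity (1 - (1 - A * b * P ^ 2 * q * (q ^ 2) ^ N)). ring. rewrite HN. ring. }
  apply tends_double in HD.
  assert (HE := tends_unique _ _ _ HD (tends_minus _ _ _ _ SR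
    (tends_scal (watson_den q A b P / qpoch_inf (A * b * P * q) q) _ _ (tends_double _ _ SL)))).
  assert (HkI : qpoch_inf (k * q) q <> 0)
    by (apply qpoch_inf_neq0; auto; intros j; apply Hkq; tauto).
  assert (HPI : qpoch_inf (q * a / k) q <> 0)
    by (apply qpoch_inf_neq0; auto; intros j; apply Hkq; tauto).
  assert (Hpref : qpochs_inf [q * a * b / k; k * q / b] q
    * qpochs_inf [q; k ^ 2 * q / a; q ^ 2 * a; q ^ 2 * a ^ 2 / k ^ 2] (q ^ 2)
    / qpochs_inf [k * q; q * a / k] q
    = watson_den q A b P / qpoch_inf (A * b * P * q) q).
  { unfold qpochs_inf, watson_den. cbn [map Cprod fold_right].
    replace (A * b * P * q) with (k * q) by (unfold A, P; field; auto).
    replace (A * q * P) with (k * q / b) by (unfold A, P; field; auto).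
    replace (b * q * P) with (q * a * b / k) by (unfold P; field; auto).
    replace (A * b * q) with (k ^ 2 * q / a) by (unfold A; field; auto).
    replace (A * b * q ^ 2 * P ^ 2) with (q ^ 2 * a) by (unfold A, P; field; auto).
    replace (q * P) with (q * a / k) by (unfold P, Cdiv; ring).
    replace (q ^ 2 * a ^ 2 / k ^ 2) with ((q * a / k) ^ 2) by (field; auto).
    rewrite <- qpoch_inf_sq by exact Hq1.
    field. auto. }
  rewrite Hpref. unfold W, phi in *.
  match type of HE with _ = ?u - ?v => transitivity (u - (u - v)); [ring | rewrite <- HE; unfold A; ring] end.
Qed.
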